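(* (a) Let $g$ be a $2\pi$-periodic function of class $HBV$ (harmonic bounded variation on $[0,2\pi]$) and let $r\in\{0,1,2,\dots\}$. Then for every point $x_0\in\mathbb{R}$, $$\lim_{n\to\infty} n^{2r+1}R_n^{(-2r-1)}(g,x_0)=\frac{(-1)^{r+1}}{(2r+1)\pi}\bigl[g(x_0+0)-g(x_0-0)\bigr],$$ where $R_n(g,x)=\sum_{k=n}^{\infty}\bigl(a_k(g)\cos kx+b_k(g)\sin kx\bigr)$ is the $n$th order tail of the Fourier series of $g$ and $R_n^{(-2r-1)}(g,\cdot)$ is its $(2r+1)$-fold zero-mean antiderivative. (b) If $\Lambda$ is such that $\Lambda BV\supsetneqq HBV$, then assertion (a) does not hold for $\Lambda BV\setminus HBV$ in place of $HBV$; that is, there exist a $2\pi$-periodic $g\in\Lambda BV\setminus HBV$, an integer $r\ge 0$ and a point $x_0$ for which the limit relation displayed in (a) fails (the limit does not exist or does not equal the right-hand side).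
   Context: For a function $f$ and an interval $I=[a,b]$ write $f(I)=f(b)-f(a)$. Let $\Lambda=\{\lambda_n\}_{n\ge1}$ be a nondecreasing sequence of positive numbers tending to infinity such that $\sum 1/\lambda_n$ diverges. A function $f$ is of bounded $\Lambda$-variation on $[0,2\pi]$, written $f\in\Lambda BV$, if $\sup\sum_i |f(I_i)|/\lambda_i<\infty$, where the supremum is over all finite collections $I_1,I_2,\dots$ (in any order) of nonoverlapping subintervals of $[0,2\pi]$. The class $HBV$ is $\Lambda BV$ with $\Lambda=\{n\}$. Every function in a class $\Lambda BV$ has one-sided limits at each point; $g(x\pm0)$ denotes these limits (of the $2\pi$-periodic function). $a_k(g)=\frac1\pi\int_{-\pi}^{\pi}g(t)\cos kt\,dt$ and $b_k(g)=\frac1\pi\int_{-\pi}^{\pi}g(t)\sin kt\,dt$ are the Fourier coefficients. For an integrable $f$ on $[-\pi,\pi]$, $f^{(0)}=f$ and $f^{(-r-1)}=\int f^{(-r)}$, with the constants of integration successively determined by $\int_{-\pi}^{\pi}f^{(-r)}(t)\,dt=0$. Thus, for $n\ge1$, $$R_n^{(-2r-1)}(g,x)=(-1)^r\sum_{k=n}^{\infty}\frac{a_k(g)\sin kx-b_k(g)\cos kx}{k^{2r+1}}.$$ *)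

(* Defs.v *)
From mathcomp Require Import all_boot all_order all_algebra.
From mathcomp Require Import all_classical all_reals all_analysis.

Set Implicit Arguments.
Unset Strict Implicit.
Unset Printing Implicit Defensive.

Import Order.TTheory GRing.Theory Num.Theory.
Import numFieldNormedType.Exports.

Local Open Scope classical_set_scope.
Local Open Scope ring_scope.

(* An interval [a, b] is encoded as the pair (a, b).  Sequences (lambda_n)_{n >= 1}
   are indexed from 0: [lam n] stands for lambda_(n+1). *)

Definition incr (R : realType) (f : R -> R) (I : R * R) : R := f I.2 - f I.1.

Definition nonoverlapping (R : realType) (I J : R * R) : bool :=
  (I.2 <= J.1) || (J.2 <= I.1).

(* The list order is the order in which the weights 1/lambda_i are attached,
   so ranging over all such lists covers all orderings of a collection. *)
Definition interval_family (R : realType) : set (seq (R * R)) :=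
  [set s | all (fun I : R * R => [&& 0 <= I.1, I.1 < I.2 & I.2 <= pi *+ 2]) s
           && pairwise (@nonoverlapping R) s].

Definition Lambda_sequence (R : realType) (lam : nat -> R) : Prop :=
  [/\ {homo lam : m n / (m <= n)%N >-> m <= n},
      forall n, 0 < lam n,
      lam n @[n --> \oo] --> +oo
    & ~ cvgn (series (fun n => (lam n)^-1))].

Definition Lambda_variation (R : realType) (lam : nat -> R) (f : R -> R) : \bar R :=
  ereal_sup [set (\sum_(i < size s) `|incr f (nth (0, 0) s i)| / lam i)%:E
            | s in @interval_family R].

Definition LambdaBV (R : realType) (lam : nat -> R) : set (R -> R) :=
  [set f | (Lambda_variation lam f < +oo)%E].

Definition HBV (R : realType) : set (R -> R) :=
  LambdaBV (fun n : nat => n.+1%:R : R).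

Definition fourier_cos (R : realType) (g : R -> R) (k : nat) : R :=
  pi^-1 * \int[lebesgue_measure]_(t in `[- pi, pi]) (g t * cos (k%:R * t)).

Definition fourier_sin (R : realType) (g : R -> R) (k : nat) : R :=
  pi^-1 * \int[lebesgue_measure]_(t in `[- pi, pi]) (g t * sin (k%:R * t)).

Definition fourier_tail (R : realType) (g : R -> R) (n : nat) (x : R) : R :=
  limn (fun N => \sum_(n <= k < N)
    (fourier_cos g k * cos (k%:R * x) + fourier_sin g k * sin (k%:R * x))).

Definition oriented_integral (R : realType) (f : R -> R) (a b : R) : R :=
  if a <= b then \int[lebesgue_measure]_(t in `[a, b]) f t
  else - \int[lebesgue_measure]_(t in `[b, a]) f t.

(* The antiderivative of f whose integral over [-pi, pi] vanishes.  It is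
   defined on all of R; for f periodic of period 2 pi and of mean zero (such as
   the Fourier tails with n >= 1) it is the periodic extension of the
   antiderivative on [-pi, pi]. *)
Definition zero_mean_antiderivative (R : realType) (f : R -> R) (x : R) : R :=
  oriented_integral f 0 x
  - (pi *+ 2)^-1 *
    \int[lebesgue_measure]_(y in `[- pi, pi]) oriented_integral f 0 y.

(* [iter_antiderivative m f] is f^(-m). *)
Definition iter_antiderivative (R : realType) (m : nat) (f : R -> R) : R -> R :=
  iter m (@zero_mean_antiderivative R) f.

Definition jump (R : realType) (g : R -> R) (x : R) : R :=
  lim (g t @[t --> x^'+]) - lim (g t @[t --> x^'-]).

Definition tail_jump_relation (R : realType) (g : R -> R) (r : nat) (x0 : R) : Prop :=
  n%:R ^+ (r.*2.+1) * iter_antiderivative r.*2.+1 (fourier_tail g n) x0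
    @[n --> \oo] -->
  (- 1) ^+ r.+1 / (r.*2.+1%:R * pi) * jump g x0.

(* Main.v *)
(* Let K_n(t) = sum_(k >= n) sin(k t) / k, an antiderivative of minus the Dirichlet
   kernel.  Folding the Fourier integrals around x0 gives the numbers
     T_n = - (1/pi) int_0^pi (g(x0 + t) - g(x0 - t)) K_n(t) dt,
   for which T_n - T_(n+1) is the n-th Fourier term of the tail integrated once.
   Splitting (0, pi] into cells of length pi/n, on which the kernels oscillate,
   and applying Abel summation bounds their integrals against a function of
   bounded harmonic variation by that variation; the variation near 0 of
   a function vanishing at 0+ tends to 0.  Hence n T_n -> -(g(x0+) - g(x0-))/pi,
   the Fourier series of g converges boundedly, and a Stolz argument for
   sum_(k >= n) (T_k - T_(k+1)) / k^(2r) gives part (a).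

   For part (b), the inclusion being strict, H_n / sum_(i < n) 1/lambda_i is
   unbounded (H_n the harmonic sum).  The function g = sum_k c_k tcos(n_k, m_k)
   superposes cosines of frequency m_k - 1/2 cut off after n_k half periods, and
   m_k times the integral of the k-th one against K_(m_k) is about H_(n_k) / 2.
   With c_k sum_(i < n_k) 1/lambda_i = 2^-k, c_k H_(n_k) > 2^k and m_k growing
   fast enough for the other terms to contribute O(1), g lies in Lambda BV while
   the relation of part (a) fails at x0 = 0 with r = 0; in particular g is not
   in HBV. *)

Require Import Defs.
From mathcomp Require Import all_boot all_order all_algebra.
From mathcomp Require Import all_classical all_reals all_analysis.
From mathcomp Require Import measurable_realfun.
From mathcomp Require Import ring lra zify.

Set Implicit Arguments.
Unset Strict Implicit.
Unset Printing Implicit Defensive.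

Import Order.TTheory GRing.Theory Num.Theory.
Import numFieldNormedType.Exports.

Local Open Scope classical_set_scope.
Local Open Scope ring_scope.

(** * Weighted sums over lists *)

(** The kernels [dirichlet n] and [n * sine_tail n] obey the same three bounds ([oscillatory]), so
    one cell estimate serves both the convergence of the Fourier series and the asymptotics of T_n.
    The constant comes from the integral of K_n over [0, pi], the sum of (1 - (-1)^k) / k^2 over k
    >= n, which is equivalent to 1/n. No asymptotics is known for T_k - T_(k+1) itself, so Abel
    summation brings back T_k before the Stolz argument.

    [fourier_tail] is a limit, hence informative only where the series is known to converge. For
    part (a) the partial sums must be bounded uniformly in x and n, and functions in HBV shown
    measurable, before antiderivatives can be taken term by term. For part (b) the counterexample
    lies outside the class where convergence is proved: its tail is found only at the points of
    (-pi, pi) other than 0, by localization, from the sums [hump_sum M], which have bounded harmonic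
    variation, converge uniformly and eventually agree with the limit away from 0. The
    antiderivative does not see the missing points. *)

Section WeightedSum.
Variable R : realFieldType.

(** The weights shift along the list, so that each fact is an induction on [s] generalized over [w];
    [wsumE] gives back the indexed sum of [Lambda_variation]. *)
Fixpoint wsum (T : Type) (w : nat -> R) (d : T -> R) (s : seq T) : R :=
  if s is x :: s' then d x * w 0%N + wsum (w \o succn) d s' else 0.

Lemma wsumE (T : Type) (x0 : T) (w : nat -> R) (d : T -> R) (s : seq T) :
  wsum w d s = \sum_(i < size s) d (nth x0 s i) * w i.
Proof.
elim: s w => [|x s IH] w /=; first by rewrite big_ord0.
by rewrite big_ord_recl /= IH.
Qed.

Lemma wsum_ge0 (T : Type) (w : nat -> R) (d : T -> R) (s : seq T) :
  (forall i, 0 <= w i) -> (forall x, 0 <= d x) -> 0 <= wsum w d s.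
Proof.
by elim: s w => [|x s IH] w w0 d0 //=; rewrite addr_ge0 ?mulr_ge0 ?IH // => i /=.
Qed.

Lemma wsum_le_weight (T : Type) (w w' : nat -> R) (d : T -> R) (s : seq T) :
  (forall i, w i <= w' i) -> (forall x, 0 <= d x) -> wsum w d s <= wsum w' d s.
Proof.
elim: s w w' => [|x s IH] w w' ww' d0 //=.
by rewrite lerD ?ler_wpM2l ?IH // => i /=.
Qed.

Lemma wsum_le (T : Type) (w : nat -> R) (d d' : T -> R) (s : seq T) :
  (forall i, 0 <= w i) -> (forall x, d x <= d' x) -> wsum w d s <= wsum w d' s.
Proof.
elim: s w => [|x s IH] w w0 dd' //=.
by rewrite lerD ?ler_wpM2r ?IH // => i /=.
Qed.

Lemma wsumD (T : Type) (w : nat -> R) (d d' : T -> R) (s : seq T) :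
  wsum w (fun x => d x + d' x) s = wsum w d s + wsum w d' s.
Proof. by elim: s w => [|x s IH] w /=; rewrite ?IH; ring. Qed.

Lemma wsumZ (T : Type) (w : nat -> R) (c : R) (d : T -> R) (s : seq T) :
  wsum w (fun x => c * d x) s = c * wsum w d s.
Proof. by elim: s w => [|x s IH] w /=; rewrite ?IH; ring. Qed.

Lemma wsum_map (T T' : Type) (h : T' -> T) (w : nat -> R) (d : T -> R) s :
  wsum w d (map h s) = wsum w (d \o h) s.
Proof. by elim: s w => [|x s IH] w //=; rewrite IH. Qed.

Lemma wsum_cat (T : Type) (w : nat -> R) (d : T -> R) (s1 s2 : seq T) :
  wsum w d (s1 ++ s2) = wsum w d s1 + wsum (fun i => w (size s1 + i)%N) d s2.
Proof.
elim: s1 w => [|x s IH] w /=; first by rewrite add0r.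
by rewrite IH /= addrA.
Qed.

(** Deleting entries moves the remaining ones to earlier places, where nonincreasing weights are
    heavier. *)
Lemma wsum_filter (T : Type) (p : pred T) (w : nat -> R) (d : T -> R) s :
  (forall i, w i.+1 <= w i) -> (forall x, 0 <= d x) ->
  wsum w d s <= wsum w d [seq x <- s | p x] + wsum w d [seq x <- s | ~~ p x].
Proof.
elim: s w => [|x s IH] w wS d0 /=; first by rewrite addr0.
have /= IHw := IH (w \o succn) (fun i => wS i.+1) d0.
have shift t : wsum (w \o succn) d t <= wsum w d t by exact: wsum_le_weight.
case: ifP => px /=.
  by have := shift [seq x <- s | ~~ p x]; lra.
by have := shift [seq x <- s | p x]; lra.
Qed.

Lemma wsum_filter_supp (T : Type) (p : pred T) (w : nat -> R) (d : T -> R) s :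
  (forall i, w i.+1 <= w i) -> (forall x, 0 <= d x) ->
  (forall x, ~~ p x -> d x = 0) ->
  wsum w d s <= wsum w d [seq x <- s | p x].
Proof.
move=> wS d0 dp; apply: le_trans (wsum_filter p _ wS d0) _.
suff -> : wsum w d [seq x <- s | ~~ p x] = 0 by rewrite addr0.
elim: s w {wS} => [|x s IH] w //=; case: ifP => //= npx.
by rewrite dp // IH mul0r addr0.
Qed.

Lemma wsum_ge_sum (T : Type) (w : nat -> R) (d : T -> R) (e : R) s :
  (forall i, 0 <= w i) -> all (fun x => e <= d x) s ->
  e * (\sum_(i < size s) w i) <= wsum w d s.
Proof.
elim: s w => [|x s IH] w w0 /=; first by rewrite big_ord0 mulr0.
move=> /andP[ex es]; rewrite big_ord_recl mulrDr lerD //; first by rewrite ler_wpM2r.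
by apply: (IH (w \o succn)) => // i; exact: w0.
Qed.

Lemma wsum_le_sum (T : Type) (w : nat -> R) (d : T -> R) (e : R) s :
  (forall i, 0 <= w i) -> all (fun x => d x <= e) s ->
  wsum w d s <= e * (\sum_(i < size s) w i).
Proof.
elim: s w => [|x s IH] w w0 /=; first by rewrite big_ord0 mulr0.
move=> /andP[ex es]; rewrite big_ord_recl mulrDr lerD //; first by rewrite ler_wpM2r.
by apply: (IH (w \o succn)) => // i; exact: w0.
Qed.

(* The weights beyond index [N] are at most those before it, so mass can only
   be gained by moving it to the first [N] places, filled up to [e]. *)
Lemma wsum_le_cap (T : Type) (w : nat -> R) (d : T -> R) (e : R) (N : nat) s :
  (forall i, 0 <= w i) -> (forall i, w i.+1 <= w i) ->
  (forall x, 0 <= d x <= e) -> \sum_(x <- s) d x <= e * N%:R ->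
  wsum w d s <= e * \sum_(i < N) w i.
Proof.
move=> w0 wS dE sN.
have e0 : 0 <= e \/ s = [::].
  by case: s sN => [|x s] _; [right|left; have /andP[/le_trans] := dE x; apply].
case: e0 => [e0|s0]; last first.
  move: sN; rewrite s0 /=; case: N => [|N]; first by rewrite big_ord0 mulr0.
  rewrite big_nil pmulr_lge0 // => e0; rewrite mulr_ge0 // sumr_ge0 //.
(* The induction needs a form free of the bound on the total mass: mass in excess of [e * N], of
   either sign, is charged at the marginal weight [w N]. *)
suff : wsum w d s <= e * \sum_(i < N) w i + w N * (\sum_(x <- s) d x - e * N%:R).
  by move/le_trans; apply; rewrite gerDl mulr_ge0_le0 // subr_le0.
elim: s N w w0 wS {sN} => [|x s IH] N w w0 wS /=.
  rewrite big_nil sub0r mulrN subr_ge0 mulrCA ler_wpM2l //.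
  rewrite mulr_natr (_ : w N *+ N = \sum_(i < N) w N); last first.
    by rewrite sumr_const card_ord.
  rewrite ler_sum // => i _; exact: ((nonincreasing_seqP w).1 wS _ _ (ltnW (ltn_ord i))).
rewrite big_cons; have /andP[dx0 dxe] := dE x.
case: N => [|N].
  rewrite big_ord0 !mulr0 add0r subr0 mulrDr [_ * d x]mulrC lerD2l.
  have := IH 0%N (w \o succn) (fun i => w0 i.+1) (fun i => wS i.+1).
  rewrite big_ord0 !mulr0 add0r subr0 /= => /le_trans; apply.
  by rewrite ler_wpM2r // sumr_ge0 // => y _; have /andP[] := dE y.
have := IH N (w \o succn) (fun i => w0 i.+1) (fun i => wS i.+1).
rewrite big_ord_recl /=; set A := \sum_(x <- s) _.
set B := \sum_(i < N) w _.
have wN : w N.+1 <= w 0%N.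
  exact: ((nonincreasing_seqP w).1 wS _ _ (leq0n N.+1)).
rewrite -[N.+1%:R]natr1.
have : (e - d x) * w N.+1 <= (e - d x) * w 0%N by rewrite ler_wpM2l // subr_ge0.
by move=> h1 h2; nra.
Qed.

End WeightedSum.

(** * Oriented integrals of locally bounded measurable functions *)

Section Calculus.
Variable R : realType.
Implicit Types (f g F G : R -> R) (a b c x t : R).

(** Lets the rules below compute a derivative and leaves its comparison with the wanted value to
    [ring] or [field]. *)
Lemma der_eq f x df df' : is_derive x 1 f df -> df = df' -> is_derive x 1 f df'.
Proof. by move=> ? <-. Qed.

Lemma derD f g x df dg : is_derive x 1 f df -> is_derive x 1 g dg ->
  is_derive x 1 (fun t => f t + g t) (df + dg).
Proof. exact: is_deriveD. Qed.

Lemma derN f x df : is_derive x 1 f df -> is_derive x 1 (fun t => - f t) (- df).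
Proof. exact: is_deriveN. Qed.

Lemma derB f g x df dg : is_derive x 1 f df -> is_derive x 1 g dg ->
  is_derive x 1 (fun t => f t - g t) (df - dg).
Proof. exact: is_deriveB. Qed.

Lemma derM f g x df dg : is_derive x 1 f df -> is_derive x 1 g dg ->
  is_derive x 1 (fun t => f t * g t) (f x * dg + g x * df).
Proof. exact: is_deriveM. Qed.

Lemma derZ f x df c : is_derive x 1 f df ->
  is_derive x 1 (fun t => c * f t) (c * df).
Proof. exact: is_deriveZ. Qed.

Lemma derV f x df : f x != 0 -> is_derive x 1 f df ->
  is_derive x 1 (fun t => (f t)^-1) (- (f x) ^- 2 * df).
Proof. exact: is_deriveV. Qed.

Lemma der_cst c x : is_derive x 1 (fun=> c) 0.
Proof. exact: is_derive_cst. Qed.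

Lemma der_id x : is_derive x 1 (fun t => t) 1.
Proof. exact: is_derive_id. Qed.

Lemma der_comp f g x df dg : is_derive x 1 g dg -> is_derive (g x) 1 f df ->
  is_derive x 1 (fun t => f (g t)) (df * dg).
Proof. by move=> dg' df'; exact: is_derive1_comp df' dg'. Qed.

Lemma der_sinZ c x : is_derive x 1 (fun t => sin (c * t)) (c * cos (c * x)).
Proof.
by apply: der_eq (der_comp (derZ c (der_id x)) (is_derive_sin _)) _; rewrite mulr1 mulrC.
Qed.

Lemma der_cosZ c x : is_derive x 1 (fun t => cos (c * t)) (- (c * sin (c * x))).
Proof.
by apply: der_eq (der_comp (derZ c (der_id x)) (is_derive_cos _)) _; rewrite mulr1 mulNr mulrC.
Qed.

Lemma der_sum (I : Type) (s : seq I) (h dh : I -> R -> R) x :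
  (forall i, is_derive x 1 (h i) (dh i x)) ->
  is_derive x 1 (fun t => \sum_(i <- s) h i t) (\sum_(i <- s) dh i x).
Proof.
move=> hd; elim: s => [|i s IH].
  rewrite big_nil (_ : (fun t => _) = fun=> 0); first exact: der_cst.
  by apply/funext => t; rewrite big_nil.
rewrite big_cons (_ : (fun t => _) = fun t => h i t + \sum_(i <- s) h i t).
  exact: derD.
by apply/funext => t; rewrite big_cons.
Qed.

Lemma der_cont f x df : is_derive x 1 f df -> {for x, continuous f}.
Proof. by move=> [fx _]; apply/differentiable_continuous/derivable1_diffP. Qed.

Lemma der_within_cont f df a b : (forall x, a <= x <= b -> is_derive x 1 f (df x)) ->
  {within `[a, b], continuous f}.
Proof.
move=> fd; apply: continuous_in_subspaceT => x; rewrite inE /= in_itv /= => xab.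
exact: der_cont (fd x xab).
Qed.

Lemma der_ge0_le f df a b : a <= b ->
  (forall x, a <= x <= b -> is_derive x 1 f (df x)) ->
  (forall x, a < x < b -> 0 <= df x) -> f a <= f b.
Proof.
move=> ab fd df0; apply: (@ger0_derive1_le_cc R f a b) => //.
- move=> x; rewrite in_itv /= => /andP[ax xb].
  by case: (fd x _) => //; rewrite !ltW.
- move=> x; rewrite in_itv /= => /andP[ax xb]; rewrite derive1E.
  have [|_ ->] := fd x; first by rewrite !ltW.
  by rewrite df0 // ax.
- exact: der_within_cont fd.
- by rewrite in_itv /= lexx ab.
- by rewrite in_itv /= lexx ab.
Qed.

Lemma der_le_le f g df dg a b : a <= b ->
  (forall x, a <= x <= b -> is_derive x 1 f (df x)) ->
  (forall x, a <= x <= b -> is_derive x 1 g (dg x)) ->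
  (forall x, a < x < b -> df x <= dg x) -> f b - f a <= g b - g a.
Proof.
move=> ab fd gd fg.
suff : g a - f a <= g b - f b by lra.
apply: (@der_ge0_le (fun t => g t - f t) (fun t => dg t - df t)) => // x xab.
  by apply: derB; [exact: gd|exact: fd].
by rewrite subr_ge0 fg.
Qed.

(** Both [g - f] and [g + f] are nondecreasing. With an explicit primitive [g] of the majorant, the
    estimates of oscillatory integrals below become pointwise inequalities. *)
Lemma der_norm_le f g df dg a b : a <= b ->
  (forall x, a <= x <= b -> is_derive x 1 f (df x)) ->
  (forall x, a <= x <= b -> is_derive x 1 g (dg x)) ->
  (forall x, a < x < b -> `|df x| <= dg x) -> `|f b - f a| <= g b - g a.
Proof.
move=> ab fd gd fg; rewrite ler_norml; apply/andP; split; last first.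
  by apply: der_le_le ab fd gd _ => x /fg; rewrite ler_norml => /andP[].
suff : - f b - - f a <= g b - g a by lra.
apply: (@der_le_le (fun t => - f t) g (fun t => - df t) dg) => // [x xab|x /fg].
  by apply: derN; exact: fd.
by rewrite ler_norml => /andP[]; lra.
Qed.

End Calculus.

Section Tame.
Variable R : realType.
Implicit Types (f g F G : R -> R) (a b c x t : R).
Local Notation mu := (@lebesgue_measure R).
Local Notation oint := (@oriented_integral R).

(** This class is stable under products and continuous substitutions, and its members are integrable
    on every compact interval, so integrability follows from the shape of the integrand. *)
Definition tame f := measurable_fun setT f /\
  forall M, exists C, forall x, `|x| <= M -> `|f x| <= C.

Lemma continuous_tame f : continuous f -> tame f.
Proof.
move=> cf; split; first exact: continuous_measurable_fun.
move=> M; have /compact_bounded[N [_ hN]] : compact (f @` `[- M, M]).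
  apply: continuous_compact; last exact: segment_compact.
  exact: continuous_subspaceT.
exists (N + 1) => x; rewrite ler_norml => xM.
apply: (hN (N + 1)); first by rewrite ltrDl.
by exists x.
Qed.

Lemma tame_cst c : tame (fun=> c).
Proof. by apply: continuous_tame => x; exact: cvg_cst. Qed.

Lemma tameD f g : tame f -> tame g -> tame (fun x => f x + g x).
Proof.
move=> [mf bf] [mg bg]; split; first exact: measurable_funD.
move=> M; have [C hC] := bf M; have [D hD] := bg M; exists (C + D) => x xM.
by rewrite (le_trans (ler_normD _ _)) // lerD ?hC ?hD.
Qed.

Lemma tameM f g : tame f -> tame g -> tame (fun x => f x * g x).
Proof.
move=> [mf bf] [mg bg]; split; first exact: measurable_funM.
move=> M; have [C hC] := bf M; have [D hD] := bg M; exists (C * D) => x xM.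
by rewrite normrM ler_pM ?hC ?hD.
Qed.

Lemma tameZ c f : tame f -> tame (fun x => c * f x).
Proof. by move=> ?; apply: tameM => //; exact: tame_cst. Qed.

Lemma tameN f : tame f -> tame (fun x => - f x).
Proof. by move/(tameZ (-1)); under eq_fun do rewrite mulN1r. Qed.

Lemma tameB f g : tame f -> tame g -> tame (fun x => f x - g x).
Proof. by move=> ? ?; apply: tameD => //; exact: tameN. Qed.

Lemma tame_sum (I : Type) (s : seq I) (h : I -> R -> R) :
  (forall i, tame (h i)) -> tame (fun x => \sum_(i <- s) h i x).
Proof.
move=> th; elim: s => [|i s IH].
  by under eq_fun do rewrite big_nil; exact: tame_cst.
by under eq_fun do rewrite big_cons; exact: tameD.
Qed.

Lemma tame_norm f : tame f -> tame (fun x => `|f x|).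
Proof.
move=> [mf bf]; split; first exact: measurableT_comp.
by move=> M; have [C hC] := bf M; exists C => x xM; rewrite normr_id hC.
Qed.

Lemma tame_comp f g : tame f -> continuous g -> tame (fun x => f (g x)).
Proof.
move=> [mf bf] cg; split.
  by apply: measurableT_comp => //; exact: continuous_measurable_fun.
move=> M; have [_ /(_ M)[C hC]] := continuous_tame cg.
by have [D hD] := bf C; exists D => x xM; rewrite hD // hC.
Qed.

Lemma tame_shift f c : tame f -> tame (fun x => f (c + x)).
Proof.
by move=> ?; apply: tame_comp => // x; apply: cvgD; [exact: cvg_cst|exact: cvg_id].
Qed.

Lemma tame_flip f c : tame f -> tame (fun x => f (c - x)).
Proof.
move=> ?; apply: tame_comp => // x; apply: cvgB; [exact: cvg_cst|exact: cvg_id].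
Qed.

Lemma tame_integrable f a b : tame f -> mu.-integrable `[a, b] (EFin \o f).
Proof.
move=> [mf bf]; apply: measurable_bounded_integrable => //.
- exact/compact_finite_measure/segment_compact.
- exact: measurable_funS mf.
have [C hC] := bf (Num.max `|a| `|b|).
exists C; split; first exact: num_real.
move=> D CD x /=; rewrite in_itv /= => /andP[ax xb].
apply: le_trans (ltW CD); apply: hC.
have := ler_norm (- a); have := ler_norm b; rewrite normrN ler_norml.
have : `|a| <= Num.max `|a| `|b| by rewrite le_max lexx.
have : `|b| <= Num.max `|a| `|b| by rewrite le_max lexx orbT.
by lra.
Qed.


Lemma integral_itv_oo f a b : measurable_fun `]a, b[ f ->
  \int[mu]_(t in `[a, b]) f t = \int[mu]_(t in `]a, b[) f t.
Proof.
move=> mf; rewrite /Rintegral -integral_itv_obnd_cbnd; last first.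
  exact/measurable_EFinP/measurable_fun_itv_bndo_bndcP.
by rewrite -integral_itv_bndo_bndc //; exact/measurable_EFinP.
Qed.

(** On the open interval [g] inherits measurability from [f], and the endpoints are negligible. This
    serves the Fourier tails, which are known only through a formula off some points. *)
Lemma eq_integral_itv f g a b : tame f -> (forall x, a < x < b -> f x = g x) ->
  \int[mu]_(t in `[a, b]) f t = \int[mu]_(t in `[a, b]) g t.
Proof.
move=> [mf _] fg; have fg' : {in `]a, b[%classic, f =1 g}.
  by move=> x; rewrite inE /= in_itv /= => /fg.
have mf' : measurable_fun `]a, b[ f by exact: measurable_funS mf.
rewrite !integral_itv_oo //; first exact: eq_Rintegral.
exact: eq_measurable_fun mf'.
Qed.

Lemma oint_le_ab f a b : a <= b -> oint f a b = \int[mu]_(t in `[a, b]) f t.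
Proof. by rewrite /oriented_integral => ->. Qed.

Lemma oint_nn f a : oint f a a = 0.
Proof. by rewrite oint_le_ab // set_itv1 Rintegral_set1. Qed.

Lemma oint_swap f a b : oint f b a = - oint f a b.
Proof.
rewrite /oriented_integral; case: (ltgtP a b) => //; rewrite ?opprK // => ->.
by rewrite set_itv1 Rintegral_set1 oppr0.
Qed.

Lemma eq_oint_oo f g a b : tame f ->
  (forall x, Num.min a b < x < Num.max a b -> f x = g x) ->
  oint f a b = oint g a b.
Proof.
move=> tf fg; rewrite /oriented_integral; case: (leP a b) fg => ab fg.
  exact: eq_integral_itv.
by congr (- _); exact: eq_integral_itv.
Qed.

Lemma eq_oint f g a b : f =1 g -> oint f a b = oint g a b.
Proof. by move=> /funext ->. Qed.

Lemma ointD f g a b : tame f -> tame g ->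
  oint (fun x => f x + g x) a b = oint f a b + oint g a b.
Proof.
move=> tf tg; rewrite /oriented_integral; case: leP => ab.
  by rewrite RintegralD //; exact: tame_integrable.
by rewrite RintegralD ?opprD //; exact: tame_integrable.
Qed.

Lemma ointZ f c a b : tame f -> oint (fun x => c * f x) a b = c * oint f a b.
Proof.
move=> tf; rewrite /oriented_integral; case: leP => ab.
  by rewrite RintegralZl //; exact: tame_integrable.
by rewrite RintegralZl ?mulrN //; exact: tame_integrable.
Qed.

Lemma ointN f a b : tame f -> oint (fun x => - f x) a b = - oint f a b.
Proof. by move=> tf; rewrite -mulN1r -ointZ //; apply: eq_oint => x; rewrite mulN1r. Qed.

Lemma ointB f g a b : tame f -> tame g ->
  oint (fun x => f x - g x) a b = oint f a b - oint g a b.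
Proof. by move=> tf tg; rewrite -ointN // -ointD //; exact: tameN. Qed.

Lemma oint_sum (I : Type) (s : seq I) (h : I -> R -> R) a b :
  (forall i, tame (h i)) ->
  oint (fun x => \sum_(i <- s) h i x) a b = \sum_(i <- s) oint (h i) a b.
Proof.
move=> th; elim: s => [|i s IH].
  rewrite big_nil -[RHS](mul0r (oint (fun=> 0) a b)) -ointZ; last exact: tame_cst.
  by apply: eq_oint => x; rewrite big_nil mul0r.
rewrite big_cons -IH -ointD //; last exact: tame_sum.
by apply: eq_oint => x; rewrite big_cons.
Qed.

Lemma le_oint f g a b : a <= b -> tame f -> tame g ->
  (forall x, a < x < b -> f x <= g x) -> oint f a b <= oint g a b.
Proof.
move=> ab tf tg fg.
have ioo h : tame h -> mu.-integrable `]a, b[ (EFin \o h).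
  by move=> th; apply: integrableS (tame_integrable a b th) => //; exact: subset_itv_oo_cc.
have moo h : tame h -> measurable_fun `]a, b[ h.
  by case=> mh _; exact: measurable_funS mh.
rewrite !oint_le_ab // !integral_itv_oo; [|exact: moo..].
apply: le_Rintegral; [by []|exact: ioo|exact: ioo|].
by move=> x /=; rewrite in_itv /= => /fg.
Qed.

Lemma oint_cst c a b : oint (fun=> c) a b = c * (b - a).
Proof.
wlog ab : a b / a <= b => [hw|].
  by case: (leP a b) => [/hw //|/ltW /hw]; rewrite oint_swap; nra.
rewrite oint_le_ab // Rintegral_cst //= lebesgue_measure_itv /= lte_fin.
case: ltP => //= ba; rewrite (_ : a = b) ?subrr //.
by apply/le_anti; rewrite ab ba.
Qed.

Lemma norm_oint f a b : a <= b -> tame f ->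
  `|oint f a b| <= oint (fun x => `|f x|) a b.
Proof.
move=> ab tf; rewrite !oint_le_ab //.
by apply: le_normr_Rintegral => //; exact: tame_integrable.
Qed.

Lemma norm_oint_le f C a b : a <= b -> tame f ->
  (forall x, a < x < b -> `|f x| <= C) -> `|oint f a b| <= C * (b - a).
Proof.
move=> ab tf fC; rewrite -oint_cst; apply: le_trans (norm_oint ab tf) _.
by apply: le_oint fC => //; [exact: tame_norm|exact: tame_cst].
Qed.

Lemma oint_add_le f a b c : tame f -> a <= b -> b <= c ->
  oint f a c = oint f a b + oint f b c.
Proof.
move=> tf ab bc; rewrite !oint_le_ab ?(le_trans ab) //.
have fi : mu.-integrable `[a, c] (EFin \o f) by exact: tame_integrable.
have := @Rintegral_itvB R f (BLeft a) (BRight c) b fi.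
rewrite !bnd_simp => /(_ ab bc) h; apply/eqP; rewrite addrC -subr_eq; apply/eqP.
rewrite h Rintegral_itv_obnd_cbnd //.
by apply: integrableS fi => //; apply: subset_itv; rewrite bnd_simp.
Qed.

Lemma oint_add f a b c : tame f -> oint f a c = oint f a b + oint f b c.
Proof.
move=> tf; have add := oint_add_le tf.
have sw x y := oint_swap f x y.
case: (leP a b) => ab; case: (leP b c) => bc; case: (leP a c) => ac.
- exact: add.
- by lra.
- by have := add _ _ _ ac (ltW bc); have := sw b c; lra.
- by have := add _ _ _ (ltW ac) ab; have := sw b c; have := sw a c; lra.
- by have := add _ _ _ (ltW ab) ac; have := sw a b; lra.
- by have := add _ _ _ bc (ltW ac); have := sw a b; have := sw a c; lra.
- by lra.
- by have := add _ _ _ (ltW bc) (ltW ab); have := sw a b; have := sw a c;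
    have := sw b c; lra.
Qed.

End Tame.

(** * Change of variable, the fundamental theorem and bounded convergence *)

Section ChangeOfVariable.
Variable R : realType.
Implicit Types (f g F G : R -> R) (a b c x t : R).
Local Notation mu := (@lebesgue_measure R).
Local Notation oint := (@oriented_integral R).

Lemma Rintegral_preserving (phi : R -> measurableTypeR R) f (D : set R) :
  measurable_fun setT phi ->
  (forall A, measurable A -> pushforward mu phi A = mu A) ->
  measurable D -> measurable_fun setT f ->
  mu.-integrable (phi @^-1` D) (EFin \o (f \o phi)) ->
  \int[mu]_(x in D) f x = \int[mu]_(x in phi @^-1` D) f (phi x).
Proof.
move=> mphi phimu mD mf intf; rewrite /Rintegral; congr fine.
transitivity (\int[pushforward mu phi]_(x in D) (EFin \o f) x)%E.
  by apply: eq_measure_integral => //= A mA AS; exact/esym/phimu.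
by apply: integral_pushforward => //; exact/measurable_EFinP.
Qed.

(** By uniqueness of Lebesgue measure: the pushforward gives half-open intervals their length. *)
Lemma lebesgue_measure_shift c (A : set R) : measurable A ->
  pushforward mu (fun x : R => c + x : measurableTypeR R) A = mu A.
Proof.
move=> mA.
have mphi : measurable_fun setT (fun x : R => c + x : measurableTypeR R).
  by apply: continuous_measurable_fun => x; apply: cvgD; [exact: cvg_cst|exact: cvg_id].
apply/esym.
apply: (@lebesgue_measure_unique R
  (measure_function_pushforward__canonical__measure_function_Measure mu mphi)) => //= _ [[a b]] _ <-.
rewrite /pushforward /=.
rewrite (_ : (fun x : R => _) @^-1` _ = `]a - c, b - c]%classic).
  rewrite !lebesgue_measure_itv /= !lte_fin ltrD2r.
  by case: ifP => // _; rewrite -!EFinB; congr EFin; ring.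
by apply/seteqP; split => x /=; rewrite !in_itv /= ltrBlDl lerBrDl.
Qed.

Lemma oint_shift f c a b : tame f ->
  oint (fun x => f (c + x)) a b = oint f (c + a) (c + b).
Proof.
move=> tf.
have key u v : \int[mu]_(t in `[c + u, c + v]) f t = \int[mu]_(t in `[u, v]) f (c + t).
  have pre : (fun x : R => c + x) @^-1` `[c + u, c + v] = `[u, v]%classic.
    by apply/seteqP; split => x /=; rewrite !in_itv /= !lerD2l.
  rewrite (@Rintegral_preserving (fun x => c + x)) //=.
  - by rewrite pre.
  - by apply: continuous_measurable_fun => x; apply: cvgD; [exact: cvg_cst|exact: cvg_id].
  - exact: lebesgue_measure_shift.
  - by case: tf.
  - by rewrite pre; apply: tame_integrable; exact: tame_shift.
by rewrite /oriented_integral lerD2l !key.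
Qed.

Lemma oint_flip f a b : tame f -> oint (fun x => f (- x)) a b = oint f (- b) (- a).
Proof.
move=> tf.
have key u v : \int[mu]_(t in `[- v, - u]) f t = \int[mu]_(t in `[u, v]) f (- t).
  have pre : (fun x : R => - x) @^-1` `[- v, - u] = `[u, v]%classic.
    by apply/seteqP; split => x /=; rewrite !in_itv /= !lerN2 andbC.
  rewrite (@Rintegral_preserving (fun x => - x)) //=.
  - by rewrite pre.
  - by apply: continuous_measurable_fun => x; apply: cvgN; exact: cvg_id.
  - exact: lebesgue_measureN.
  - by case: tf.
  - rewrite pre; apply: tame_integrable; have := tame_flip 0 tf.
    by under eq_fun do rewrite sub0r.
by rewrite /oriented_integral lerN2 !key.
Qed.

Lemma oint_FTC f F a b : a <= b -> {within `[a, b], continuous f} ->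
  (forall x, a <= x <= b -> is_derive x 1 F (f x)) -> oint f a b = F b - F a.
Proof.
rewrite le_eqVlt => /predU1P[->|ab] cf dF; first by rewrite oint_nn subrr.
have cF x : a <= x <= b -> F y @[y --> x] --> F x by move=> /dF /der_cont.
rewrite oint_le_ab ?ltW // /Rintegral (@continuous_FTC2 _ _ F) //.
- split.
  + by move=> x; rewrite in_itv /= => /andP[ax xb]; case: (dF x); rewrite ?ltW.
  + by apply: cvg_at_right_filter; apply: cF; rewrite lexx ltW.
  + by apply: cvg_at_left_filter; apply: cF; rewrite lexx ltW.
- move=> x; rewrite in_itv /= => /andP[ax xb]; rewrite derive1E.
  by case: (dF x); rewrite ?ltW.
Qed.

Lemma oint_FTC_all f F a b : continuous f ->
  (forall x, is_derive x 1 F (f x)) -> oint f a b = F b - F a.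
Proof.
move=> cf dF; case: (leP a b) => [ab|/ltW ab]; last rewrite oint_swap -opprB; last congr (- _).
  by apply: oint_FTC => //; exact: continuous_subspaceT.
by apply: oint_FTC => //; exact: continuous_subspaceT.
Qed.

Lemma oint_lipschitz f a M : tame f -> exists2 C, 0 <= C & forall x y,
  `|x| <= M -> `|y| <= M -> `|oint f a x - oint f a y| <= C * `|x - y|.
Proof.
move=> tf; have [_ /(_ M)[C hC]] := tf; exists (Num.max C 0); first by rewrite le_max lexx orbT.
have hC' z : `|z| <= M -> `|f z| <= Num.max C 0 by move=> /hC h; rewrite le_max h.
move: (Num.max C 0) hC' => {hC}C hC x y.
wlog xy : x y / x <= y => [hw xM yM|xM yM].
  case: (leP x y) => [xy|/ltW xy]; first exact: hw.
  by rewrite distrC [`|x - y|]distrC; exact: hw.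
rewrite (oint_add a x y tf) opprD addrA subrr sub0r normrN distrC.
rewrite (ger0_norm (_ : 0 <= y - x)) ?subr_ge0 //.
apply: norm_oint_le => // z /andP[xz zy]; apply: hC.
by move: xM yM; rewrite !ler_norml; lra.
Qed.

Lemma oint_continuous f a : tame f -> continuous (oint f a).
Proof.
move=> tf x; have [C C0 hC] := oint_lipschitz a (`|x| + 1) tf.
apply/cvgrPdist_le => e e0; near=> y.
have xy : `|x - y| <= Num.min 1 (e / (C + 1)).
  near: y; apply: cvgr_dist_le; first exact: cvg_id.
  by rewrite lt_min ltr01 divr_gt0 // ltr_pwDr.
have := hC x y; rewrite lerDl ler01 => /(_ isT) h.
apply: le_trans (h _) _.
  have -> : y = x - (x - y) by rewrite opprB addrC subrK.
  by rewrite (le_trans (ler_normB _ _)) // lerD2l (le_trans xy) // ge_min lexx.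
have : `|x - y| <= e / (C + 1) by rewrite (le_trans xy) // ge_min lexx orbT.
rewrite ler_pdivlMr ?ltr_pwDr // => h'.
by have := normr_ge0 (x - y); nra.
Unshelve. all: by end_near. Qed.

Lemma tame_oint f a : tame f -> tame (oint f a).
Proof. by move=> /oint_continuous /continuous_tame; apply. Qed.

(** The form of dominated convergence that survives antiderivation: constants dominate on compact
    intervals, and primitives are again bounded there uniformly in [n]. It can thus be iterated
    [2r + 1] times. *)
Definition bounded_cvg (f_ : nat -> R -> R) f :=
  [/\ forall n, tame (f_ n),
      forall M, exists C, forall n x, `|x| <= M -> `|f_ n x| <= C
    & forall x, f_ n x @[n --> \oo] --> f x].

Lemma bounded_cvg_tame (f_ : nat -> R -> R) f : bounded_cvg f_ f -> tame f.
Proof.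
move=> [tf bf cf]; split.
  apply: (@measurable_fun_cvg _ _ R setT f_); first by move=> m; case: (tf m).
  by move=> x _; exact: cf.
move=> M; have [C hC] := bf M; exists C => x xM.
have /cvg_norm h := cf x.
rewrite -(cvg_lim _ h) //; apply: limr_le; first by apply/cvg_ex; exists `|f x|.
by apply: nearW => n; exact: hC.
Qed.

Lemma bounded_cvg_oint (f_ : nat -> R -> R) f a b : bounded_cvg f_ f ->
  oint (f_ n) a b @[n --> \oo] --> oint f a b.
Proof.
wlog ab : a b / a <= b => [hw bcf|bcf].
  case: (leP a b) => [/hw|/ltW ba]; first exact.
  rewrite oint_swap; under eq_fun do rewrite oint_swap.
  by apply: cvgN; exact: hw.
have tf := bounded_cvg_tame bcf; case: bcf => tf_ bf cf.
have [C hC] := bf (`|a| + `|b|).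
have itvM x : x \in `[a, b] -> `|x| <= `|a| + `|b|.
  rewrite in_itv /= => /andP[ax xb]; rewrite ler_norml.
  have := ler_norm b; have := ler_norm (- a); have := normr_ge0 a; have := normr_ge0 b.
  by rewrite normrN; lra.
rewrite oint_le_ab //; under eq_fun do rewrite oint_le_ab //.
have := @dominated_convergence _ _ R mu `[a, b] _ (fun n => EFin \o f_ n) (EFin \o f)
  (fun=> C%:E).
case.
- by [].
- by move=> n; apply/measurable_EFinP; case: (tf_ n) => h _; exact: measurable_funS h.
- by apply/measurable_EFinP; case: tf => h _; exact: measurable_funS h.
- apply: aeW => x _; apply: cvg_EFin; first exact: nearW.
  exact: cf.
- exact: (tame_integrable a b (tame_cst C)).
- apply: aeW => x n /= xab; rewrite lee_fin; apply: hC; exact: itvM.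
move=> _ _ h; rewrite /Rintegral.
apply: fine_cvg; rewrite /= fineK; first exact: h.
exact: (integrable_fin_num _ (tame_integrable a b tf)).
Qed.

Lemma bounded_cvg_oint_fun (f_ : nat -> R -> R) f a : bounded_cvg f_ f ->
  bounded_cvg (fun n x => oint (f_ n) a x) (oint f a).
Proof.
move=> bcf; split=> [n|M|x]; last exact: bounded_cvg_oint.
  by apply: tame_oint; case: bcf.
case: bcf => tf_ bf _; have [C hC] := bf (`|a| + `|M|).
exists (C * (`|a| + `|M|)) => n x xM.
have C0 : 0 <= C.
  apply: le_trans (normr_ge0 _) (hC 0%N 0 _); rewrite normr0; exact: addr_ge0.
have [MM xMM] : M <= `|M| /\ `|x| <= `|M|.
  by have := ler_norm M; split=> //; apply: le_trans xM _.
have bz z : Num.min a x < z < Num.max a x -> `|z| <= `|a| + `|M|.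
  rewrite gt_min lt_max ler_norml => /andP[h1 h2].
  have := ler_norm (- x); have := ler_norm x; have := ler_norm a; have := ler_norm (- a).
  rewrite !normrN; move: (normr_ge0 a) (normr_ge0 M) => ? ? ? ? ? ?.
  by case/orP: h1 => ?; case/orP: h2 => ?; lra.
have ax : `|x - a| <= `|a| + `|M| by rewrite (le_trans (ler_normB _ _)) // addrC lerD2l.
apply: le_trans (_ : C * `|x - a| <= _); last exact: ler_wpM2l.
case: (leP a x) bz => ax' bz.
  rewrite [`|x - a|]ger0_norm ?subr_ge0 //; apply: norm_oint_le => // z /bz; exact: hC.
rewrite oint_swap normrN distrC (@ger0_norm _ (a - x)); last by rewrite subr_ge0 ltW.
apply: norm_oint_le => //; first exact: ltW.
by move=> z /bz; exact: hC.
Qed.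

End ChangeOfVariable.

(** * Zero-mean antiderivatives *)

Section ZeroMean.
Variable R : realType.
Implicit Types (f g F G : R -> R) (a b c x t : R).
Local Notation oint := (@oriented_integral R).
Local Notation Z := (@zero_mean_antiderivative R).

Lemma pi_ge_Npi : - pi <= pi :> R.
Proof. by have := pi_ge0 R; lra. Qed.

Lemma zeroE f x : Z f x = oint f 0 x - (pi *+ 2)^-1 * oint (oint f 0) (- pi) pi.
Proof. by rewrite /zero_mean_antiderivative -(oint_le_ab (oint f 0) pi_ge_Npi). Qed.

Lemma bounded_cvg_zero_mean (f_ : nat -> R -> R) f : bounded_cvg f_ f ->
  bounded_cvg (fun n => Z (f_ n)) (Z f).
Proof.
move=> bcf; have bco := bounded_cvg_oint_fun 0 bcf.
have cI := @bounded_cvg_oint R _ _ (- pi) pi bco.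
have [to bo co] := bco.
split=> [n|M|x].
- rewrite (_ : Z (f_ n) = fun x => oint (f_ n) 0 x - (pi *+ 2)^-1 * oint (oint (f_ n) 0) (- pi) pi).
    by apply: tameB; [exact: to|exact: tame_cst].
  by apply/funext => x; rewrite zeroE.
- have [C hC] := bo M.
  have /cvg_seq_bounded[D [_ hD]] : cvgn (fun n => (pi *+ 2)^-1 * oint (oint (f_ n) 0) (- pi) pi).
    by apply: is_cvgMr; apply/cvg_ex; eexists; exact: cI.
  exists (C + (D + 1)) => n x xM; rewrite zeroE (le_trans (ler_normB _ _)) // lerD ?hC //.
  by apply: (hD (D + 1)) => //; rewrite ltrDl.
- rewrite zeroE; under eq_fun do rewrite zeroE.
  by apply: cvgB; [exact: co|apply: cvgMr; exact: cI].
Qed.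

Lemma zero_mean_FTC f F x : continuous f -> (forall t, is_derive t 1 F (f t)) ->
  oint F (- pi) pi = 0 -> Z f x = F x.
Proof.
move=> cf dF F0.
have tF : tame F by apply: continuous_tame => y; exact: der_cont (dF y).
have oE y : oint f 0 y = F y - F 0 by exact: oint_FTC_all.
rewrite zeroE oE (eq_oint _ _ oE) ointB //; last exact: tame_cst.
rewrite F0 oint_cst sub0r opprK -mulr2n mulrN opprK mulrCA mulVf ?mulr1 ?subrK //.
by rewrite mulrn_eq0 /= gt_eqF // pi_gt0.
Qed.

End ZeroMean.

(** * Tails of the sawtooth series *)

Section Kernels.
Variable R : realType.
Implicit Types (t : R) (n k : nat).

(** The usual kernel of order [n - 1], whence the frequency [n - 1/2] throughout. *)
Definition dirichlet n t : R := 2^-1 + \sum_(1 <= k < n) cos (k%:R * t).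

(* For [0 < t < 2 pi] this is the tail [\sum_(k >= n) sin (k t) / k]. *)
Definition sine_tail n t : R :=
  (pi - t) / 2 - \sum_(1 <= k < n) k%:R^-1 * sin (k%:R * t).

(* The antiderivative [\int_t^pi] of [sine_tail n]. *)
Definition sine_tail_int n t : R :=
  (pi - t) ^+ 2 / 4
  + \sum_(1 <= k < n) (k%:R ^- 2) * ((-1) ^+ k - cos (k%:R * t)).

Lemma sin_natpi k : sin (k%:R * pi) = 0 :> R.
Proof.
elim: k => [|k IH]; first by rewrite mul0r sin0.
by rewrite -natr1 mulrDl mul1r sinDpi IH oppr0.
Qed.

Lemma cos_natpi k : cos (k%:R * pi) = (-1) ^+ k :> R.
Proof.
elim: k => [|k IH]; first by rewrite mul0r cos0.
by rewrite -natr1 mulrDl mul1r cosDpi IH exprS mulN1r.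
Qed.

Lemma sine_tail_pi n : sine_tail n pi = 0.
Proof.
rewrite /sine_tail subrr mul0r big1 ?subr0 // => k _.
by rewrite sin_natpi mulr0.
Qed.

Lemma sine_tail_int_pi n : sine_tail_int n pi = 0.
Proof.
rewrite /sine_tail_int subrr expr0n mul0r big1 ?addr0 // => k _.
by rewrite cos_natpi subrr mulr0.
Qed.

Lemma der_sine_tail n t : is_derive t 1 (sine_tail n) (- dirichlet n t).
Proof.
(* [der_sum] asks for a derivative at every index, also at [k = 0] outside the range, where
   [0^-1 = 0] kills the term. *)
pose dh k (t : R) : R := if k is 0%N then 0 else cos (k%:R * t).
have h k : is_derive t 1 (fun t => k%:R^-1 * sin (k%:R * t)) (dh k t).
  apply: der_eq (derZ _ (der_sinZ _ _)) _; case: k => [|k]; first by rewrite !mul0r mulr0.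
  by rewrite mulrA mulVf ?mul1r // pnatr_eq0.
have h2 : is_derive t 1 (fun t : R => (pi - t) / 2) ((pi - t) * 0 + 2^-1 * (0 - 1)).
  exact: derM (derB (der_cst _ _) (der_id _)) (der_cst _ _).
apply: der_eq (derB h2 (der_sum _ h)) _.
rewrite /dirichlet (eq_big_nat _ _ (F2 := fun k => cos (k%:R * t))); last by case.
by field.
Qed.

Lemma der_sine_tail_int n t : is_derive t 1 (sine_tail_int n) (- sine_tail n t).
Proof.
pose dh k (t : R) : R := k%:R^-1 * sin (k%:R * t).
have h k : is_derive t 1 (fun t => (k%:R ^- 2) * ((-1) ^+ k - cos (k%:R * t)))
    (dh k t).
  apply: der_eq (derZ _ (derB (der_cst _ _) (der_cosZ _ _))) _.
  rewrite /dh sub0r opprK; case: k => [|k]; first by rewrite !mul0r sin0 !mulr0.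
  have : k.+1%:R != 0 :> R by rewrite pnatr_eq0.
  by move: (k.+1%:R : R) => m m0; field.
have h2 : is_derive t 1 (fun t : R => (pi - t) ^+ 2 / 4) (- ((pi - t) / 2)).
  have h3 := derM (derB (der_cst pi t) (der_id t)) (derB (der_cst pi t) (der_id t)).
  by apply: der_eq (derM h3 (der_cst 4^-1 t)) _; field.
by apply: der_eq (derD h2 (der_sum _ h)) _; rewrite /sine_tail /dh; ring.
Qed.

Lemma continuous_sine_tail n : continuous (sine_tail n).
Proof. by move=> t; exact: der_cont (der_sine_tail n t). Qed.

Lemma continuous_sine_tail_int n : continuous (sine_tail_int n).
Proof. by move=> t; exact: der_cont (der_sine_tail_int n t). Qed.

Lemma continuous_sum (I : Type) (s : seq I) (h : I -> R -> R) :
  (forall i, continuous (h i)) -> continuous (fun x => \sum_(i <- s) h i x).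
Proof.
move=> ch; elim: s => [|i s IH] x.
  by under eq_fun do rewrite big_nil; exact: cvg_cst.
under eq_fun do rewrite big_cons.
by apply: cvgD; [exact: ch|exact: IH].
Qed.

Lemma continuous_cosZ (c : R) : continuous (fun t : R => cos (c * t)).
Proof. by move=> t; exact: der_cont (der_cosZ _ _). Qed.

Lemma continuous_sinZ (c : R) : continuous (fun t : R => sin (c * t)).
Proof. by move=> t; exact: der_cont (der_sinZ _ _). Qed.

Lemma continuous_dirichlet n : continuous (dirichlet n).
Proof.
move=> t; apply: cvgD; first exact: cvg_cst.
by apply: (continuous_sum (h := fun k t => cos (k%:R * t))) => k; exact: continuous_cosZ.
Qed.

Lemma sine_tail_succ n t : (0 < n)%N ->
  sine_tail n t - sine_tail n.+1 t = n%:R^-1 * sin (n%:R * t).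
Proof. by move=> n0; rewrite /sine_tail big_nat_recr //=; ring. Qed.

Lemma dirichlet_sin n t : (0 < n)%N ->
  2 * sin (2^-1 * t) * dirichlet n t = sin ((n%:R - 2^-1) * t).
Proof.
elim: n => // -[|n] IH _.
  rewrite /dirichlet big_geq // addr0 mulrAC divff ?mul1r //.
  by congr (sin (_ * _)); field.
have -> : dirichlet n.+2 t = dirichlet n.+1 t + cos (n.+1%:R * t).
  by rewrite /dirichlet big_nat_recr //= addrA.
rewrite mulrDr IH //.
have e1 : (n.+1%:R - 2^-1) * t = n.+1%:R * t - 2^-1 * t by ring.
have e2 : (n.+2%:R - 2^-1) * t = n.+1%:R * t + 2^-1 * t by rewrite -[n.+2%:R]natr1; field.
by rewrite e1 e2 sinB sinD; ring.
Qed.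

Lemma sin_half_pi_gt0 t : 0 < t <= pi -> 0 < sin (2^-1 * t).
Proof. by move=> ?; apply: sin_gt0_pi; have := pi_gt0 R; lra. Qed.

Lemma cos_half_ge0 t : 0 <= t <= pi -> 0 <= cos (2^-1 * t).
Proof. by move=> ?; apply: cos_ge0_pihalf; have := pi_gt0 R; lra. Qed.

(* [sin v - v cos v] is nondecreasing on [0, pi]; apply this to v = t/4. *)
Lemma sin_half_ge t : 0 <= t <= pi -> t / 4 <= sin (2^-1 * t).
Proof.
move=> /andP[t0 tpi]; set v := 4^-1 * t.
have v0 : 0 <= v by rewrite /v; lra.
have vpi : v <= pi / 4 by rewrite /v; lra.
have pi0 := pi_gt0 R.
have c2 : 2^-1 <= cos v ^+ 2.
  have -> : 2^-1 = cos (pi / 4) ^+ 2 :> R.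
    have := cos_pihalf R; rewrite (_ : pi / 2 = (pi / 4) *+ 2); last by field.
    by rewrite cos_mulr2n => h; lra.
  have cp : 0 <= cos (pi / 4) :> R by apply: cos_ge0_pihalf; lra.
  rewrite ler_pXn2r ?nnegrE //; last by apply: cos_ge0_pihalf; lra.
  move: vpi; rewrite le_eqVlt => /predU1P[->//|vpi]; apply: ltW.
  by rewrite ltr_cos ?in_itv //=; lra.
have sv : v * cos v <= sin v.
  have dx (x : R) : is_derive x 1 (fun t : R => sin t - t * cos t) (x * sin x).
    apply: der_eq (derB (is_derive_sin x) (derM (der_id x) (is_derive_cos x))) _.
    by ring.
  have := @der_ge0_le R _ (fun x => x * sin x) 0 v v0 (fun x _ => dx x).
  rewrite sin0 mul0r subrr subr_ge0; apply => x /andP[x0 xv].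
  by rewrite mulr_ge0 ?ltW // sin_gt0_pi //; lra.
have -> : 2^-1 * t = v *+ 2 by rewrite /v; field.
rewrite sin_mulr2n; have cv : 0 <= cos v by apply: cos_ge0_pihalf; lra.
have : cos v * (v * cos v) <= cos v * sin v by exact: ler_wpM2l.
by rewrite (_ : t / 4 = v) /v; [nra|field].
Qed.

Lemma norm_mul_le1 (x y : R) : `|x| <= 1 -> 0 <= y -> `|x * y| <= y.
Proof. by move=> x1 y0; rewrite normrM (ger0_norm y0) ler_piMl. Qed.

Section Bounds.
Variables (n : nat) (n0 : (0 < n)%N).
Let nu : R := n%:R - 2^-1.
Let s t := sin (2^-1 * t) : R.
Let c t := cos (2^-1 * t) : R.
Let q t := c t / s t ^+ 2.

Let nu_gt0 : 0 < nu.
Proof.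
have h : 1 <= n%:R :> R by rewrite ler1n.
by rewrite /nu; lra. Qed.

Let s0 t : 0 < t <= pi -> s t != 0.
Proof. by move=> /sin_half_pi_gt0 h; rewrite gt_eqF. Qed.

Let s_pi : s pi = 1.
Proof. by rewrite /s mulrC sin_pihalf. Qed.

Let c_pi : c pi = 0.
Proof. by rewrite /c mulrC cos_pihalf. Qed.

Let cos_nu_pi : cos (nu * pi) = 0.
Proof.
by rewrite /nu mulrBl cosB sin_natpi mul0r addr0 (mulrC 2^-1) cos_pihalf mulr0.
Qed.

Let ds t : is_derive t 1 s (2^-1 * c t).
Proof. exact: der_sinZ. Qed.

Let dc t : is_derive t 1 c (- (2^-1 * s t)).
Proof. exact: der_cosZ. Qed.

Let dsV t : 0 < t <= pi -> is_derive t 1 (fun t => (s t)^-1) (- (2^-1 * q t)).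
Proof.
move=> t0; apply: der_eq (derV (s0 t0) (ds t)) _.
by rewrite /q; field; exact: s0.
Qed.

Let dq t : 0 < t <= pi ->
  is_derive t 1 q (- ((2^-1 * s t ^+ 2 + c t ^+ 2) / s t ^+ 3)).
Proof.
move=> t0; have h := dsV t0.
rewrite (_ : q = fun t => c t * ((s t)^-1 * (s t)^-1)); last first.
  by apply/funext => u; rewrite /q -exprVn expr2.
by apply: der_eq (derM (dc t) (derM h h)) _; rewrite /q; field; exact: s0.
Qed.

Lemma dirichletE t : 0 < t <= pi -> dirichlet n t = sin (nu * t) / (2 * s t).
Proof.
move=> t0; rewrite -dirichlet_sin // mulrC mulKf // mulf_neq0 // ?s0 //.
Qed.

(** What remains of [sine_tail n] after one integration by parts of [sin (nu u) / (2 * s u)] over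
    [[t, pi]]. *)
Let e t := sine_tail n t - cos (nu * t) / (2 * nu) * (s t)^-1.

Let de t : 0 < t <= pi -> is_derive t 1 e (cos (nu * t) * q t / (4 * nu)).
Proof.
move=> t0; have h := derM (derM (der_cosZ nu t) (der_cst (2 * nu)^-1 t)) (dsV t0).
apply: der_eq (derB (der_sine_tail n t) h) _.
rewrite dirichletE // /q; field; rewrite s0 //= gt_eqF //.
Qed.

Let e_pi : e pi = 0.
Proof. by rewrite /e sine_tail_pi cos_nu_pi !mul0r subrr. Qed.

Let q_ge0 t : 0 < t <= pi -> 0 <= q t.
Proof.
move=> t0; rewrite divr_ge0 ?exprn_ge0 //; last exact/ltW/sin_half_pi_gt0.
by apply: cos_half_ge0; lra.
Qed.

Lemma itv_pi t x : 0 < t <= pi -> t <= x <= pi -> 0 < x <= pi.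
Proof. by move=> /andP[t0 _] /andP[tx ->]; rewrite (lt_le_trans t0). Qed.

Lemma itv_pi_oo t x : 0 < t <= pi -> t < x < pi -> 0 < x <= pi.
Proof. by move=> /andP[t0 _] /andP[tx xp]; rewrite (lt_trans t0) //= ltW. Qed.

(** The derivative of [e] is at most [q / (4 * nu)], and [q / 2] is minus the derivative of [1 / s]:
    the majorant has an elementary primitive. *)
Let e_bound t : 0 < t <= pi -> `|e t| <= (2 * nu)^-1 * ((s t)^-1 - 1).
Proof.
move=> t0; have /andP[_ tpi] := t0.
have := @der_norm_le R e (fun x => - (2 * nu)^-1 * (s x)^-1)
  (fun x => cos (nu * x) * q x / (4 * nu)) (fun x => q x / (4 * nu)) t pi tpi.
rewrite e_pi sub0r normrN s_pi invr1 => h.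
rewrite (_ : _ * (_ - 1) = - (2 * nu)^-1 * 1 - - (2 * nu)^-1 * (s t)^-1); last by ring.
apply: h => x.
- by move=> /(itv_pi t0); exact: de.
- move=> /(itv_pi t0) x0; apply: der_eq (derZ _ (dsV x0)) _.
  by field; rewrite gt_eqF.
- move=> /(itv_pi_oo t0) x0; rewrite -mulrA norm_mul_le1 ?cos_max //.
  by rewrite divr_ge0 ?q_ge0 // mulr_ge0 // ltW.
Qed.

Lemma sine_tail_bound_nu t : 0 < t <= pi -> `|sine_tail n t| <= (nu * s t)^-1.
Proof.
move=> t0; have st := sin_half_pi_gt0 t0.
have -> : sine_tail n t = e t + cos (nu * t) / (2 * nu) * (s t)^-1 by rewrite /e subrK.
apply: le_trans (ler_normD _ _) _.
have h1 := e_bound t0.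
have h2 : `|cos (nu * t) / (2 * nu) * (s t)^-1| <= (2 * nu)^-1 * (s t)^-1.
  rewrite -mulrA norm_mul_le1 ?cos_max // mulr_ge0 // invr_ge0 ?mulr_ge0 // ltW //.
apply: le_trans (lerD h1 h2) _.
rewrite (_ : (nu * s t)^-1 = (2 * nu)^-1 * ((s t)^-1 - 1) + (2 * nu)^-1 * (s t)^-1
   + (2 * nu)^-1); last by field; rewrite s0 //= gt_eqF.
by rewrite lerDl invr_ge0 mulr_ge0 // ltW.
Qed.

(** The leading term of [e], from a second integration by parts: in [e - f] the oscillating factor
    multiplies only the derivative of [q], of constant sign, with a gain of [1 / nu^2]. *)
Let f t := sin (nu * t) * q t / (4 * nu ^+ 2).

Let f_bound t : 0 < t <= pi -> `|f t| <= q t / (4 * nu ^+ 2).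
Proof.
move=> t0; rewrite /f -mulrA norm_mul_le1 ?sin_max //.
by rewrite divr_ge0 ?q_ge0 // mulr_ge0 // exprn_ge0 // ltW.
Qed.

Let e_bound2 t : 0 < t <= pi -> `|e t| <= q t / (2 * nu ^+ 2).
Proof.
move=> t0; have /andP[_ tpi] := t0.
suff h : `|e t - f t| <= q t / (4 * nu ^+ 2).
  have -> : e t = (e t - f t) + f t by rewrite subrK.
  apply: le_trans (ler_normD _ _) _; apply: le_trans (lerD h (f_bound t0)) _.
  by rewrite le_eqVlt; apply/orP; left; apply/eqP; field; rewrite gt_eqF.
pose dq' x := (2^-1 * s x ^+ 2 + c x ^+ 2) / s x ^+ 3.
have := @der_norm_le R (fun x => e x - f x) (fun x => - (4 * nu ^+ 2)^-1 * q x)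
  (fun x => sin (nu * x) * dq' x / (4 * nu ^+ 2)) (fun x => dq' x / (4 * nu ^+ 2)) t pi tpi.
rewrite /= e_pi /f /q c_pi !mul0r !mulr0 mul0r subrr !sub0r normrN.
rewrite -/(q t) -/(f t) mulNr opprK [_^-1 * q t]mulrC; apply => x.
- move=> /(itv_pi t0) x0.
  have h := derM (derM (der_sinZ nu x) (dq x0)) (der_cst (4 * nu ^+ 2)^-1 x).
  apply: der_eq (derB (de x0) h) _.
  by rewrite /dq' /q; field; rewrite s0 //= gt_eqF.
- move=> /(itv_pi t0) x0; apply: der_eq (derZ _ (dq x0)) _.
  by rewrite /dq'; field; rewrite s0 //= gt_eqF.
- move=> /(itv_pi_oo t0) x0; rewrite -mulrA norm_mul_le1 ?sin_max //.
  apply: divr_ge0; last by rewrite mulr_ge0 // exprn_ge0 // ltW.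
  apply: divr_ge0; first by apply: addr_ge0; [apply: mulr_ge0 => //|]; exact: sqr_ge0.
  by rewrite exprn_ge0 // ltW // sin_half_pi_gt0.
Qed.

(** The function [a] integrates the main term [- cos (nu x) / (2 * nu * s x)] of the derivative up
    to [f]. The rest has derivative [- e - f], at most [3 q / (4 nu^2)], whose primitive is again a
    multiple of [1 / s]. *)
Lemma sine_tail_int_bound_nu t : 0 < t <= pi ->
  `|sine_tail_int n t| <= 2 / (nu ^+ 2 * s t).
Proof.
move=> t0; have /andP[_ tpi] := t0; have st := sin_half_pi_gt0 t0.
pose a x := - (2 * nu ^+ 2)^-1 * (sin (nu * x) * (s x)^-1).
have := @der_norm_le R (fun x => sine_tail_int n x - a x)
  (fun x => - (3 / (2 * nu ^+ 2)) * (s x)^-1)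
  (fun x => - e x - f x) (fun x => 3 * q x / (4 * nu ^+ 2)) t pi tpi.
rewrite /= sine_tail_int_pi s_pi invr1 => h.
have {h} : `|0 - a pi - (sine_tail_int n t - a t)| <=
     - (3 / (2 * nu ^+ 2)) * 1 - - (3 / (2 * nu ^+ 2)) * (s t)^-1.
  apply: h => x.
  - move=> /(itv_pi t0) x0.
    have h := derZ (- (2 * nu ^+ 2)^-1) (derM (der_sinZ nu x) (dsV x0)).
    apply: der_eq (derB (der_sine_tail_int n x) h) _.
    by rewrite /e /f /q; field; rewrite s0 //= gt_eqF.
  - move=> /(itv_pi t0) x0; apply: der_eq (derZ _ (dsV x0)) _.
    by field; rewrite gt_eqF.
  - move=> /(itv_pi_oo t0) x0.
    apply: le_trans (ler_normB _ _) _; rewrite normrN.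
    apply: le_trans (lerD (e_bound2 x0) (f_bound x0)) _.
    by rewrite le_eqVlt; apply/orP; left; apply/eqP; field; rewrite gt_eqF.
have nu2 : 0 < (2 * nu ^+ 2)^-1 by rewrite invr_gt0 mulr_gt0 // exprn_gt0.
have abound x : 0 < s x -> `|a x| <= (2 * nu ^+ 2)^-1 * (s x)^-1.
  move=> sx; rewrite /a normrM normrN (gtr0_norm nu2) ler_pM2l //.
  by rewrite norm_mul_le1 ?sin_max // invr_ge0 ltW.
have api := abound pi; rewrite s_pi ltr01 invr1 mulr1 in api.
have at_ := abound _ st.
rewrite (_ : 2 / (nu ^+ 2 * s t) = 4 * (2 * nu ^+ 2)^-1 * (s t)^-1); last first.
  by field; rewrite s0 //= gt_eqF.
move: (2 * nu ^+ 2)^-1 nu2 api at_ => w w0 /(_ isT).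
rewrite !ler_norml; move: (sine_tail_int n t) (a pi) (a t) ((s t)^-1) => x y z u.
by lra.
Qed.

Let nu_ge : n%:R / 2 <= nu.
Proof.
have h : 1 <= n%:R :> R by rewrite ler1n.
by rewrite /nu; lra. Qed.

Let n_gt0 : 0 < n%:R :> R.
Proof. by rewrite ltr0n. Qed.

Lemma dirichlet_bound t : 0 < t <= pi -> `|dirichlet n t| <= 2 / t.
Proof.
move=> t0; rewrite dirichletE //; have /andP[t1 tpi] := t0.
have st := sin_half_ge (t := t); rewrite -/(s t) in st.
have st' : t / 4 <= s t by apply: st; rewrite (ltW t1).
apply: le_trans (_ : (2 * s t)^-1 <= _).
  rewrite norm_mul_le1 ?sin_max // invr_ge0 mulr_ge0 // ltW //.
  exact: sin_half_pi_gt0.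
rewrite ler_pdivlMr // mulrC ler_pdivrMr; [lra|].
by rewrite mulr_gt0 // sin_half_pi_gt0.
Qed.

Lemma dirichlet_bound_n t : `|dirichlet n t| <= n%:R.
Proof.
rewrite /dirichlet; apply: le_trans (ler_normD _ _) _.
apply: le_trans (lerD (lexx _) (ler_norm_sum _ _ _)) _.
apply: le_trans (_ : 2^-1 + \sum_(1 <= k < n) 1 <= _).
  rewrite ger0_norm // lerD2l; apply: ler_sum_nat => k _; exact: cos_max.
rewrite sumr_const_nat (natrB _ n0); lra.
Qed.

Lemma sine_tail_bound t : 0 < t <= pi -> `|sine_tail n t| <= 8 / (n%:R * t).
Proof.
move=> t0; apply: le_trans (sine_tail_bound_nu t0) _; have /andP[t1 tpi] := t0.
have st : t / 4 <= s t by apply: sin_half_ge; rewrite (ltW t1).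
have sp := sin_half_pi_gt0 t0.
rewrite ler_pdivlMr ?mulr_gt0 // mulrC ler_pdivrMr ?mulr_gt0 //.
have : n%:R / 2 * (t / 4) <= nu * s t by apply: ler_pM => //; lra.
by rewrite -/(s t); lra.
Qed.

Lemma sine_tail_int_bound t : 0 < t <= pi ->
  `|sine_tail_int n t| <= 32 / (n%:R ^+ 2 * t).
Proof.
move=> t0; apply: le_trans (sine_tail_int_bound_nu t0) _; have /andP[t1 tpi] := t0.
have st : t / 4 <= s t by apply: sin_half_ge; rewrite (ltW t1).
have sp := sin_half_pi_gt0 t0.
rewrite ler_pdivlMr ?mulr_gt0 ?exprn_gt0 // mulrAC ler_pdivrMr ?mulr_gt0 ?exprn_gt0 //.
have h : (n%:R / 2) ^+ 2 * (t / 4) <= nu ^+ 2 * s t.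
  apply: ler_pM => //; [lra|].
  by rewrite ler_pXn2r ?nnegrE ?divr_ge0 // ltW.
rewrite -/(s t); move: h; rewrite exprMn; nra.
Qed.

(** For [t >= 1/n] the decay estimate suffices. Below, each of the [n - 1] terms [sin (k t) / k] is
    at most [t], so the subtracted sum is at most 1. *)
Lemma sine_tail_bounded t : 0 <= t <= pi -> `|sine_tail n t| <= 8.
Proof.
move=> /andP[t0 tpi]; case: (leP (n%:R^-1) t) => nt.
  have t1 : 0 < t by rewrite (lt_le_trans _ nt) // invr_gt0.
  apply: le_trans (sine_tail_bound _) _; first by rewrite t1.
  rewrite ler_pdivrMr ?mulr_gt0 //.
  by move: nt; rewrite -[n%:R^-1]mul1r ler_pdivrMr //; lra.
have tn : t * n%:R <= 1 by move: (ltW nt); rewrite -[n%:R^-1]mul1r ler_pdivlMr.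
rewrite /sine_tail; apply: le_trans (ler_normB _ _) _.
have h1 : `|(pi - t) / 2| <= 2.
  rewrite ger0_norm; last by rewrite divr_ge0 // subr_ge0.
  by have := pihalf_lt2 R; lra.
suff h2 : `|\sum_(1 <= k < n) k%:R^-1 * sin (k%:R * t)| <= 1 by lra.
apply: le_trans (ler_norm_sum _ _ _) _.
apply: le_trans (_ : \sum_(1 <= k < n) t <= _); last first.
  by rewrite sumr_const_nat -mulr_natr (natrB _ n0) mulrBr; lra.
apply: ler_sum_nat => k /andP[k1 _]; have k0 : 0 < k%:R :> R by rewrite ltr0n.
rewrite normrM gtr0_norm ?invr_gt0 // ler_pdivrMl //.
rewrite -[X in `|X|]subr0 -(sin0 R) -[X in _ <= X]subr0.
apply: (@der_norm_le R sin id cos (fun=> 1)) => [|x _].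
  by rewrite mulr_ge0 // ltW.
exact: cos_max.
Qed.

End Bounds.
End Kernels.

(** * Functions of bounded Lambda-variation *)

Section Variation.
Variable R : realType.
Implicit Types (f g phi : R -> R) (w : nat -> R) (s : seq (R * R)).

(** Unlike in [interval_family], degenerate intervals are allowed: they contribute nothing, and a
    point chosen in a cell may fall on its left end. *)
Definition itvs (a b : R) : pred (seq (R * R)) := fun s =>
  all (fun I => [&& a <= I.1, I.1 <= I.2 & I.2 <= b]) s
  && pairwise (@nonoverlapping R) s.

Definition wvariation_le w f (a b V : R) : Prop :=
  forall s, itvs a b s -> wsum w (fun I => `|incr f I|) s <= V.

Definition harm (i : nat) : R := i.+1%:R^-1.

Lemma harm_ge0 i : 0 <= harm i. Proof. by rewrite invr_ge0. Qed.

Lemma harmS i : harm i.+1 <= harm i.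
Proof. by rewrite lef_pV2 ?posrE // ler_nat. Qed.

Lemma harm_le1 i : harm i <= 1.
Proof. by rewrite invf_le1 // ler1n. Qed.

Lemma family_filter a b p s : itvs a b s -> itvs a b [seq I <- s | p I].
Proof.
move=> /andP[sa sp]; apply/andP; split; last exact: pairwise_filter.
by rewrite all_filter; apply: sub_all sa => I /= ->; rewrite implybT.
Qed.

Lemma family_sub a b a' b' s : a' <= a -> b <= b' -> itvs a b s -> itvs a' b' s.
Proof.
move=> aa bb /andP[sa sp]; apply/andP; split => //; apply: sub_all sa => I /and3P[h1 h2 h3].
by rewrite (le_trans aa) // h2 (le_trans h3).
Qed.

Lemma wvariation_le_sub w f a b a' b' V : a <= a' -> b' <= b ->
  wvariation_le w f a b V -> wvariation_le w f a' b' V.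
Proof. by move=> aa bb h s fs; apply: h; exact: family_sub fs. Qed.

(** Discarding degenerate intervals does not lower the sum, since the others move to heavier
    weights; so both kinds of families have the same bounds. *)
Lemma LambdaBVP (lam : nat -> R) f :
  (forall i, 0 < lam i) -> {homo lam : m n / (m <= n)%N >-> m <= n} ->
  LambdaBV lam f <-> exists V, wvariation_le (fun i => (lam i)^-1) f 0 (pi *+ 2) V.
Proof.
move=> lam0 lamS; rewrite /LambdaBV /= /Lambda_variation; split => [fV|[V fV]].
  set S := (X in ereal_sup X) in fV.
  have S0 : (0%:E <= ereal_sup S)%E.
    by apply: ereal_sup_ubound; exists [::]; rewrite // big_ord0.
  have Sfin : ereal_sup S \is a fin_num by rewrite ge0_fin_numE.
  exists (fine (ereal_sup S)) => s fs.
  rewrite -lee_fin fineK //.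
  have wS i : (lam i.+1)^-1 <= (lam i)^-1 by rewrite lef_pV2 ?posrE // lamS.
  have := wsum_filter_supp (p := fun I : R * R => I.1 < I.2) (d := fun I => `|incr f I|)
    (w := fun i => (lam i)^-1) s wS (fun=> normr_ge0 _).
  have /andP[sa sp] := fs.
  move=> h; apply: (@le_trans _ _ (wsum (fun i => (lam i)^-1) (fun I => `|incr f I|)
    [seq I <- s | I.1 < I.2])%:E); last first.
    apply: ereal_sup_ubound; exists [seq I <- s | I.1 < I.2]; last by rewrite (wsumE (0, 0)).
    apply/andP; split; last exact: pairwise_filter.
    rewrite all_filter; apply: sub_all sa => I /and3P[h1 _ h3] /=.
    by rewrite h1 h3 andbT; exact: implybb.
  rewrite lee_fin.
  (* [wsum_filter_supp] wants the increment to vanish on every discarded pair, reversed ones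
     included; this variant does, and agrees with it on the family. *)
  pose d' (I : R * R) := if I.1 <= I.2 then `|incr f I| else 0.
  have e t : all (fun I : R * R => I.1 <= I.2) t ->
      wsum (fun i => (lam i)^-1) (fun I => `|incr f I|) t = wsum (fun i => (lam i)^-1) d' t.
    move: (fun i => (lam i)^-1) => w; elim: t w => //= I t IH w /andP[It Ht].
    by rewrite IH // /d' It.
  rewrite e; last by apply: sub_all sa => I /and3P[].
  rewrite e; last by rewrite all_filter; apply: sub_all sa => I /and3P[_ hI _] /=; rewrite hI implybT.
  apply: wsum_filter_supp => // I; rewrite /d'; case: ifP => //.
  rewrite -leNgt => I1 I2; rewrite /incr (_ : I.2 = I.1) ?subrr ?normr0 //.
  by apply/le_anti; rewrite I1 I2.
apply: (@le_lt_trans _ _ V%:E); last exact: ltry.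
apply: ge_ereal_sup => _ [s /andP[sa sp] <-].
rewrite lee_fin; have := fV s; rewrite (wsumE (0, 0)); apply; apply/andP; split => //.
by apply: sub_all sa => I /and3P[h1 /ltW h2 h3]; rewrite h1 h2 h3.
Qed.

Lemma HBVP f : @HBV R f <-> exists V, wvariation_le harm f 0 (pi *+ 2) V.
Proof.
rewrite /HBV; apply: LambdaBVP => [i|m n mn]; first by rewrite ltr0n.
by rewrite ler_nat.
Qed.

Lemma wvariation_leD w f g a b V V' : (forall i, 0 <= w i) ->
  wvariation_le w f a b V -> wvariation_le w g a b V' ->
  wvariation_le w (fun t => f t + g t) a b (V + V').
Proof.
move=> w0 fV gV s fs; apply: le_trans (lerD (fV _ fs) (gV _ fs)).
rewrite -wsumD; apply: wsum_le => // I.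
by rewrite /incr opprD addrACA ler_normD.
Qed.

Lemma wvariation_leZ w c f a b V :
  wvariation_le w f a b V -> wvariation_le w (fun t => c * f t) a b (`|c| * V).
Proof.
move=> fV s fs; apply: le_trans (ler_wpM2l (normr_ge0 c) (fV _ fs)).
rewrite -wsumZ le_eqVlt; apply/orP; left; apply/eqP; congr wsum.
by apply/funext => I; rewrite /incr -mulrBr normrM.
Qed.

Lemma wvariation_leN w f a b V :
  wvariation_le w f a b V -> wvariation_le w (fun t => - f t) a b V.
Proof.
move=> fV s fs; apply: le_trans (fV _ fs).
rewrite le_eqVlt; apply/orP; left; apply/eqP; congr wsum.
by apply/funext => I; rewrite /incr -opprD normrN.
Qed.

Lemma wvariation_le_cst w c a b : wvariation_le w (fun=> c) a b 0.
Proof.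
move=> s _; have -> : (fun I => `|incr (fun=> c) I|) = (fun=> 0) :> (R * R -> R).
  by apply/funext => I; rewrite /incr subrr normr0.
by elim: s w => //= I s IH w; rewrite mul0r add0r.
Qed.

Lemma family_shift a b c s :
  itvs a b s -> itvs (c + a) (c + b) (map (fun I => (c + I.1, c + I.2)) s).
Proof.
move=> /andP[sa sp]; apply/andP; split.
  by rewrite all_map; apply: sub_all sa => I /=; rewrite !lerD2l.
rewrite pairwise_map; apply: sub_pairwise sp => I J.
by rewrite /nonoverlapping /= !lerD2l.
Qed.

Lemma wvariation_le_shift w f a b c V : wvariation_le w f (c + a) (c + b) V ->
  wvariation_le w (fun t => f (c + t)) a b V.
Proof.
move=> fV s /(family_shift c) /fV; apply: le_trans.
by rewrite wsum_map.
Qed.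

Lemma family_flip a b c s :
  itvs a b s -> itvs (c - b) (c - a) (map (fun I => (c - I.2, c - I.1)) s).
Proof.
move=> /andP[sa sp]; apply/andP; split.
  by rewrite all_map; apply: sub_all sa => I /= /and3P[h1 h2 h3]; rewrite !lerD2l !lerN2 h1 h2 h3.
rewrite pairwise_map; apply: sub_pairwise sp => I J.
by rewrite /nonoverlapping /= !lerD2l !lerN2 orbC.
Qed.

Lemma wvariation_le_flip w f a b c V : wvariation_le w f (c - b) (c - a) V ->
  wvariation_le w (fun t => f (c - t)) a b V.
Proof.
move=> fV s /(family_flip c) /fV; apply: le_trans; rewrite wsum_map.
rewrite le_eqVlt; apply/orP; left; apply/eqP; congr wsum.
by apply/funext => I; rewrite /incr /= distrC.
Qed.

End Variation.
Arguments harm {R}.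

(** * Periodic functions of bounded harmonic variation over an arbitrary period *)

Section PeriodicHBV.
Variable R : realType.
Variables (g : R -> R) (V : R).
Hypothesis gper : periodic g (pi *+ 2).
Hypothesis gV : wvariation_le harm g 0 (pi *+ 2) V.

Let twopi_gt0 : 0 < pi *+ 2 :> R.
Proof. by rewrite pmulrn_lgt0 // pi_gt0. Qed.

Lemma periodic_int (k : int) (x : R) : g (x + k%:~R * (pi *+ 2)) = g x.
Proof.
have nat_case (m : nat) y : g (y + m%:R * (pi *+ 2)) = g y.
  by rewrite mulr_natl periodicn.
case: k => m; first exact: nat_case.
rewrite NegzE mulrNz mulNr.
by have := nat_case m.+1 (x - m.+1%:R * (pi *+ 2)); rewrite subrK => ->.
Qed.

Lemma reduce_mod (x : R) : exists k : int, 0 <= x + k%:~R * (pi *+ 2) < pi *+ 2.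
Proof.
exists (- Num.floor (x / (pi *+ 2))).
have /andP[] := floor_itv (x / (pi *+ 2)).
rewrite ler_pdivlMr // ltr_pdivrMr // intrD1 mulrDl mul1r rmorphN /= mulNr.
by move: ((Num.floor (x / (pi *+ 2)))%:~R * (pi *+ 2)) => z; lra.
Qed.

Let V_ge0 : 0 <= V.
Proof. exact: (gV (s := [::])). Qed.

Let osc_0_2pi x y : 0 <= x <= pi *+ 2 -> 0 <= y <= pi *+ 2 -> `|g y - g x| <= V.
Proof.
wlog xy : x y / x <= y => [hw x02 y02|x02 y02].
  by case: (leP x y) => [/hw|/ltW /hw]; [apply|rewrite distrC; apply].
have := gV (s := [:: (x, y)]).
rewrite /= /harm invr1 mulr1 addr0; apply; apply/andP; split => //=.
by move: x02 y02 => /andP[-> _] /andP[_ ->]; rewrite xy.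
Qed.

Lemma HBV_osc x y : `|g y - g x| <= V.
Proof.
have [k /andP[k1 k2]] := reduce_mod x; have [l /andP[l1 l2]] := reduce_mod y.
rewrite -(periodic_int k x) -(periodic_int l y); apply: osc_0_2pi.
  by rewrite k1 ltW.
by rewrite l1 ltW.
Qed.

Lemma HBV_bounded x : `|g x| <= `|g 0| + V.
Proof.
rewrite -[g x](subrK (g 0)) addrC; apply: le_trans (ler_normD _ _) _.
by rewrite lerD2l HBV_osc.
Qed.

Lemma family_straddle a b c (s : seq (R * R)) : itvs a b s ->
  all (fun I : R * R => (I.1 < c) && (c < I.2)) s -> (size s <= 1)%N.
Proof.
case: s => [|I [|J s]] // /andP[_] /= /andP[/andP[IJ _] _].
move=> /and3P[/andP[I1 I2] /andP[J1 J2] _]; move: IJ; rewrite /nonoverlapping.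
by case/orP => h; [have := lt_le_trans I2 h|have := lt_le_trans J2 h]; lra.
Qed.

(** Cut at [2 pi]: the intervals to the left, those to the right moved back by a period, and the at
    most one that straddles the cut cost [V] each. *)
Let HBV_variation_0 c : 0 <= c < pi *+ 2 -> wvariation_le harm g c (c + pi *+ 2) (3 * V).
Proof.
move=> /andP[c0 c2pi] s fs.
pose d I := `|incr g I|.
pose p1 (I : R * R) := I.2 <= pi *+ 2; pose p2 (I : R * R) := pi *+ 2 <= I.1.
have d0 I : 0 <= d I by exact: normr_ge0.
have h1 := wsum_filter p1 s (@harmS R) d0.
set s' := [seq x <- s | ~~ p1 x] in h1.
have h2 := wsum_filter p2 s' (@harmS R) d0.
have fs' : itvs c (c + pi *+ 2) s' by exact: family_filter.
have b1 : wsum harm d [seq x <- s | p1 x] <= V.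
  apply: gV; have /andP[sa sp] := fs; apply/andP; split; last exact: pairwise_filter.
  rewrite all_filter; apply: sub_all sa => I /= /and3P[i1 i2 i3]; apply/implyP => i4.
  by rewrite (le_trans c0 i1) i2; exact: i4.
have b2 : wsum harm d [seq x <- s' | p2 x] <= V.
  have := family_filter p2 fs' => /(family_shift (- (pi *+ 2))) fam2.
  have := gV (s := map (fun I => (- (pi *+ 2) + I.1, - (pi *+ 2) + I.2)) [seq I <- s' | p2 I]).
  rewrite wsum_map => h.
  have -> : wsum harm d [seq x <- s' | p2 x] =
    wsum harm ((fun I => `|incr g I|) \o (fun I : R * R => (- (pi *+ 2) + I.1, - (pi *+ 2) + I.2)))
     [seq x <- s' | p2 x].
    congr wsum; apply/funext => I /=; rewrite /d /incr /=.
    by rewrite -(gper (- (pi *+ 2) + I.2)) -(gper (- (pi *+ 2) + I.1)) !(addrC (- (pi *+ 2))) !subrK.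
  apply: h; have /andP[sa sp] := fam2; apply/andP; split => //.
  move: sa; rewrite !all_map !all_filter; apply: sub_all => I /=.
  move=> /implyP ha; apply/implyP => /ha /implyP hb; apply/implyP => p2I.
  have := hb p2I; move: p2I; rewrite !lerD2l /p2 => p2I /and3P[i1 i2 i3]; lra.
have b3 : wsum harm d [seq x <- s' | ~~ p2 x] <= V.
  have := family_straddle (c := pi *+ 2) (family_filter (fun x => ~~ p2 x) fs').
  set t := [seq x <- s' | ~~ p2 x].
  have -> : all (fun I : R * R => (I.1 < pi *+ 2) && (pi *+ 2 < I.2)) t.
    rewrite /t /s' !all_filter; apply/allP => I _ /=.
    apply/implyP; rewrite /p1 -ltNge => h3; apply/implyP; rewrite /p2 -ltNge => h4.
    by rewrite h3 h4.
  case: t => [|I [|J t]] //=; last by move/(_ isT).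
  by move=> _; rewrite /harm invr1 mulr1 addr0; exact: HBV_osc.
by lra.
Qed.

Lemma HBV_variation c : wvariation_le harm g c (c + pi *+ 2) (3 * V).
Proof.
have [k kc] := reduce_mod c.
set c' := c + k%:~R * (pi *+ 2) in kc.
have h := HBV_variation_0 kc.
have -> : g = fun t => g (k%:~R * (pi *+ 2) + t).
  by apply/funext => t; rewrite addrC periodic_int.
by apply: wvariation_le_shift; rewrite addrA [_ + c]addrC.
Qed.

Lemma HBV_variation_right x : wvariation_le harm (fun t => g (x + t)) 0 pi (3 * V).
Proof.
apply: (@wvariation_le_shift R harm g 0 pi x); rewrite addr0.
by apply: (wvariation_le_sub _ _ (@HBV_variation x)) => //; rewrite lerD2l mulr2n lerDl pi_ge0.
Qed.

Lemma HBV_variation_left x : wvariation_le harm (fun t => g (x - t)) 0 pi (3 * V).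
Proof.
apply: (@wvariation_le_flip R harm g 0 pi x); rewrite subr0.
have := @HBV_variation (x - pi); apply: wvariation_le_sub => //.
by rewrite mulr2n addrA subrK lerDl pi_ge0.
Qed.

End PeriodicHBV.

(** * One-sided limits and smallness of the harmonic variation near 0 *)

Section VariationNearZero.
Variable R : realType.
Implicit Types (phi : R -> R) (s : seq (R * R)).

Definition hsum n : R := \sum_(i < n) harm i.

Lemma hsum_unbounded (C : R) : exists n, C < hsum n.
Proof.
apply: contrapT => h; apply: (@dvg_harmonic R).
apply: nondecreasing_is_cvgn.
  by apply/nondecreasing_seqP => n; rewrite seriesEnat /= big_nat_recr //= lerDl invr_ge0.
exists C => _ [n _ <-]; rewrite leNgt; apply/negP => Cn; apply: h; exists n.
by rewrite /hsum -(big_mkord xpredT (@harm R)).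
Qed.

Lemma hsumS n : hsum n.+1 = hsum n + harm n.
Proof. by rewrite /hsum big_ord_recr. Qed.

Lemma le_hsum m n : (m <= n)%N -> hsum m <= hsum n.
Proof.
move=> mn; rewrite -(subnK mn); elim: (n - m)%N => // k IH.
by rewrite addSn hsumS (le_trans IH) // lerDl harm_ge0.
Qed.

(** More than [N] increments above [e] would alone have weighted sum at least [e * hsum N], which
    exceeds [V]. The bound [N] depends on [V] and [e] only. *)
Lemma family_count (V e : R) : 0 < e -> exists N : nat, forall phi (a b : R) s,
  wvariation_le (@harm R) phi a b V -> itvs a b s ->
  (size [seq I <- s | (e < `|incr phi I|)%R] <= N)%N.
Proof.
move=> e0; have [N hN] := hsum_unbounded (V / e); exists N => phi a b s phiV fs.
rewrite leqNgt; apply/negP => Ns.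
set t := [seq I <- s | _] in Ns.
have := @wsum_ge_sum R _ harm (fun I => `|incr phi I|) e t (@harm_ge0 R).
have -> : all (fun I => e <= `|incr phi I|) t.
  by rewrite all_filter; apply/allP => I _ /=; apply/implyP => /ltW.
move=> /(_ isT); apply/negP; rewrite -ltNge.
have fV := phiV t (family_filter _ fs).
apply: le_lt_trans fV _; move: hN; rewrite ltr_pdivrMr // => /lt_le_trans; apply.
by rewrite mulrC ler_pM2l //; apply: le_hsum; exact: ltnW.
Qed.

Lemma family_cat (a b c d : R) s t : c <= b -> itvs b d s -> itvs a c t -> a <= b -> c <= d ->
  itvs a d (s ++ t).
Proof.
move=> cb fs ft ab cd; have /andP[sa sp] := fs; have /andP[ta tp] := ft.
apply/andP; split.
  rewrite all_cat; apply/andP; split.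
    by apply: sub_all sa => I /and3P[h1 h2 h3]; rewrite h2 h3 (le_trans ab).
  by apply: sub_all ta => I /and3P[h1 h2 h3]; rewrite h1 h2 (le_trans h3).
rewrite pairwise_cat sp tp !andbT; apply/allrelP => I J Is Jt.
have /and3P[I1 I2 I3] := allP sa _ Is; have /and3P[J1 J2 J3] := allP ta _ Jt.
by apply/orP; right; rewrite (le_trans J3) // (le_trans cb).
Qed.

(** If the Cauchy criterion failed at 0+, disjoint intervals with increments at least [e] could be
    added ever closer to 0, and the harmonic sum of their weights would pass [V / e]. *)
Lemma regulated_right phi (b V : R) : 0 < b ->
  (forall a, 0 < a -> wvariation_le (@harm R) phi a b V) ->
  forall e, 0 < e -> exists2 d, 0 < d & forall y z, 0 < y < d -> 0 < z < d ->
    `|phi y - phi z| < e.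
Proof.
move=> b0 phiV e e0; apply: contrapT => hneg.
have ex d : 0 < d -> exists y z, [/\ 0 < y, y < d, y < z, z < d & e <= `|phi z - phi y|].
  move=> d0; apply: contrapT => h; apply: hneg; exists d => // y z /andP[y0 yd] /andP[z0 zd].
  rewrite ltNge; apply/negP => eyz; apply: h.
  case: (ltgtP y z) => yz.
  - by exists y, z; rewrite distrC; split.
  - by exists z, y; split.
  - by move: eyz; rewrite yz subrr normr0 leNgt e0.
have chain N : exists a s, [/\ 0 < a <= b, itvs a b s, size s = N &
    all (fun I => e <= `|incr phi I|) s].
  elim: N => [|N [a [s [/andP[a0 ab] fs sN es]]]]; first by exists b, [::]; rewrite b0 lexx; split.
  have [y [z [y0 ya yz za eyz]]] := ex a a0.
  exists y, (s ++ [:: (y, z)]); split.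
  - by rewrite y0 (le_trans (ltW ya)).
  - apply: (@family_cat y a a b) => //; last exact: ltW.
    by rewrite /itvs /= lexx !ltW.
  - by rewrite size_cat sN addn1.
  - by rewrite all_cat es /= andbT.
have [N hN] := hsum_unbounded (V / e).
have [a [s [/andP[a0 ab] fs sN es]]] := chain N.
have h1 := phiV a a0 s fs.
have h2 := @wsum_ge_sum R _ harm (fun I => `|incr phi I|) e s (@harm_ge0 R) es.
have := le_trans h2 h1; rewrite sN leNgt; apply/negP; rewrite negbK.
by move: hN; rewrite ltr_pdivrMr // mulrC.
Qed.

Lemma right_limit phi (b V : R) : 0 < b ->
  (forall a, 0 < a -> wvariation_le (@harm R) phi a b V) ->
  exists l : R, phi t @[t --> 0^'+] --> l.
Proof.
move=> b0 phiV; apply/cvg_ex; apply: cauchy_cvg; apply/cauchy_ballP => e e0.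
have [d d0 hd] := regulated_right b0 phiV e0.
have dnear : \forall y \near 0^'+, 0 < y < d.
  near=> y; apply/andP; split; near: y; first exact: nbhs_right_gt.
  exact: nbhs_right_lt.
pose A := [set r : R | exists2 y, 0 < y < d & r = phi y].
have nA : (phi t @[t --> 0^'+]) A by apply: filterS dnear => y yd; exists y.
exists (A, A) => //= -[_ _] [/= [y yd ->] [z zd ->]].
by rewrite /ball /=; exact: hd.
Unshelve. all: by end_near. Qed.


(* A family carrying variation [> e] arbitrarily close to [0] can be appended
   behind any family living away from [0] : since [phi] is small near [0], its
   first terms, which get shifted to smaller weights, are negligible. *)
Lemma variation_near0_small phi (b V : R) : 0 < b ->
  (forall a, 0 < a -> wvariation_le (@harm R) phi a b V) ->
  phi t @[t --> 0^'+] --> 0 ->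
  forall e, 0 < e -> exists2 eta, 0 < eta <= b &
    forall a, 0 < a -> wvariation_le (@harm R) phi a eta e.
Proof.
move=> b0 phiV phi0 e e0; apply: contrapT => hneg.
have ex eta : 0 < eta <= b -> exists a s, [/\ 0 < a <= eta, itvs a eta s &
    e < wsum (@harm R) (fun I => `|incr phi I|) s].
  move=> eta0; apply: contrapT => h; apply: hneg; exists eta => // a a0 s fs.
  rewrite leNgt; apply/negP => es; apply: h.
  exists (Num.min a eta), s; split => //.
    by rewrite lt_min a0 ge_min lexx orbT; case/andP: eta0 => ->.
  by apply: family_sub fs => //; rewrite ge_min lexx.
have small c : 0 < c -> exists2 eta, 0 < eta & forall t, 0 < t <= eta -> `|phi t| <= c.
  move=> c0; have /cvgr0Pnorm_le /(_ c c0) [d /= d0 hd] := phi0.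
  exists (d / 2); first by rewrite divr_gt0.
  move=> t /andP[t0 td]; apply: hd => //=; rewrite sub0r normrN gtr0_norm //.
  by apply: le_lt_trans td _; rewrite ltr_pdivrMr //; lra.
have chain M : exists a s, [/\ 0 < a <= b, itvs a b s &
    M%:R * (e / 2) <= wsum (@harm R) (fun I => `|incr phi I|) s].
  elim: M => [|M [a [s [/andP[a0 ab] fs sM]]]].
    by exists b, [::]; rewrite b0 lexx mul0r.
  (* The first [N] terms of the new family will be dropped: with increments at most [2 * c] and
     weights at most 1 they cost at most [e / 2]. *)
  pose N := size s; pose c := e / (4 * N.+1%:R).
  have c0 : 0 < c by rewrite divr_gt0 // mulr_gt0 // ltr0n.
  have [eta1 eta10 heta1] := small c c0.
  pose eta := Num.min eta1 a.
  have eta0 : 0 < eta by rewrite lt_min eta10.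
  have eta_a : eta <= a by rewrite ge_min lexx orbT.
  have [|a' [s' [/andP[a'0 a'eta] fs' es']]] := ex eta.
    by rewrite eta0 (le_trans eta_a).
  (* Behind the [N] terms of [s], what is left of [s'] keeps exactly the weights it had. *)
  exists a', (s ++ drop N s'); split.
  - by rewrite a'0 (le_trans a'eta) // (le_trans eta_a).
  - apply: (family_cat eta_a fs _ (le_trans a'eta eta_a) (le_trans eta_a ab)).
    have /andP[ta tp] := fs'; apply/andP; split.
      by rewrite -(cat_take_drop N s') all_cat in ta; case/andP: ta.
    by rewrite -(cat_take_drop N s') pairwise_cat in tp; case/and3P: tp.
  rewrite wsum_cat -natr1 mulrDl mul1r; apply: lerD => //.
  have := es'; rewrite -{1}(cat_take_drop N s') wsum_cat.
  set w1 := wsum _ _ (take N s'); set w2 := wsum _ _ (drop N s').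
  have hw1 : w1 <= e / 2.
    have : all (fun I => `|incr phi I| <= 2 * c) (take N s').
      have /andP[ta _] := fs'; rewrite -(cat_take_drop N s') all_cat in ta.
      case/andP: ta => ta _; apply: sub_all ta => I /and3P[i1 i2 i3].
      have bnd x : a' <= x <= eta -> `|phi x| <= c.
        move=> /andP[x1 x2]; apply: heta1; rewrite (lt_le_trans a'0) //=.
        by rewrite (le_trans x2) // ge_min lexx.
      apply: le_trans (ler_normB _ _) _; rewrite mulr_natl mulr2n.
      by apply: lerD; apply: bnd; rewrite ?i3 ?i1 ?(le_trans i1 i2) ?(le_trans i2 i3).
    move=> /(wsum_le_sum (@harm_ge0 R)) /le_trans; apply.
    apply: le_trans (_ : 2 * c * N%:R <= _).
      rewrite ler_pM2l ?mulr_gt0 //.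
      apply: le_trans (_ : \sum_(i < size (take N s')) (1 : R) <= _).
        by apply: ler_sum => i _; exact: harm_le1.
      by rewrite sumr_const card_ord ler_nat size_take_min geq_minl.
    rewrite /c (_ : 2 * _ * _ = e / 2 * (N%:R / N.+1%:R)); last first.
      by have : N.+1%:R != 0 :> R by []; move: (N.+1%:R : R) => y y0; field.
    by rewrite ler_piMr ?divr_ge0 ?ltW // ltr_pdivrMr ?ltr0n // mul1r ltr_nat.
  have hw2 : e / 2 < w2 -> e / 2 <= wsum (fun i => harm (N + i)) (fun I => `|incr phi I|) (drop N s').
    case: (leqP N (size s')) => Ns'.
      by move/ltW => /le_trans; apply; rewrite /w2 size_takel.
    rewrite /w2 drop_oversize /=; last exact: ltnW.
    by move=> /ltW.
  by move=> h; apply: hw2; lra.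
have [M hM] : exists M : nat, V < M%:R * (e / 2).
  exists (Num.truncn (V / (e / 2))).+1.
  by rewrite -ltr_pdivrMr ?divr_gt0 // truncnS_gt.
have [a [s [/andP[a0 ab] fs sM]]] := chain M.
by have := phiV a a0 s fs; rewrite leNgt (lt_le_trans hM).
Qed.

Lemma sumr_const_seq_size (T : Type) (s : seq T) (c : R) :
  \sum_(i <- s) c = c *+ size s.
Proof. by elim: s => [|x s IH]; rewrite ?big_nil ?big_cons //= IH mulrS. Qed.

Lemma succ3_le i : (i.+3 <= 3 * i.+1)%N.
Proof. by lia. Qed.

(* Terms with right end beyond [eta] carry weight [O(1/n)], and only boundedly
   many of them exceed a given threshold. *)
Lemma variation_sum_small phi (b V B : R) : 0 < b ->
  (forall a, 0 < a -> wvariation_le (@harm R) phi a b V) ->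
  (forall t, 0 < t <= b -> `|phi t| <= B) ->
  phi t @[t --> 0^'+] --> 0 ->
  forall e, 0 < e -> exists n0 : nat, forall n a s, (n0 <= n)%N -> (0 < n)%N -> 0 < a ->
    itvs a b s -> (size s <= n)%N ->
    (forall i, (i < size s)%N -> (nth (0, 0) s i).2 <= i.+3%:R * (b / n%:R)) ->
    wsum (@harm R) (fun I => `|incr phi I|) s <= e.
Proof.
move=> b0 phiV phiB phi0 e e0.
have B0 : 0 <= B by apply: le_trans (phiB b _); rewrite ?b0 ?lexx.
have [eta /andP[eta0 etab] heta] := variation_near0_small b0 phiV phi0 (divr_gt0 e0 (ltr0n R 3)).
(* An interval ending beyond [eta] has [eta < (i + 3) b / n <= 3 (i + 1) b / n], that is
   [harm i <= K / n]. The threshold [e'] is such that [n] increments below it then cost [e / 3]. *)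
pose K : R := 3 * b / eta.
have K0 : 0 < K by rewrite divr_gt0 // mulr_gt0.
pose e' := e / (3 * K).
have e'0 : 0 < e' by rewrite divr_gt0 // mulr_gt0.
have [N hN] := family_count V e'0.
exists (Num.truncn (3 * K * (N%:R * (2 * B)) / e)).+1 => n a s nn n0 a0 fs sn send.
have nR0 : 0 < n%:R :> R by rewrite ltr0n.
have big : 3 * K * (N%:R * (2 * B)) / e < n%:R.
  by apply: lt_le_trans (truncnS_gt _) _; rewrite ler_nat.
pose d (I : R * R) := `|incr phi I|.
pose p (I : R * R) := I.2 <= eta.
pose d1 I := if p I then d I else 0.
pose d2 I := if p I then 0 else d I.
have d0 I : 0 <= d I by exact: normr_ge0.
have dE : d = fun I => d1 I + d2 I.
  by apply/funext => I; rewrite /d1 /d2; case: ifP; rewrite ?addr0 ?add0r.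
have d10 I : 0 <= d1 I by rewrite /d1; case: ifP.
have d20 I : 0 <= d2 I by rewrite /d2; case: ifP.
rewrite -/d dE wsumD.
have h1 : wsum (@harm R) d1 s <= e / 3.
  apply: le_trans (@wsum_filter_supp R _ p _ d1 s (@harmS R) d10 _) _.
    by move=> I; rewrite /d1 => /negbTE ->.
  apply: le_trans (@wsum_le R _ _ d1 d _ (@harm_ge0 R) _) _.
    by move=> I; rewrite /d1; case: ifP.
  apply: (heta a a0); have /andP[sa sp] := fs; apply/andP; split; last exact: pairwise_filter.
  rewrite all_filter; apply: sub_all sa => I /= /and3P[-> -> _].
  by apply/implyP.
have h2 : wsum (@harm R) d2 s <= K / n%:R * \sum_(I <- s) d2 I.
  rewrite (wsumE (0, 0)) (big_nth (0, 0)) big_mkord mulr_sumr.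
  apply: ler_sum => i _; rewrite mulrC; rewrite /d2.
  case: ifP => [|/negbT]; first by rewrite !mulr0.
  rewrite /p -ltNge => eI; apply: ler_wpM2r => //.
  have := lt_le_trans eI (send i (ltn_ord i)).
  rewrite mulrA ltr_pdivlMr // => h.
  have i1 : 0 < i.+1%:R :> R by rewrite ltr0n.
  have i3n : (i.+3 <= 3 * i.+1)%N by exact: succ3_le.
  have i3 : i.+3%:R <= 3 * i.+1%:R :> R by have := i3n; rewrite -(ler_nat R) natrM.
  rewrite /harm -[X in X <= _]mul1r ler_pdivrMr // -(ler_pM2r (mulr_gt0 eta0 nR0)) mul1r.
  move: i1 i3 h; move: (i.+1%:R : R) (i.+3%:R : R) => y z y0 yz h.
  rewrite (_ : K / n%:R * y * (eta * n%:R) = 3 * b * y); last first.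
    by rewrite /K; field; rewrite !gt_eqF.
  have : z * b <= 3 * y * b by rewrite ler_wpM2r // ltW.
  by move: h; lra.
have h3 : \sum_(I <- s) d2 I <= N%:R * (2 * B) + e' * n%:R.
  have incrB I : a <= I.1 <= I.2 -> I.2 <= b -> d I <= 2 * B.
    move=> /andP[i1 i2] i3; apply: le_trans (ler_normB _ _) _.
    rewrite mulr_natl mulr2n.
    by apply: lerD; apply: phiB; rewrite ?i3 ?(le_trans i2 i3) andbT (lt_le_trans a0) ?(le_trans i1).
  apply: le_trans (_ : \sum_(I <- s) d I <= _).
    by apply: ler_sum => I _; rewrite /d2; case: ifP.
  have Ns := hN _ _ _ s (phiV a a0) fs.
  rewrite (bigID (fun I => e' < d I)) /=; apply: lerD.
    rewrite -big_filter.
    have : {in [seq I <- s | e' < d I], forall I, d I <= 2 * B}.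
      move=> I; rewrite mem_filter => /andP[_ Is]; have /andP[/allP sa _] := fs.
      by have /and3P[i1 i2 i3] := sa _ Is; apply: incrB => //; rewrite i1.
    move: Ns; rewrite -/d; move: [seq I <- s | _] => t Nt ht.
    apply: le_trans (_ : (size t)%:R * (2 * B) <= _); last first.
      by rewrite ler_wpM2r ?mulr_ge0 // ler_nat.
    rewrite big_seq; apply: le_trans (_ : \sum_(I <- t | I \in t) 2 * B <= _).
      by apply: ler_sum.
    by rewrite -big_seq sumr_const_seq_size -[X in X <= _]mulr_natl.
  apply: le_trans (_ : \sum_(I <- s) e' <= _).
    rewrite big_mkcond; apply: ler_sum => I _ /=; case: ifP => [|_]; last exact: ltW.
    by rewrite -leNgt.
  rewrite sumr_const_seq_size -[X in X <= _]mulr_natr ler_wpM2l ?(ltW e'0) //.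
  by rewrite ler_nat.
have h4 : K / n%:R * (\sum_(I <- s) d2 I) <= K / n%:R * (N%:R * (2 * B) + e' * n%:R).
  by rewrite ler_wpM2l // divr_ge0 // ltW.
have h5 : K / n%:R * (N%:R * (2 * B) + e' * n%:R) <= 2 * (e / 3).
  rewrite mulrDr (_ : K / n%:R * (e' * n%:R) = e / 3); last first.
    by rewrite /e'; field; rewrite !gt_eqF.
  suff : K / n%:R * (N%:R * (2 * B)) <= e / 3 by lra.
  rewrite mulrAC ler_pdivrMr //.
  by move: big; rewrite ltr_pdivrMr //; lra.
by lra.
Qed.

End VariationNearZero.

(** * Measurability of regulated functions *)

Section Measurability.
Variable R : realType.

(** The set [D n] of points with oscillation at least [1/(n+1)] leaves free an interval to the right
    of every point; a rational in that interval identifies the point, so [D n] is countable. The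
    preimage of a ray is its interior together with points of the sets [D n]. *)
Lemma measurable_right_regulated (g : R -> R) :
  (forall x e, 0 < e -> exists2 d, 0 < d & forall y z, 0 < y < d -> 0 < z < d ->
     `|g (x + y) - g (x + z)| < e) ->
  measurable_fun setT g.
Proof.
move=> reg.
pose D (n : nat) := [set x | forall d, 0 < d ->
  exists2 y, `|y - x| < d & n.+1%:R^-1 <= `|g y - g x|].
have Dfree n x : exists2 d, 0 < d & forall y, x < y < x + d -> ~ D n y.
  have [d d0 hd] := reg x n.+1%:R^-1 (ltac:(by rewrite invr_gt0 ltr0n)).
  exists d => // y /andP[xy yd] Dy.
  have r0 : 0 < Num.min (y - x) (x + d - y) by rewrite lt_min !subr_gt0 xy.
  have [z] := Dy _ r0; rewrite lt_min !ltr_norml => /andP[/andP[z1 _] /andP[_ z2]].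
  rewrite leNgt => /negP; apply.
  have := hd (z - x) (y - x); rewrite !(addrC x) !subrK; apply.
    by apply/andP; split; lra.
  by apply/andP; split; lra.
have Dcount n : countable (D n).
  have /choice[q hq] : forall x, exists q : rat, x < ratr q /\ forall y, x < y < ratr q -> ~ D n y.
    move=> x; have [d d0 hd] := Dfree n x.
    have [q] : exists q, ratr q \in `]x, (x + d)[ by apply: rat_in_itvoo; rewrite ltrDl.
    rewrite in_itv /= => /andP[xq qd]; exists q; split => // y /andP[xy yq].
    by apply: hd; rewrite xy (lt_trans yq).
  apply/countable_injP; exists (fun x => pickle (q x)) => x y; rewrite !inE => Dx Dy.
  move=> /(pcan_inj (@pickleK _)) qxy.
  have [xq hx] := hq x; have [yq hy] := hq y.
  case: (ltgtP x y) => // xy.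
    by exfalso; apply: (hx y) => //; rewrite xy qxy.
  by exfalso; apply: (hy x) => //; rewrite xy -qxy.
apply: (measurability _ (RGenOInfty.measurableE R)) => _ [_ [c ->] <-].
rewrite setTI; set A := g @^-1` _.
have -> : A = interior A `|` (A `\` interior A).
  by rewrite setUDr setDv setD0; apply/esym/setUidPr; exact: interior_subset.
apply: measurableU; first by apply: open_measurable; exact: open_interior.
apply: countable_measurable => //.
have cD : countable (\bigcup_n D n) by apply: bigcup_countable.
apply: (@sub_countable R R _ (\bigcup_n D n)) cD; apply: subset_card_le => x [Ax nAx].
move: Ax; rewrite /A /= in_itv /= andbT => cx.
have [n hn] : exists n : nat, n.+1%:R^-1 < g x - c.
  exists (Num.truncn (g x - c)^-1).
  by rewrite invf_plt ?posrE ?subr_gt0// truncnS_gt.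
exists n => // d d0; apply: contrapT => hd; apply: nAx.
apply/nbhs_ballP; exists d => //= y; rewrite /ball /= => xyd.
rewrite /A /= in_itv /= andbT ltNge; apply/negP => yc; apply: hd; exists y.
  by rewrite distrC.
by apply: le_trans (ltW hn) _; rewrite distrC; apply: le_trans (ler_norm _); lra.
Qed.

Lemma HBV_tame (g : R -> R) (V : R) : periodic g (pi *+ 2) ->
  wvariation_le harm g 0 (pi *+ 2) V -> tame g.
Proof.
move=> gper gV; split; last first.
  by move=> M; exists (`|g 0| + V) => x _; exact: HBV_bounded.
apply: measurable_right_regulated => x; apply: (@regulated_right _ _ pi (3 * V)).
  exact: pi_gt0.
move=> a a0; have := HBV_variation_right gper gV x; apply: wvariation_le_sub => //.
exact: ltW.
Qed.

End Measurability.

(** * Oscillatory kernels against functions of harmonic bounded variation *)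

Section OscillatoryKernel.
Variable R : realType.
Local Notation oint := (@oriented_integral R).

(** Here [W n] is the primitive of [- w n] vanishing at [pi]. The bounds say that [w n] oscillates
    at scale [1/n]: integrating gains a factor [1/n] over the size [1/t], and below that scale the
    size saturates at [n]. *)
Definition oscillatory (C : R) (w W : nat -> R -> R) := forall n, (0 < n)%N ->
  [/\ continuous (w n), forall t : R, is_derive t 1 (W n) (- w n t), W n pi = 0 &
      forall t, 0 < t <= pi ->
        [/\ `|w n t| <= C / t, `|W n t| <= C / (n%:R * t) & `|w n t| <= C * n%:R]].

Lemma oint_split (f : R -> R) (x : nat -> R) m : tame f ->
  oint f (x 0%N) (x m) = \sum_(i < m) oint f (x i) (x i.+1).
Proof.
move=> tf; elim: m => [|m IH]; first by rewrite big_ord0 oint_nn.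
by rewrite big_ord_recr /= -IH -oint_add.
Qed.

Lemma abel_sum (u v : nat -> R) m :
  \sum_(i < m) u i * (v i - v i.+1) =
  u 0%N * v 0%N - u m * v m + \sum_(i < m) (u i.+1 - u i) * v i.+1.
Proof.
elim: m => [|m IH]; first by rewrite !big_ord0 subrr addr0.
by rewrite !big_ord_recr /= IH; ring.
Qed.

Lemma wsum_mkseq (w : nat -> R) (d : R * R -> R) (h : nat -> R * R) m :
  wsum w d (mkseq h m) = \sum_(i < m) d (h i) * w i.
Proof.
rewrite (wsumE (0, 0)) size_mkseq; apply: eq_bigr => i _.
by rewrite nth_mkseq.
Qed.

Lemma itvs_mkseq (a b : R) (h : nat -> R * R) m :
  (forall i, (i < m)%N -> [&& a <= (h i).1, (h i).1 <= (h i).2 & (h i).2 <= b]) ->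
  (forall i j, (i < j < m)%N -> (h i).2 <= (h j).1) ->
  itvs a b (mkseq h m).
Proof.
move=> hab hh; apply/andP; split.
  by rewrite all_map; apply/allP => i; rewrite mem_iota /= => /hab.
rewrite pairwise_map.
have : pairwise ltn (iota 0 m) by rewrite -sorted_pairwise ?iota_ltn_sorted //; exact: ltn_trans.
have : all (fun i => i < m)%N (iota 0 m) by apply/allP => i; rewrite mem_iota.
elim: (iota 0 m) => //= i s IH /andP[im sm] /andP[si sp]; rewrite IH // andbT.
apply/allP => j js; apply/orP; left; apply: hh.
by apply/andP; split; [exact: (allP si _ js)|exact: (allP sm _ js)].
Qed.

(** The supremum of [phi t - phi a] may not be attained, and the factor 2 makes room for this: if no
    [t] worked, the integrand would be so small that the integral is at most half of itself. *)
Lemma integral_osc_point (phi w : R -> R) (a b M : R) : a < b -> 0 < M -> tame phi ->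
  continuous w -> (forall t, a <= t <= b -> `|w t| <= M) ->
  exists2 t, a <= t <= b &
    `|oint (fun t => (phi t - phi a) * w t) a b| <= 2 * M * (b - a) * `|phi t - phi a|.
Proof.
move=> ab M0 tphi cw wM; set I := `|oint _ _ _|.
apply: contrapT => hneg.
have lt t : a <= t <= b -> 2 * M * (b - a) * `|phi t - phi a| < I.
  by move=> tab; rewrite ltNge; apply/negP => h; apply: hneg; exists t.
have c0 : 0 < 2 * M * (b - a) by rewrite !mulr_gt0 // subr_gt0.
have I0 : 0 < I by apply: le_lt_trans (lt a _); [exact: mulr_ge0 (ltW c0) _|rewrite lexx ltW].
have : I <= (I / (2 * M * (b - a)) * M) * (b - a).
  apply: norm_oint_le => //; first exact: ltW.
    by apply: tameM; [apply: tameB => //; exact: tame_cst|exact: continuous_tame].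
  move=> t /andP[at_ tb]; have tab : a <= t <= b by rewrite !ltW.
  rewrite normrM; apply: ler_pM => //; last exact: wM.
  by rewrite ler_pdivlMr // mulrC; apply: ltW; exact: lt.
rewrite (_ : I / _ * M * (b - a) = I / 2); first by lra.
have b1 : b - a != 0 by rewrite gt_eqF // subr_gt0.
by move: (b - a) b1 => y y0; field; rewrite y0 gt_eqF.
Qed.

Variables (C : R) (w W : nat -> R -> R).
Hypothesis C_gt0 : 0 < C.
Hypothesis osc : oscillatory C w W.

(** On the cell starting at [(i + 1) pi / n] the kernel has mass at most [C * harm i]: this is the
    origin of the harmonic weights. The deviation of [phi] from its value at the left end gives
    [s1]; the values at the left ends, summed by parts against [W n], give [s2]. *)
Lemma oscillatory_cells (phi : R -> R) n (beta : R) : (0 < n)%N -> tame phi ->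
  (forall t, 0 < t <= pi / n%:R -> `|phi t| <= beta) ->
  exists s1 s2 : seq (R * R),
  [/\ itvs (pi / n%:R) pi s1 /\ itvs (pi / n%:R) pi s2,
      (size s1 <= n)%N /\ (size s2 <= n)%N,
      (forall i, (i < size s1)%N -> (nth (0, 0) s1 i).2 <= i.+3%:R * (pi / n%:R)),
      (forall i, (i < size s2)%N -> (nth (0, 0) s2 i).2 <= i.+3%:R * (pi / n%:R)) &
      `|oint (fun t => phi t * w n t) 0 pi| <=
        5 * C * beta + 2 * C * wsum harm (fun I => `|incr phi I|) s1
        + C * wsum harm (fun I => `|incr phi I|) s2].
Proof.
move=> n0 tphi phib.
have [cw dW Wpi bnd] := osc n0.
have nR : 0 < n%:R :> R by rewrite ltr0n.
set D := pi / n%:R in phib *.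
have pi0 := pi_gt0 R.
have D0 : 0 < D by rewrite divr_gt0.
have Dpi : D <= pi by rewrite /D ler_pdivrMr // ler_peMr ?(ltW pi0) // ler1n.
have C0 : 0 <= C by exact: ltW.
have beta0 : 0 <= beta by apply: le_trans (normr_ge0 _) (phib D _); rewrite D0 lexx.
(* The first cell [(0, pi / n]] is set apart; the remaining [n - 1] run from [x 0 = pi / n] to
   [x m = pi]. *)
pose m := n.-1; pose x i : R := i.+1%:R * D.
have nm : n = m.+1 by rewrite /m prednK.
have xm : x m = pi by rewrite /x -nm /D mulrC divfK // gt_eqF.
have x0 i : 0 < x i by rewrite mulr_gt0 // ltr0n.
have lex i j : (i <= j)%N -> x i <= x j by move=> ij; rewrite ler_pM2r // ler_nat.
have xS i : x i.+1 - x i = D by rewrite /x -(natr1 i.+1); ring.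
have xpi i : (i <= m)%N -> x i <= pi by rewrite -xm; exact: lex.
have tpw : tame (fun t => phi t * w n t) by apply: tameM => //; exact: continuous_tame.
have ex i : exists t, (i < m)%N -> x i <= t <= x i.+1 /\
    `|oint (fun t => (phi t - phi (x i)) * w n t) (x i) (x i.+1)| <=
      2 * C * (`|phi t - phi (x i)| * harm i).
  case: (ltnP i m) => im; last by exists 0.
  have [|||t tx ht] := @integral_osc_point phi (w n) (x i) (x i.+1) (C / x i) _ _ tphi cw.
  - by rewrite -subr_gt0 xS.
  - by rewrite divr_gt0.
  - move=> t /andP[t1 t2]; have t0 : 0 < t by rewrite (lt_le_trans (x0 i)).
    have [|h _ _] := bnd t; first by rewrite t0 (le_trans t2) // xpi.
    by apply: le_trans h _; rewrite ler_wpM2l // lef_pV2 ?posrE.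
  exists t => _; split => //; apply: le_trans ht _.
  rewrite xS le_eqVlt; apply/orP; left; apply/eqP.
  have i0 : i.+1%:R != 0 :> R by rewrite pnatr_eq0.
  rewrite /harm /x; move: (i.+1%:R : R) i0 => y y0.
  by field; rewrite y0 gt_eqF.
have [t ht] := choice ex.
exists (mkseq (fun i => (x i, t i)) m), (mkseq (fun i => (x i, x i.+1)) m).
have DxD i : D <= x i by rewrite /x ler_peMl ?(ltW D0) // ler1n.
have right3 i : x i.+1 <= i.+3%:R * D by rewrite /x ler_pM2r // ler_nat.
split.
- split; apply: itvs_mkseq => /= [i im|i j /andP[ij jm]].
  + by have [/andP[h1 h2] _] := ht i im; rewrite DxD h1 (le_trans h2) // xpi.
  + have [/andP[h1 h2] _] := ht i (ltn_trans ij jm).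
    by apply: le_trans h2 _; exact: lex.
  + by rewrite DxD lex // xpi.
  + exact: lex.
- by rewrite !size_mkseq nm leqnSn.
- move=> i; rewrite size_mkseq => im; rewrite nth_mkseq //=.
  by have [/andP[h1 h2] _] := ht i im; apply: le_trans h2 _.
- by move=> i; rewrite size_mkseq => im; rewrite nth_mkseq //=; exact: right3.
rewrite (oint_add 0 D pi tpw) -xm.
have x00 : x 0%N = D by rewrite /x mul1r.
rewrite -[X in oint _ X (x m)]x00 oint_split //.
have -> : \sum_(i < m) oint (fun t => phi t * w n t) (x i) (x i.+1) =
    \sum_(i < m) oint (fun t => (phi t - phi (x i)) * w n t) (x i) (x i.+1)
    + \sum_(i < m) phi (x i) * (W n (x i) - W n (x i.+1)).
  rewrite -big_split /=; apply: eq_bigr => i _.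
  have -> : W n (x i) - W n (x i.+1) = oint (w n) (x i) (x i.+1).
    have dNW (u : R) : is_derive u 1 (fun t => - W n t) (w n u).
      by apply: der_eq (derN (dW u)) _; rewrite opprK.
    by have -> := oint_FTC_all (x i) (x i.+1) cw dNW; rewrite opprK addrC.
  rewrite -ointZ; last exact: continuous_tame.
  rewrite -ointD.
  - by apply: eq_oint => u; rewrite -mulrDl subrK.
  - by apply: tameM; [apply: tameB => //; exact: tame_cst|exact: continuous_tame].
  - by apply: tameZ; exact: continuous_tame.
(* The boundary term at [pi] vanishes with [W n pi]. The one at [pi / n] costs [C * beta], and the
   first cell [4 * C * beta] because [pi < 4]. *)
rewrite (abel_sum (fun i => phi (x i)) (fun i => W n (x i))) xm Wpi mulr0 subr0.
rewrite !wsum_mkseq x00.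
have b1 : `|oint (fun t => phi t * w n t) 0 D| <= 4 * C * beta.
  apply: le_trans (_ : beta * (C * n%:R) * (D - 0) <= _).
    apply: norm_oint_le => //; first exact: ltW.
    move=> u /andP[u0 uD]; rewrite normrM; apply: ler_pM => //.
      by apply: phib; rewrite u0 ltW.
    by have [|_ _] := bnd u; first by rewrite u0 (le_trans (ltW uD)).
  rewrite subr0 (_ : _ * D = beta * C * pi); last by rewrite /D; move: (n%:R : R) nR => z z0; field; rewrite gt_eqF.
  have := pihalf_lt2 R; rewrite ltr_pdivrMr // => pi4.
  by have := mulr_ge0 beta0 C0; nra.
have hW i : (i < m)%N -> `|W n (x i)| <= C * (pi^-1 * harm i).
  move=> im; have [|_ h _] := bnd (x i); first by rewrite x0 xpi // ltnW.
  apply: le_trans h _; rewrite le_eqVlt; apply/orP; left; apply/eqP.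
  have i0 : i.+1%:R != 0 :> R by rewrite pnatr_eq0.
  rewrite /harm /x /D; move: (i.+1%:R : R) i0 (n%:R : R) nR (@pi R) pi0 => y y0 z z0 p p0.
  by field; rewrite y0 !gt_eqF.
have pi1 : pi^-1 <= 1 :> R by rewrite invf_le1 //; have := pi_ge2 R; lra.
have b2 : `|phi D * W n D| <= C * beta.
  rewrite normrM mulrC; apply: ler_pM => //; last by apply: phib; rewrite D0 lexx.
  have [|_ h _] := bnd D; first by rewrite D0.
  apply: le_trans h _; rewrite (_ : n%:R * D = pi); last by rewrite /D mulrC divfK // gt_eqF.
  by rewrite ler_piMr.
have b3 : `|\sum_(i < m) oint (fun t => (phi t - phi (x i)) * w n t) (x i) (x i.+1)| <=
    2 * C * \sum_(i < m) `|incr phi (x i, t i)| * harm i.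
  apply: le_trans (ler_norm_sum _ _ _) _; rewrite mulr_sumr; apply: ler_sum => i _.
  by have [_] := ht i (ltn_ord i).
have b4 : `|\sum_(i < m) (phi (x i.+1) - phi (x i)) * W n (x i.+1)| <=
    C * \sum_(i < m) `|incr phi (x i, x i.+1)| * harm i.
  apply: le_trans (ler_norm_sum _ _ _) _; rewrite mulr_sumr; apply: ler_sum => i _.
  rewrite normrM /incr /= mulrCA; apply: ler_wpM2l => //.
  have : (i.+1 <= m)%N by exact: ltn_ord.
  rewrite leq_eqVlt => /predU1P[->|im].
    by rewrite xm Wpi normr0 mulr_ge0 // harm_ge0.
  apply: le_trans (hW _ im) _; apply: ler_wpM2l => //.
  apply: le_trans (_ : 1 * harm i.+1 <= _); first by rewrite ler_wpM2r // harm_ge0.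
  by rewrite mul1r harmS.
set S0 := oint _ 0 D in b1 *; set S1 := \sum_(i < m) oint _ _ _ in b3 *.
set S2 := phi D * _ in b2 *; set S3 := \sum_(i < m) _ * W n _ in b4 *.
apply: le_trans (ler_normD _ _) _; apply: le_trans (lerD b1 (ler_normD _ _)) _.
apply: le_trans (lerD (lexx _) (lerD b3 (ler_normD _ _))) _.
by lra.
Qed.

Lemma oscillatory_bounded (phi : R -> R) (B V : R) n : (0 < n)%N -> tame phi ->
  (forall t, 0 < t <= pi -> `|phi t| <= B) ->
  (forall a, 0 < a -> wvariation_le harm phi a pi V) ->
  `|oint (fun t => phi t * w n t) 0 pi| <= 5 * C * B + 3 * C * V.
Proof.
move=> n0 tphi phiB phiV.
have nR : 0 < n%:R :> R by rewrite ltr0n.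
have D0 : 0 < pi / n%:R :> R by rewrite divr_gt0 // pi_gt0.
have Dpi : pi / n%:R <= pi :> R by rewrite ler_pdivrMr // ler_peMr ?pi_ge0 // ler1n.
have [|s1 [s2 [[fs1 fs2] _ _ _]]] := @oscillatory_cells phi n B n0 tphi.
  by move=> t /andP[t0 tD]; apply: phiB; rewrite t0 (le_trans tD).
move/le_trans; apply.
have C0 : 0 <= C by exact: ltW.
have := phiV _ D0 _ fs1; have := phiV _ D0 _ fs2.
move=> /(ler_wpM2l C0) h2 /(ler_wpM2l C0) h1.
by lra.
Qed.

Lemma oscillatory_cvg0 (phi : R -> R) (B V : R) : tame phi ->
  (forall t, 0 < t <= pi -> `|phi t| <= B) ->
  (forall a, 0 < a -> wvariation_le harm phi a pi V) ->
  phi t @[t --> 0^'+] --> 0 ->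
  oint (fun t => phi t * w n t) 0 pi @[n --> \oo] --> 0.
Proof.
move=> tphi phiB phiV phi0.
have C0 : 0 <= C by exact: ltW.
apply/cvgrPdist_le => e e0.
(* The cell estimate with [beta] and both variations at most [c] totals [(5 + 2 + 1) * C * c]. *)
pose c := e / (8 * (C + 1)).
have c0 : 0 < c by rewrite divr_gt0 // mulr_gt0 // ltr_pwDr.
have [n1 hn1] := variation_sum_small (pi_gt0 R) phiV phiB phi0 c0.
have /cvgr0Pnorm_le /(_ c c0) [d /= d0 hd] := phi0.
exists (maxn 1 (maxn n1 (Num.truncn (pi / d)).+1)) => // n /=.
rewrite !geq_max => /and3P[n0 nn1 nd].
have nR : 0 < n%:R :> R by rewrite ltr0n.
have D0 : 0 < pi / n%:R :> R by rewrite divr_gt0 // pi_gt0.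
have Dd : pi / n%:R < d.
  rewrite ltr_pdivrMr // mulrC -ltr_pdivrMr //.
  by apply: lt_le_trans (truncnS_gt _) _; rewrite ler_nat.
rewrite sub0r normrN.
have [|s1 [s2 [[fs1 fs2] [z1 z2] r1 r2]]] := @oscillatory_cells phi n c n0 tphi.
  move=> t /andP[t0 tD]; apply: hd => //=; rewrite sub0r normrN gtr0_norm //.
  exact: le_lt_trans Dd.
move/le_trans; apply.
have /(ler_wpM2l C0) h1 := hn1 n _ s1 nn1 n0 D0 fs1 z1 r1.
have /(ler_wpM2l C0) h2 := hn1 n _ s2 nn1 n0 D0 fs2 z2 r2.
have : 8 * (C + 1) * c = e by rewrite /c mulrC divfK // gt_eqF // mulr_gt0 // ltr_pwDr.
by nra.
Qed.

End OscillatoryKernel.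

(** * Fourier partial sums and jump *)

Section KernelInstances.
Variable R : realType.

(** One constant for both kernels: [32] is that of [sine_tail_int_bound], the largest involved. *)
Lemma oscillatory_dirichlet : oscillatory 32 (@dirichlet R) (@sine_tail R).
Proof.
move=> n n0; have nR : 0 < n%:R :> R by rewrite ltr0n.
split; [exact: continuous_dirichlet|by move=> t; exact: der_sine_tail|exact: sine_tail_pi|].
move=> t t0; have /andP[tp _] := t0; split.
- by apply: le_trans (dirichlet_bound n0 t0) _; rewrite ler_wpM2r ?invr_ge0 ?(ltW tp) // ler_nat.
- apply: le_trans (sine_tail_bound n0 t0) _.
  by rewrite ler_wpM2r ?ler_nat // invr_ge0 mulr_ge0 // ltW.
- by apply: le_trans (dirichlet_bound_n n0 t) _; rewrite ler_peMl // ler1n.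
Qed.

Lemma oscillatory_sine_tail : oscillatory 32 (fun n t => n%:R * @sine_tail R n t)
  (fun n t => n%:R * @sine_tail_int R n t).
Proof.
move=> n n0; have nR : 0 < n%:R :> R by rewrite ltr0n.
split.
- by move=> t; apply: cvgMr; exact: continuous_sine_tail.
- by move=> t; apply: der_eq (derZ _ (der_sine_tail_int n t)) _; rewrite mulrN.
- by rewrite sine_tail_int_pi mulr0.
move=> t t0; have /andP[tp tpi] := t0; rewrite !normrM !(gtr0_norm nR); split.
- rewrite mulrC -ler_pdivlMr //; apply: le_trans (sine_tail_bound n0 t0) _.
  rewrite [n%:R * t]mulrC invfM mulrA.
  by rewrite !ler_wpM2r ?ler_nat // invr_ge0 ltW.
- rewrite mulrC -ler_pdivlMr //; apply: le_trans (sine_tail_int_bound n0 t0) _.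
  rewrite le_eqVlt; apply/orP; left; apply/eqP.
  by move: (n%:R : R) nR => z z0; field; rewrite !gt_eqF.
- rewrite mulrC ler_wpM2r ?(ltW nR) //; apply: le_trans (sine_tail_bounded n0 _) _.
    by rewrite (ltW tp).
  by rewrite ler_nat.
Qed.

(** The integral of [sine_tail n] over [[0, pi]]. *)
Let L n : R := sine_tail_int n 0.

Lemma sine_tail_int0_succ n : (0 < n)%N -> L n - L n.+1 = (1 - (-1) ^+ n) * n%:R ^- 2.
Proof.
by move=> n0; rewrite /L /sine_tail_int big_nat_recr //= mulr0 cos0; ring.
Qed.

(** The kernel estimate for the constant function 1, of variation 0, whence [160 = 5 * 32]. It is
    used only to see that [L] tends to 0. *)
Lemma sine_tail_int0_bound n : (0 < n)%N -> `|L n| <= 160 / n%:R.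
Proof.
move=> n0; have nR : 0 < n%:R :> R by rewrite ltr0n.
have := @oscillatory_bounded R 32 _ _ (ltr0n R 32) oscillatory_sine_tail
  (fun=> 1) 1 0 n n0 (tame_cst _).
rewrite (@eq_oint R _ (fun t => n%:R * sine_tail n t)); last by move=> t; rewrite mul1r.
rewrite ointZ; last exact/continuous_tame/continuous_sine_tail.
have dNL (u : R) : is_derive u 1 (fun t => - sine_tail_int n t) (sine_tail n u).
  by apply: der_eq (derN (der_sine_tail_int n u)) _; rewrite opprK.
rewrite (oint_FTC_all 0 pi (@continuous_sine_tail R n) dNL).
rewrite sine_tail_int_pi oppr0 sub0r opprK normrM (gtr0_norm nR) => h.
rewrite ler_pdivlMr // mulrC; apply: le_trans (h _ _) _.
- by move=> t _; rewrite normr1.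
- by move=> a _; exact: wvariation_le_cst.
- by lra.
Qed.

(** Steps of length two are needed because [L n - L n.+1] vanishes for even [n]: a comparison with a
    smooth sequence holds over pairs of indices only. *)
Lemma le0_of_step2 (u : nat -> R) (n : nat) : u @ \oo --> 0 ->
  (forall m, (n <= m)%N -> u m <= u m.+2) -> u n <= 0.
Proof.
move=> u0 us.
have mono j : u n <= u (n + j.*2)%N.
  elim: j => [|j IH]; first by rewrite addn0.
  by apply: le_trans IH _; rewrite doubleS !addnS us // leq_addr.
rewrite leNgt; apply/negP => un0.
have /cvgr0Pnorm_lt /(_ _ un0) [m _ hm] := u0.
have := hm (n + m.*2)%N; rewrite /= => /(_ _) h.
have : `|u (n + m.*2)%N| < u n.
  by apply: h; rewrite -addnn addnA leq_addl.
by move/(le_lt_trans (ler_norm _)); rewrite ltNge mono.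
Qed.

(** Squeezes [L n] between [1/(n+1)] and [1/(n-1)]. Of two consecutive terms exactly one is nonzero,
    equal to [2 / k^2] with [k] odd, and it lies between the corresponding differences of the two
    bounds. *)
Lemma cvg_sine_tail_int0 : n%:R * L n @[n --> \oo] --> (1 : R).
Proof.
have L0 : L @ \oo --> 0.
  apply/cvgr0Pnorm_le => e e0.
  exists (Num.truncn (160 / e)).+1 => // n /= en.
  have n0 : (0 < n)%N by apply: leq_trans en.
  apply: le_trans (sine_tail_int0_bound n0) _.
  rewrite ler_pdivrMr ?ltr0n // mulrC -ler_pdivrMr //.
  by apply: ltW; apply: lt_le_trans (truncnS_gt _) _; rewrite ler_nat.
have L02 : (fun m => L m.+2) @ \oo --> 0 by rewrite -(cvg_shiftS L) -(cvg_shiftS (fun n => L n.+1)) in L0.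
have h0 : (fun m => m.+1%:R^-1 : R) @ \oo --> 0 := @cvg_harmonic R.
have h2 : (fun m => m.+3%:R^-1 : R) @ \oo --> 0.
  by have := h0; rewrite -(cvg_shiftS (fun m => m.+1%:R^-1 : R)) -(cvg_shiftS (fun m => m.+2%:R^-1 : R)).
have L2 m : L m.+2 - L m.+4 = (1 - (-1) ^+ m) * m.+2%:R ^- 2 + (1 + (-1) ^+ m) * m.+3%:R ^- 2.
  have -> : L m.+2 - L m.+4 = (L m.+2 - L m.+3) + (L m.+3 - L m.+4) by ring.
  by rewrite !sine_tail_int0_succ // !exprS; ring.
have sgn m : (-1) ^+ m = 1 :> R \/ (-1) ^+ m = -1 :> R.
  by rewrite -signr_odd; case: (odd m); [right|left]; rewrite ?expr1 ?expr0.
have upper m : L m.+2 - m.+1%:R^-1 <= 0.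
  apply: (@le0_of_step2 (fun m => L m.+2 - m.+1%:R^-1)) => [|k _].
    by rewrite -[0]subr0; apply: cvgB.
  have := L2 k.
  have x0 : 0 < k.+1%:R :> R by rewrite ltr0n.
  have : (k.+1%:R : R)^-1 - (k.+1%:R + 1 + 1)^-1 = 2 / (k.+1%:R * (k.+1%:R + 1 + 1)).
    by move: (k.+1%:R : R) x0 => x x0; field; rewrite !gt_eqF // !addr_gt0.
  have -> : k.+3%:R = k.+1%:R + 1 + 1 :> R by rewrite !natr1.
  have -> : k.+2%:R = k.+1%:R + 1 :> R by rewrite natr1.
  move: (k.+1%:R : R) x0 => x x0 e1 e2.
  have le1 : (x + 1) ^- 2 <= (x * (x + 1 + 1))^-1.
    by rewrite lef_pV2 ?posrE ?exprn_gt0 ?mulr_gt0 ?addr_gt0 //; nra.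
  have le2 : (x + 1 + 1) ^- 2 <= (x * (x + 1 + 1))^-1.
    by rewrite lef_pV2 ?posrE ?exprn_gt0 ?mulr_gt0 ?addr_gt0 //; nra.
  by move: e2; case: (sgn k) => ->; lra.
have lower m : m.+3%:R^-1 - L m.+2 <= 0.
  apply: (@le0_of_step2 (fun m => m.+3%:R^-1 - L m.+2)) => [|k _].
    by rewrite -[0]subr0; apply: cvgB.
  have := L2 k.
  have x0 : 1 < k.+2%:R :> R by rewrite ltr1n.
  have : (k.+2%:R + 1 : R)^-1 - (k.+2%:R + 1 + 2)^-1 = 2 / ((k.+2%:R + 1) * (k.+2%:R + 1 + 2)).
    by move: (k.+2%:R : R) x0 => x x0; field; rewrite !gt_eqF //; lra.
  have -> : k.+2.+3%:R = k.+2%:R + 1 + 2 :> R by rewrite natr1 -natrD addn2.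
  have -> : k.+3%:R = k.+2%:R + 1 :> R by rewrite natr1.
  move: (k.+2%:R : R) x0 => x x0 e1 e2.
  have le1 : ((x + 1) * (x + 1 + 2))^-1 <= (x + 1) ^- 2.
    by rewrite lef_pV2 ?posrE; nra.
  have le2 : ((x + 1) * (x + 1 + 2))^-1 <= x ^- 2.
    by rewrite lef_pV2 ?posrE; nra.
  by move: e2; case: (sgn k) => ->; lra.
rewrite -(cvg_shiftS (fun n => n%:R * L n)) -(cvg_shiftS (fun n => n.+1%:R * L n.+1)).
apply: (@squeeze_cvgr _ _ _ _ (fun m => 1 - m.+3%:R^-1) (fun m => 1 + m.+1%:R^-1)).
- apply: nearW => m /=; have := upper m; have := lower m.
  have y0 : 0 < m.+1%:R :> R by rewrite ltr0n.
  have e1 : m.+3%:R = m.+1%:R + 2 :> R by rewrite -addn2 natrD.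
  have e2 : m.+2%:R = m.+1%:R + 1 :> R by rewrite -addn1 natrD.
  rewrite e1 e2; move: (m.+1%:R : R) y0 (L m.+2) => y y0 l h3 h4.
  have i1 : (y + 2) * (y + 2)^-1 = 1 by rewrite divff // gt_eqF // addr_gt0.
  have i2 : y * y^-1 = 1 by rewrite divff // gt_eqF.
  have p1 : 0 < (y + 2)^-1 by rewrite invr_gt0 addr_gt0.
  have p2 : 0 < y^-1 by rewrite invr_gt0.
  by apply/andP; split; nra.
- by rewrite -[X in _ --> X]subr0; apply: cvgB => //; exact: cvg_cst.
- by rewrite -[X in _ --> X]addr0; apply: cvgD => //; exact: cvg_cst.
Qed.

End KernelInstances.

(** * Fourier integrals folded around a point *)

Section Folding.
Variable R : realType.
Implicit Types (g u : R -> R) (x t : R) (n k : nat).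
Local Notation oint := (@oriented_integral R).

Lemma oint_periodic u a : tame u -> periodic u (pi *+ 2) ->
  oint u (a - pi) (a + pi) = oint u (- pi) pi.
Proof.
move=> tu uper.
rewrite (oint_add (a - pi) (- pi) (a + pi) tu) (oint_add (- pi) pi (a + pi) tu).
suff -> : oint u pi (a + pi) = oint u (- pi) (a - pi).
  by rewrite (oint_swap u (- pi)); ring.
have := oint_shift (pi *+ 2) (- pi) (a - pi) tu.
rewrite (_ : pi *+ 2 + - pi = pi); last by rewrite mulr2n addrK.
rewrite (_ : pi *+ 2 + (a - pi) = a + pi); last by rewrite mulr2n; ring.
by move=> <-; apply: eq_oint => t; rewrite addrC uper.
Qed.

Lemma oint_fold u : tame u ->
  oint u (- pi) pi = oint (fun t => u t + u (- t)) 0 pi.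
Proof.
move=> tu; rewrite (oint_add (- pi) 0 pi tu).
have tu' : tame (fun t => u (- t)) by have := tame_flip 0 tu; under eq_fun do rewrite sub0r.
by rewrite ointD // oint_flip // oppr0 addrC.
Qed.

Lemma periodic_cosZ k : periodic (fun t : R => cos (k%:R * t)) (pi *+ 2).
Proof.
by move=> t; rewrite mulrDr [k%:R * (pi *+ 2)]mulr_natl (periodicn (@cosD2pi R)).
Qed.

Lemma periodic_sinZ k : periodic (fun t : R => sin (k%:R * t)) (pi *+ 2).
Proof.
by move=> t; rewrite mulrDr [k%:R * (pi *+ 2)]mulr_natl (periodicn (@sinD2pi R)).
Qed.

Lemma fourier_fold g (F : R -> R) x : tame g -> periodic g (pi *+ 2) ->
  continuous F -> periodic F (pi *+ 2) ->
  oint (fun t => g t * F (t - x)) (- pi) pi =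
  oint (fun t => g (x + t) * F t + g (x - t) * F (- t)) 0 pi.
Proof.
move=> tg gper cF Fper.
pose u t := g (x + t) * F t.
have tu : tame u by apply: tameM; [exact: tame_shift|exact: continuous_tame].
have uper : periodic u (pi *+ 2) by move=> t; rewrite /u addrA gper Fper.
rewrite -(oint_fold tu) -(oint_periodic (- x) tu uper).
rewrite -oint_shift //; apply: eq_oint => t.
by rewrite /u addrA subrr add0r addrC.
Qed.

Section Coefficients.
Variables (g : R -> R).
Hypotheses (tg : tame g) (gper : periodic g (pi *+ 2)).

Lemma fourier_cosE k : fourier_cos g k = pi^-1 * oint (fun t => g t * cos (k%:R * t)) (- pi) pi.
Proof. by rewrite /fourier_cos oint_le_ab // pi_ge_Npi. Qed.

Lemma fourier_sinE k : fourier_sin g k = pi^-1 * oint (fun t => g t * sin (k%:R * t)) (- pi) pi.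
Proof. by rewrite /fourier_sin oint_le_ab // pi_ge_Npi. Qed.

Let tgc k : tame (fun t => g t * cos (k%:R * t)).
Proof. by apply: tameM => //; apply: continuous_tame; exact: continuous_cosZ. Qed.

Let tgs k : tame (fun t => g t * sin (k%:R * t)).
Proof. by apply: tameM => //; apply: continuous_tame; exact: continuous_sinZ. Qed.

Lemma fourier_term k x :
  fourier_cos g k * cos (k%:R * x) + fourier_sin g k * sin (k%:R * x) =
  pi^-1 * oint (fun t => (g (x + t) + g (x - t)) * cos (k%:R * t)) 0 pi.
Proof.
rewrite fourier_cosE fourier_sinE -!mulrA -mulrDr; congr (_ * _).
have h := @fourier_fold g (fun t => cos (k%:R * t)) x tg gper (@continuous_cosZ R _)
  (@periodic_cosZ k).
rewrite (eq_oint 0 pi (g := fun t => g (x + t) * cos (k%:R * t) + g (x - t) * cos (k%:R * - t))).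
  rewrite -h !(mulrC (oint _ _ _)) -!ointZ // -ointD; try exact: tameZ.
  by apply: eq_oint => t; rewrite mulrBr cosB; ring.
by move=> t; rewrite mulrN cosN mulrDl.
Qed.

Lemma fourier_conj_term k x :
  fourier_cos g k * sin (k%:R * x) - fourier_sin g k * cos (k%:R * x) =
  - pi^-1 * oint (fun t => (g (x + t) - g (x - t)) * sin (k%:R * t)) 0 pi.
Proof.
rewrite fourier_cosE fourier_sinE -!mulrA -mulrBr mulNr -mulrN; congr (_ * _).
have h := @fourier_fold g (fun t => sin (k%:R * t)) x tg gper (@continuous_sinZ R _)
  (@periodic_sinZ k).
rewrite (eq_oint 0 pi (g := fun t => g (x + t) * sin (k%:R * t) + g (x - t) * sin (k%:R * - t))).
  rewrite -h !(mulrC (oint _ _ _)) -!ointZ // -ointB; try exact: tameZ.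
  rewrite -ointN; last first.
    apply: tameM => //; apply: continuous_tame => t.
    apply: (@continuous_comp _ _ _ (fun t => t - x) (fun t => sin (k%:R * t))).
      by apply: cvgB; [exact: cvg_id|exact: cvg_cst].
    exact: continuous_sinZ.
  by apply: eq_oint => t; rewrite mulrBr sinB; ring.
by move=> t; rewrite mulrN sinN mulrN mulrBl.
Qed.

(* [a_0 / 2] plus the Fourier terms of order [1 <= k < n]. *)
Definition dirichlet_mean n x : R :=
  pi^-1 * oint (fun t => (g (x + t) + g (x - t)) * dirichlet n t) 0 pi.

(** The number [T_n] at the point [x], since [sine_tail n] equals [K_n] on [(0, pi]]. *)
Definition sine_tail_mean n x : R :=
  - pi^-1 * oint (fun t => (g (x + t) - g (x - t)) * sine_tail n t) 0 pi.

Lemma tame_even_part x : tame (fun t => g (x + t) + g (x - t)).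
Proof. by apply: tameD; [exact: tame_shift|exact: tame_flip]. Qed.

Lemma tame_odd_part x : tame (fun t => g (x + t) - g (x - t)).
Proof. by apply: tameB; [exact: tame_shift|exact: tame_flip]. Qed.

Lemma fourier_partial_sum n N x : (0 < n <= N)%N ->
  \sum_(n <= k < N)
    (fourier_cos g k * cos (k%:R * x) + fourier_sin g k * sin (k%:R * x)) =
  dirichlet_mean N x - dirichlet_mean n x.
Proof.
move=> /andP[n0 nN].
rewrite -(telescope_sumr (fun m => dirichlet_mean m x)) //.
apply: eq_big_nat => k /andP[nk _]; have k0 : (0 < k)%N by exact: leq_trans nk.
rewrite fourier_term /dirichlet_mean -mulrBr -ointB; first last.
- by apply: tameM; [exact: tame_even_part|exact/continuous_tame/continuous_dirichlet].
- by apply: tameM; [exact: tame_even_part|exact/continuous_tame/continuous_dirichlet].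
congr (_ * _); apply: eq_oint => t; rewrite -mulrBr; congr (_ * _).
by rewrite /dirichlet big_nat_recr //=; ring.
Qed.

Lemma sine_tail_mean_succ n x : (0 < n)%N ->
  sine_tail_mean n x - sine_tail_mean n.+1 x =
  (fourier_cos g n * sin (n%:R * x) - fourier_sin g n * cos (n%:R * x)) / n%:R.
Proof.
move=> n0; rewrite fourier_conj_term /sine_tail_mean -mulrBr -ointB; first last.
- by apply: tameM; [exact: tame_odd_part|exact/continuous_tame/continuous_sine_tail].
- by apply: tameM; [exact: tame_odd_part|exact/continuous_tame/continuous_sine_tail].
rewrite -mulrA; congr (_ * _); rewrite mulrC -ointZ; last first.
  by apply: tameM; [exact: tame_odd_part|apply: continuous_tame; exact: continuous_sinZ].
by apply: eq_oint => t; rewrite -mulrBr sine_tail_succ // mulrCA.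
Qed.

End Coefficients.
End Folding.

(** * Fourier series of functions of bounded harmonic variation *)

Section HBVFourier.
Variable R : realType.
Variables (g : R -> R) (V : R).
Hypothesis gper : periodic g (pi *+ 2).
Hypothesis gV : wvariation_le harm g 0 (pi *+ 2) V.
Local Notation oint := (@oriented_integral R).

Let tg : tame g. Proof. exact: HBV_tame gV. Qed.
Let B := `|g 0| + V.
Let gB x : `|g x| <= B. Proof. exact: HBV_bounded. Qed.

Let varR x a : 0 < a -> wvariation_le harm (fun t => g (x + t)) a pi (3 * V).
Proof.
by move=> a0; have := HBV_variation_right gper gV x; apply: wvariation_le_sub => //; exact: ltW.
Qed.

Let varL x a : 0 < a -> wvariation_le harm (fun t => g (x - t)) a pi (3 * V).
Proof.
by move=> a0; have := HBV_variation_left gper gV x; apply: wvariation_le_sub => //; exact: ltW.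
Qed.

Lemma HBV_limits x : exists l1 l2 : R,
  g (x + t) @[t --> 0^'+] --> l1 /\ g (x - t) @[t --> 0^'+] --> l2.
Proof.
have [l1 h1] := right_limit (pi_gt0 R) (varR x).
by have [l2 h2] := right_limit (pi_gt0 R) (varL x); exists l1, l2.
Qed.

(** Uniform in [x], because [3 * V] bounds the variation on either side of every point; this
    dominates the partial sums of the series. *)
Lemma dirichlet_mean_bounded : exists C, forall n x, (0 < n)%N ->
  `|dirichlet_mean g n x| <= C.
Proof.
exists (pi^-1 * (5 * 32 * (B + B) + 3 * 32 * (3 * V + 3 * V))) => n x n0.
rewrite normrM ger0_norm ?invr_ge0 ?pi_ge0 // ler_wpM2l ?invr_ge0 ?pi_ge0 //.
apply: (oscillatory_bounded (ltr0n R 32) (@oscillatory_dirichlet R) n0).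
- exact: tame_even_part.
- by move=> t _; rewrite (le_trans (ler_normD _ _)) // lerD.
- by move=> a a0; apply: wvariation_leD; [exact: harm_ge0|exact: varR|exact: varL].
Qed.

(** [oscillatory_cvg0] covers functions vanishing at 0+ only. The limit [l] is split off, and the
    integral of the kernel alone has a closed form. *)
Lemma oint_sub_limit (phi w : R -> R) (l : R) : tame phi -> continuous w ->
  oint (fun t => (phi t - l) * w t) 0 pi =
  oint (fun t => phi t * w t) 0 pi - l * oint w 0 pi.
Proof.
move=> tphi cw; rewrite -ointZ; last exact: continuous_tame.
rewrite -ointB; last by apply: tameZ; exact: continuous_tame.
  by apply: eq_oint => t; rewrite mulrBl.
by apply: tameM => //; exact: continuous_tame.
Qed.

Lemma cvg_sub_limit (phi : R -> R) (l : R) : phi t @[t --> 0^'+] --> l ->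
  phi t - l @[t --> 0^'+] --> 0.
Proof.
by move=> h; rewrite -[X in _ --> X](subrr l); apply: cvgB => //; exact: cvg_cst.
Qed.

Lemma cvg_dirichlet_mean x l1 l2 :
  g (x + t) @[t --> 0^'+] --> l1 -> g (x - t) @[t --> 0^'+] --> l2 ->
  dirichlet_mean g n x @[n --> \oo] --> (l1 + l2) / 2.
Proof.
move=> h1 h2.
have tp := tame_even_part tg x.
have : oint (fun t => (g (x + t) + g (x - t) - (l1 + l2)) * dirichlet n t) 0 pi
    @[n --> \oo] --> 0.
  apply: (@oscillatory_cvg0 R 32 _ _ (ltr0n R 32) (@oscillatory_dirichlet R)
    _ (B + B + `|l1 + l2|) (3 * V + 3 * V + 0)).
- by apply: tameB => //; exact: tame_cst.
- move=> t _; rewrite (le_trans (ler_normB _ _)) // lerD //.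
  by rewrite (le_trans (ler_normD _ _)) // lerD.
- move=> a a0; apply: wvariation_leD; [exact: harm_ge0| |].
    by apply: wvariation_leD; [exact: (@harm_ge0 R)|exact: varR|exact: varL].
  exact: wvariation_le_cst.
- by apply: cvg_sub_limit; apply: cvgD.
have e n : (0 < n)%N -> oint (fun t => (g (x + t) + g (x - t) - (l1 + l2)) * dirichlet n t) 0 pi =
    pi * (dirichlet_mean g n x - (l1 + l2) / 2).
  move=> n0; rewrite oint_sub_limit //; last exact: continuous_dirichlet.
  have dNK (u : R) : is_derive u 1 (fun t => - sine_tail n t) (dirichlet n u).
    by apply: der_eq (derN (der_sine_tail n u)) _; rewrite opprK.
  rewrite (oint_FTC_all 0 pi (@continuous_dirichlet R n) dNK) sine_tail_pi oppr0 sub0r opprK.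
  rewrite (_ : sine_tail n 0 = pi / 2); last first.
    by rewrite /sine_tail subr0 big1 ?subr0 // => k _; rewrite mulr0 sin0 mulr0.
  by rewrite /dirichlet_mean mulrBr mulVKf ?gt_eqF ?pi_gt0 //; congr (_ - _); ring.
rewrite -(cvg_shiftS (fun n => oint _ 0 pi)) => h.
rewrite -(cvg_shiftS (fun n => dirichlet_mean g n x)).
have h' : pi^-1 * oint (fun t => (g (x + t) + g (x - t) - (l1 + l2)) * dirichlet n.+1 t) 0 pi
    + (l1 + l2) / 2 @[n --> \oo] --> pi^-1 * 0 + (l1 + l2) / 2.
  by apply: cvgD; [exact: cvgMr|exact: cvg_cst].
rewrite mulr0 add0r in h'.
apply: cvg_trans h'; apply: near_eq_cvg; apply: nearW => n.
by rewrite e // mulKf ?subrK // gt_eqF // pi_gt0.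
Qed.

Lemma cvg_sine_tail_mean x l1 l2 :
  g (x + t) @[t --> 0^'+] --> l1 -> g (x - t) @[t --> 0^'+] --> l2 ->
  n%:R * sine_tail_mean g n x @[n --> \oo] --> - pi^-1 * (l1 - l2).
Proof.
move=> h1 h2.
have tp := tame_odd_part tg x.
have : oint (fun t => (g (x + t) - g (x - t) - (l1 - l2)) * (n%:R * sine_tail n t)) 0 pi
    @[n --> \oo] --> 0.
  apply: (@oscillatory_cvg0 R 32 _ _ (ltr0n R 32) (@oscillatory_sine_tail R)
    _ (B + B + `|l1 - l2|) (3 * V + 3 * V + 0)).
- by apply: tameB => //; exact: tame_cst.
- move=> t _; rewrite (le_trans (ler_normB _ _)) // lerD //.
  by rewrite (le_trans (ler_normB _ _)) // lerD.
- move=> a a0; apply: wvariation_leD; [exact: (@harm_ge0 R)| |].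
    by apply: wvariation_leD; [exact: (@harm_ge0 R)|exact: varR|apply: wvariation_leN; exact: varL].
  exact: wvariation_le_cst.
- by apply: cvg_sub_limit; apply: cvgB.
have e n : oint (fun t => (g (x + t) - g (x - t) - (l1 - l2)) * (n%:R * sine_tail n t)) 0 pi =
    - pi * (n%:R * sine_tail_mean g n x) - (l1 - l2) * (n%:R * sine_tail_int n 0).
  have cK : continuous (fun t => n%:R * @sine_tail R n t).
    by move=> t; apply: cvgMr; exact: continuous_sine_tail.
  rewrite oint_sub_limit //.
  have dNL (u : R) : is_derive u 1 (fun t => - (n%:R * sine_tail_int n t)) (n%:R * sine_tail n u).
    by apply: der_eq (derN (derZ _ (der_sine_tail_int n u))) _; rewrite mulrN opprK.
  rewrite (oint_FTC_all 0 pi cK dNL) sine_tail_int_pi mulr0 oppr0 sub0r opprK.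
  congr (_ - _); rewrite /sine_tail_mean.
  have e0 (I : R) : - pi * (n%:R * (- pi^-1 * I)) = n%:R * I.
    by rewrite mulrCA; congr (_ * _); rewrite mulrA mulrNN divff ?mul1r // gt_eqF ?pi_gt0.
  rewrite e0 -ointZ; last first.
    by apply: tameM => //; exact/continuous_tame/continuous_sine_tail.
  by apply: eq_oint => t; rewrite mulrCA.
under eq_fun do rewrite e.
move=> h; have h3 := @cvg_sine_tail_int0 R.
have h4 : - pi * (n%:R * sine_tail_mean g n x) @[n --> \oo] --> 0 + (l1 - l2) * 1.
  have h5 : (l1 - l2) * (n%:R * sine_tail_int n 0) @[n --> \oo] --> (l1 - l2) * 1.
    exact: cvgMr.
  apply: cvg_trans (cvgD h h5); apply: near_eq_cvg; apply: nearW => n /=.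
  by rewrite subrK.
rewrite add0r mulr1 in h4.
have h6 : - pi^-1 * (- pi * (n%:R * sine_tail_mean g n x)) @[n --> \oo] --> - pi^-1 * (l1 - l2).
  exact: cvgMr.
apply: cvg_trans h6; apply: near_eq_cvg; apply: nearW => n /=.
by rewrite mulrA mulrNN mulVf ?mul1r // gt_eqF ?pi_gt0.
Qed.

End HBVFourier.

(** * Asymptotics of the integrated tails *)

Section TailAsymptotics.
Variable R : realType.

Lemma cvg_norm_le (u : nat -> R) (l c : R) : u @ \oo --> l ->
  (\forall n \near \oo, `|u n| <= c) -> `|l| <= c.
Proof.
move=> /cvg_norm ul uc; rewrite -(cvg_lim _ ul) //; apply: limr_le => //.
by apply/cvg_ex; exists `|l|.
Qed.

(** [U n / w n] is an average of the [theta k] for [k >= n], with weights [w k - w k.+1] of total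
    [w n]. *)
Lemma stolz_tail (u w theta U : nat -> R) (rho : R) :
  (forall k, (0 < k)%N -> u k = theta k * (w k - w k.+1)) ->
  (forall k, (0 < k)%N -> w k.+1 <= w k) -> (forall k, (0 < k)%N -> 0 < w k) ->
  w @ \oo --> 0 -> theta @ \oo --> rho ->
  (forall n, (0 < n)%N -> \sum_(n <= k < N) u k @[N --> \oo] --> U n) ->
  U n / w n @[n --> \oo] --> rho.
Proof.
move=> uw wS w0 wcvg thcvg Ucvg; apply/cvgrPdist_le => e e0.
have /cvgrPdist_le /(_ e e0) [n0 _ hn0] := thcvg.
exists n0.+1 => // n /= n0n; have n1 : (0 < n)%N by apply: leq_trans n0n.
have wn := w0 n n1.
suff h : `|rho * w n - U n| <= e * w n.
  have -> : rho - U n / w n = (rho * w n - U n) / w n by rewrite mulrBl mulfK ?gt_eqF.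
  by rewrite normrM (gtr0_norm (_ : 0 < (w n)^-1)) ?invr_gt0 // ler_pdivrMr.
have lim : rho * (w n - w N) - \sum_(n <= k < N) u k @[N --> \oo] --> rho * (w n - 0) - U n.
  apply: cvgB; last exact: Ucvg.
  by apply: cvgMr; apply: cvgB => //; exact: cvg_cst.
rewrite subr0 in lim; apply: (cvg_norm_le lim).
exists n => // N /= nN.
have tel : w n - w N = \sum_(n <= k < N) (w k - w k.+1).
  rewrite -opprB -(telescope_sumr (fun k => w k)) // -sumrN.
  by apply: eq_bigr => k _; rewrite opprB.
apply: le_trans (_ : e * (w n - w N) <= _); last first.
  by rewrite ler_wpM2l ?(ltW e0) // gerBl ltW // w0 // (leq_trans n1).
rewrite tel !mulr_sumr -sumrB; apply: le_trans (ler_norm_sum _ _ _) _.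
apply: ler_sum_nat => k /andP[nk _].
have k0 : (0 < k)%N by apply: leq_trans nk.
rewrite uw // -mulrBl normrM (ger0_norm (_ : 0 <= w k - w k.+1)) ?subr_ge0 ?wS //.
by rewrite ler_wpM2r ?subr_ge0 ?wS //; apply: hn0 => /=; apply: leq_trans nk; exact: ltnW.
Qed.

Lemma abel_power (T : nat -> R) (p n N : nat) : (n <= N)%N ->
  \sum_(n <= k < N) (T k - T k.+1) * k%:R ^- p =
  T n * n%:R ^- p - T N * N%:R ^- p
  - \sum_(n <= k < N) T k.+1 * (k%:R ^- p - k.+1%:R ^- p).
Proof.
move=> nN; rewrite -(subnKC nN); elim: (N - n)%N => [|m IH].
  by rewrite addn0 !big_geq // !subrr.
by rewrite addnS !big_nat_recr ?leq_addr //= IH; ring.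
Qed.

Lemma cvg_natV : (n%:R : R)^-1 @[n --> \oo] --> (0 : R).
Proof. by rewrite -(cvg_shiftS (fun n : nat => (n%:R : R)^-1)); exact: cvg_harmonic. Qed.

Lemma cvg_exp0 (u : nat -> R) (p : nat) : u @ \oo --> 0 -> u n ^+ p.+1 @[n --> \oo] --> 0.
Proof.
move=> u0; elim: p => [|p IH]; first by under eq_fun do rewrite expr1.
have h : u n * u n ^+ p.+1 @[n --> \oo] --> (0 * 0 : R) by exact: cvgM.
rewrite mulr0 in h.
by apply: cvg_trans h; apply: near_eq_cvg; apply: nearW => n; rewrite /= [RHS]exprS.
Qed.

Lemma cvg_exp1 (u : nat -> R) (p : nat) : u @ \oo --> (1 : R) -> u n ^+ p @[n --> \oo] --> (1 : R).
Proof.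
move=> u0; elim: p => [|p IH]; first by under eq_fun do rewrite expr0; exact: cvg_cst.
have h : u n * u n ^+ p @[n --> \oo] --> (1 * 1 : R) by exact: cvgM.
rewrite mulr1 in h.
by apply: cvg_trans h; apply: near_eq_cvg; apply: nearW => n; rewrite /= [RHS]exprS.
Qed.

Lemma cvg_geom1 (u : nat -> R) (p : nat) : u @ \oo --> (1 : R) ->
  \sum_(i < p) u n ^+ i @[n --> \oo] --> (p%:R : R).
Proof.
move=> u1; elim: p => [|p IH].
  by under eq_fun do rewrite big_ord0; exact: cvg_cst.
under eq_fun do rewrite big_ord_recr /=.
by rewrite -natr1; apply: cvgD => //; exact: cvg_exp1.
Qed.

(** With [k + 1 = k y], factoring [y^p - 1] isolates the order [k^-(p+1)]; the cofactor tends to [p]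
    as [y] tends to 1. *)
Lemma power_diff (p k : nat) (y : R) : (0 < k)%N -> y = 1 + k%:R^-1 ->
  k%:R ^- p - k.+1%:R ^- p =
  k%:R ^- p.+1 * (y ^- p * \sum_(i < p) y ^+ i).
Proof.
move=> k0 yE; have kR : 0 < k%:R :> R by rewrite ltr0n.
have y0 : 0 < y by rewrite yE addr_gt0 // invr_gt0.
have -> : k.+1%:R = k%:R * y :> R.
  by rewrite yE mulrDr mulr1 mulfV ?gt_eqF // natr1.
have sub1 := subrX1 y p; have y1 : y - 1 = k%:R^-1 by rewrite yE addrAC subrr add0r.
rewrite y1 in sub1.
have -> : \sum_(i < p) y ^+ i = k%:R * (y ^+ p - 1) by rewrite sub1 mulVKf ?gt_eqF.
have yp : y ^+ p != 0 by rewrite expf_neq0 // gt_eqF.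
have kp : k%:R ^+ p != 0 :> R by rewrite expf_neq0 // gt_eqF.
rewrite exprMn exprS.
move: (y ^+ p) (k%:R ^+ p : R) yp kp (k%:R : R) kR => a b a0 b0 z z0.
by field; rewrite a0 expf_neq0 !gt_eqF.
Qed.

(** The hypothesis controls [T n], not its differences. After Abel summation [T n / n^p - A n] is a
    tail whose terms are comparable with the differences of [k^-(p+1)], so its quotient by
    [n^-(p+1)] tends to [l * p / (p + 1)]. Subtracting from [n * T n] leaves [l / (p + 1)]. *)
Lemma tail_asymptotics (T A : nat -> R) (l : R) (p : nat) :
  n%:R * T n @[n --> \oo] --> l ->
  (forall n, (0 < n)%N ->
     \sum_(n <= k < N) (T k - T k.+1) * k%:R ^- p @[N --> \oo] --> A n) ->
  n%:R ^+ p.+1 * A n @[n --> \oo] --> l / p.+1%:R.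
Proof.
move=> Tl Acvg.
have T0 : T @ \oo --> 0.
  have h : n%:R^-1 * (n%:R * T n) @[n --> \oo] --> (0 * l : R) by apply: cvgM => //; exact: cvg_natV.
  rewrite mul0r -(cvg_shiftS (fun n => n%:R^-1 * (n%:R * T n))) in h.
  rewrite -(cvg_shiftS T); apply: cvg_trans h; apply: near_eq_cvg; apply: nearW => n.
  by rewrite /= mulKf // pnatr_eq0.
pose y k : R := 1 + k%:R^-1.
have y1 : y @ \oo --> (1 : R).
  by rewrite -[X in _ --> X]addr0; apply: cvgD; [exact: cvg_cst|exact: cvg_natV].
pose G q k := \sum_(i < q) y k ^+ i.
pose u k := T k.+1 * (k%:R ^- p - k.+1%:R ^- p).
pose w k : R := k%:R ^- p.+1.
(* The quotient of [u k] by [w k - w k.+1], read off from [power_diff] for [p] and [p + 1]. *)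
pose theta k := k.+1%:R * T k.+1 * (G p k / G p.+1 k).
have y0 k : 0 < y k by rewrite /y ltr_pwDl // invr_ge0.
have G0 k : 0 < G p.+1 k.
  rewrite /G big_ord_recl expr0 ltr_pwDl // sumr_ge0 // => i _.
  by rewrite exprn_ge0 // ltW.
have U n : (0 < n)%N -> \sum_(n <= k < N) u k @[N --> \oo] --> T n * n%:R ^- p - A n.
  move=> n0.
  have TN : T N * N%:R ^- p @[N --> \oo] --> 0.
    case: p {Acvg u w theta G0} => [|p].
      by under eq_fun do rewrite expr0 invr1 mulr1.
    have h : T n * n%:R^-1 ^+ p.+1 @[n --> \oo] --> (0 * 0 : R).
      by apply: cvgM => //; apply: cvg_exp0; exact: cvg_natV.
    rewrite mulr0 in h.
    by apply: cvg_trans h; apply: near_eq_cvg; apply: nearW => m; rewrite /= -exprVn.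
  have h : T n * n%:R ^- p - T N * N%:R ^- p - \sum_(n <= k < N) (T k - T k.+1) * k%:R ^- p
      @[N --> \oo] --> T n * n%:R ^- p - 0 - A n.
    by apply: cvgB; [apply: cvgB => //; exact: cvg_cst|exact: Acvg].
  rewrite subr0 in h; apply: cvg_trans h; apply: near_eq_cvg.
  by exists n => // N /= nN; rewrite (abel_power _ _ nN) opprB addrC subrK.
have st : (T n * n%:R ^- p - A n) / w n @[n --> \oo] --> l * (p%:R / p.+1%:R).
  apply: (@stolz_tail u w theta) => //.
  - move=> k k0; rewrite /u /w /theta (power_diff p k0 (erefl (y k))).
    rewrite (power_diff p.+1 k0 (erefl (y k))) -/(G p k) -/(G p.+1 k).
    have kR : 0 < k%:R :> R by rewrite ltr0n.
    have -> : k.+1%:R = k%:R * y k :> R.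
      by rewrite /y mulrDr mulr1 mulfV ?gt_eqF // natr1.
    have yp : y k ^+ p != 0 by rewrite expf_neq0 // gt_eqF.
    have kp : k%:R ^+ p != 0 :> R by rewrite expf_neq0 // gt_eqF.
    rewrite !exprS; move: (G p k) (G p.+1 k) (G0 k) (T k.+1) => a b b0 t.
    move: (y k ^+ p) (k%:R ^+ p : R) yp kp (k%:R : R) kR (y k) (y0 k) => c d c0 d0 z z0 v v0.
    by field; rewrite !expf_neq0 ?gt_eqF.
  - move=> k k0; have kR : 0 < k%:R :> R by rewrite ltr0n.
    by rewrite lef_pV2 ?posrE ?exprn_gt0 ?ltr0n // lerXn2r ?nnegrE ?ler_nat.
  - by move=> k k0; rewrite invr_gt0 exprn_gt0 // ltr0n.
  - by rewrite /w; under eq_fun do rewrite -exprVn; apply: cvg_exp0; exact: cvg_natV.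
  - apply: cvgM; first by rewrite (cvg_shiftS (fun n => n%:R * T n)).
    by apply: cvgM; [exact: cvg_geom1|apply: cvgV; [rewrite pnatr_eq0|exact: cvg_geom1]].
have h : n%:R * T n - (T n * n%:R ^- p - A n) / w n @[n --> \oo] --> l - l * (p%:R / p.+1%:R).
  exact: cvgB.
have -> : l / p.+1%:R = l - l * (p%:R / p.+1%:R).
  have : p%:R + 1 != 0 :> R by rewrite natr1 pnatr_eq0.
  by rewrite -natr1; move: (p%:R : R) => q q1; field.
apply: cvg_trans h; apply: near_eq_cvg; exists 1%N => // n /= n0.
have nR : 0 < n%:R :> R by rewrite ltr0n.
have np : n%:R ^+ p != 0 :> R by rewrite expf_neq0 // gt_eqF.
rewrite /w exprS; move: (n%:R ^+ p : R) np (n%:R : R) nR (T n) (A n) => a a0 z z0 t s.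
by field; rewrite ?a0 ?expf_neq0 ?gt_eqF.
Qed.

End TailAsymptotics.

(** * Zero-mean antiderivatives of trigonometric polynomials *)

Section TrigPoly.
Variable R : realType.
Implicit Types (alpha beta : nat -> R) (s : seq nat).
Local Notation oint := (@oriented_integral R).
Local Notation Z := (@zero_mean_antiderivative R).

Definition trig_poly s alpha beta (x : R) : R :=
  \sum_(k <- s) (alpha k * cos (k%:R * x) + beta k * sin (k%:R * x)).

Lemma der_trig_poly s alpha beta (x : R) :
  is_derive x 1 (trig_poly s alpha beta)
    (trig_poly s (fun k => k%:R * beta k) (fun k => - k%:R * alpha k) x).
Proof.
apply: (@der_sum R _ s (fun k (x : R) => alpha k * cos (k%:R * x) + beta k * sin (k%:R * x))
  (fun k (x : R) => k%:R * beta k * cos (k%:R * x) + - k%:R * alpha k * sin (k%:R * x)) x) => k.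
apply: der_eq (derD (derZ _ (der_cosZ _ _)) (derZ _ (der_sinZ _ _))) _.
by rewrite !mulNr; ring.
Qed.

Lemma continuous_trig_poly s alpha beta : continuous (trig_poly s alpha beta).
Proof. by move=> x; exact: der_cont (der_trig_poly _ _ _ _). Qed.

Lemma eq_trig_poly s alpha beta alpha' beta' (x : R) :
  {in s, alpha =1 alpha'} -> {in s, beta =1 beta'} ->
  trig_poly s alpha beta x = trig_poly s alpha' beta' x.
Proof. by move=> ha hb; apply: eq_big_seq => k ks; rewrite ha // hb. Qed.

Lemma der_trig_poly_primitive s alpha beta (x : R) : all (fun k => 0 < k)%N s ->
  is_derive x 1 (trig_poly s (fun k => - beta k / k%:R) (fun k => alpha k / k%:R))
    (trig_poly s alpha beta x).
Proof.
move=> /allP s0; apply: der_eq (der_trig_poly _ _ _ _) _.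
apply: eq_trig_poly => k /s0; rewrite -(ltr0n R) => k0.
  by rewrite mulrCA mulfV ?mulr1 // gt_eqF.
by rewrite mulNr mulNr mulrN opprK mulrCA mulfV ?mulr1 // gt_eqF.
Qed.

(** The primitive without constant term has mean zero because, all frequencies being positive, it
    has itself a primitive with equal values at [-pi] and [pi]. *)
Lemma zero_mean_trig_poly s alpha beta : all (fun k => 0 < k)%N s ->
  Z (trig_poly s alpha beta) =
  trig_poly s (fun k => - beta k / k%:R) (fun k => alpha k / k%:R).
Proof.
move=> s0; apply/funext => x; apply: zero_mean_FTC.
- exact: continuous_trig_poly.
- by move=> t; exact: der_trig_poly_primitive.
rewrite (oint_FTC_all _ _ (@continuous_trig_poly s _ _)
  (fun t => @der_trig_poly_primitive s _ _ t s0)).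
rewrite /trig_poly -sumrB big1 // => k _.
by rewrite mulrN cosN sinN sin_natpi oppr0 !mulr0 !addr0 subrr.
Qed.

(** One antiderivative exchanges sines and cosines, two multiply each coefficient by [- 1 / k^2];
    hence the induction by pairs. *)
Lemma iter_trig_poly_even s alpha beta r : all (fun k => 0 < k)%N s ->
  iter_antiderivative r.*2 (trig_poly s alpha beta) =
  trig_poly s (fun k => (-1) ^+ r * alpha k / k%:R ^+ r.*2)
              (fun k => (-1) ^+ r * beta k / k%:R ^+ r.*2).
Proof.
move=> s0; elim: r => [|r IH].
  apply/funext => x; apply: eq_trig_poly => k _; by rewrite !expr0 mul1r divr1.
rewrite doubleS /iter_antiderivative !iterS -/(iter_antiderivative r.*2 _) IH.
rewrite !zero_mean_trig_poly //; apply/funext => x.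
have /allP sP := s0.
by apply: eq_trig_poly => k /sP; rewrite -(ltr0n R) => k0;
  rewrite !exprS !mulNr; field; rewrite ?expf_neq0 ?gt_eqF.
Qed.

Lemma iter_trig_poly_odd s alpha beta r (x : R) : all (fun k => 0 < k)%N s ->
  iter_antiderivative r.*2.+1 (trig_poly s alpha beta) x =
  (-1) ^+ r * \sum_(k <- s) (alpha k * sin (k%:R * x) - beta k * cos (k%:R * x)) / k%:R
                 * k%:R ^- r.*2.
Proof.
move=> s0; rewrite /iter_antiderivative iterS -/(iter_antiderivative r.*2 _).
rewrite iter_trig_poly_even // zero_mean_trig_poly // mulr_sumr.
have /allP sP := s0.
apply: eq_big_seq => k /sP; rewrite -(ltr0n R) => k0.
by field; rewrite ?expf_neq0 ?gt_eqF.
Qed.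

Lemma bounded_cvg_iter (f_ : nat -> R -> R) (f : R -> R) m : bounded_cvg f_ f ->
  bounded_cvg (fun n => iter_antiderivative m (f_ n)) (iter_antiderivative m f).
Proof.
move=> fc; elim: m => // m IH.
by rewrite /iter_antiderivative; exact: bounded_cvg_zero_mean.
Qed.

End TrigPoly.

(** * Term-by-term integration of the tails and their limit at a jump *)

Section PartA.
Variable R : realType.
Variables (g : R -> R) (V : R).
Hypothesis gper : periodic g (pi *+ 2).
Hypothesis gV : wvariation_le harm g 0 (pi *+ 2) V.

Let tg : tame g. Proof. exact: (HBV_tame gper gV). Qed.

Lemma cvg_fourier_tail n x l1 l2 : (0 < n)%N ->
  g (x + t) @[t --> 0^'+] --> l1 -> g (x - t) @[t --> 0^'+] --> l2 ->
  trig_poly (index_iota n N) (fourier_cos g) (fourier_sin g) x @[N --> \oo]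
    --> (l1 + l2) / 2 - dirichlet_mean g n x.
Proof.
move=> n0 h1 h2.
have h : dirichlet_mean g N x - dirichlet_mean g n x @[N --> \oo] -->
    (l1 + l2) / 2 - dirichlet_mean g n x.
  by apply: cvgB; [exact: (cvg_dirichlet_mean gper gV h1 h2)|exact: cvg_cst].
apply: cvg_trans h; apply: near_eq_cvg; exists n => // N /= nN.
by rewrite /trig_poly (fourier_partial_sum tg gper) // n0.
Qed.

Lemma fourier_tail_HBV n x l1 l2 : (0 < n)%N ->
  g (x + t) @[t --> 0^'+] --> l1 -> g (x - t) @[t --> 0^'+] --> l2 ->
  fourier_tail g n x = (l1 + l2) / 2 - dirichlet_mean g n x.
Proof.
move=> n0 h1 h2; have := cvg_fourier_tail n0 h1 h2.
by move=> /(cvg_lim (@Rhausdorff R)) <-.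
Qed.

Lemma bounded_cvg_fourier_tail n : (0 < n)%N ->
  bounded_cvg (fun N => trig_poly (index_iota n N) (fourier_cos g) (fourier_sin g))
    (fourier_tail g n).
Proof.
move=> n0; split.
- by move=> N; apply: continuous_tame; exact: continuous_trig_poly.
- move=> M; have [C hC] := dirichlet_mean_bounded gper gV.
  have C0 : 0 <= C by apply: le_trans (normr_ge0 _) (hC 1%N 0 isT).
  exists (C + C) => N x _; case: (leqP n N) => nN.
    rewrite /trig_poly (fourier_partial_sum tg gper) ?n0 //.
    by rewrite (le_trans (ler_normB _ _)) // lerD // hC // (leq_trans n0).
  by rewrite /trig_poly big_geq ?normr0 ?addr_ge0 // ltnW.
- move=> x; have [l1 [l2 [h1 h2]]] := HBV_limits gper gV x.
  by rewrite (fourier_tail_HBV n0 h1 h2); exact: cvg_fourier_tail.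
Qed.

(** Bounded convergence of the partial sums passes through all the antiderivatives, which are
    explicit on trigonometric polynomials. *)
Lemma cvg_iter_fourier_tail n r x : (0 < n)%N ->
  \sum_(n <= k < N) (sine_tail_mean g k x - sine_tail_mean g k.+1 x) * k%:R ^- r.*2
    @[N --> \oo] --> (-1) ^+ r * iter_antiderivative r.*2.+1 (fourier_tail g n) x.
Proof.
move=> n0; have [_ _ h] := bounded_cvg_iter r.*2.+1 (bounded_cvg_fourier_tail n0).
have h' : (-1) ^+ r * iter_antiderivative r.*2.+1
    (trig_poly (index_iota n N) (fourier_cos g) (fourier_sin g)) x @[N --> \oo]
    --> (-1) ^+ r * iter_antiderivative r.*2.+1 (fourier_tail g n) x.
  by apply: cvgMr; exact: h.
apply: cvg_trans h'; apply: near_eq_cvg; apply: nearW => N.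
have s0 : all (fun k => 0 < k)%N (index_iota n N).
  by apply/allP => k; rewrite mem_index_iota => /andP[nk _]; exact: leq_trans nk.
rewrite iter_trig_poly_odd // mulrA -expr2 sqrr_sign mul1r.
apply: eq_big_seq => k /(allP s0) k0.
by rewrite (sine_tail_mean_succ tg gper).
Qed.

Lemma cvg_at_right_shift (x l : R) : g (x + t) @[t --> 0^'+] --> l ->
  g t @[t --> x^'+] --> l.
Proof.
move=> h; apply/cvgrPdist_le => e e0.
have /cvgrPdist_le /(_ e e0) [d /= d0 hd] := h.
exists d => //= y xy yx; have -> : y = x + (y - x) by rewrite addrC subrK.
apply: hd; last by rewrite subr_gt0.
by rewrite /= sub0r normrN distrC.
Qed.

Lemma cvg_at_left_shift (x l : R) : g (x - t) @[t --> 0^'+] --> l ->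
  g t @[t --> x^'-] --> l.
Proof.
move=> h; apply/cvgrPdist_le => e e0.
have /cvgrPdist_le /(_ e e0) [d /= d0 hd] := h.
exists d => //= y xy yx; have -> : y = x - (x - y) by rewrite opprB addrC subrK.
apply: hd; last by rewrite subr_gt0.
by rewrite /= sub0r normrN.
Qed.

Lemma HBV_tail_jump r x : tail_jump_relation g r x.
Proof.
have [l1 [l2 [h1 h2]]] := HBV_limits gper gV x.
have jumpE : jump g x = l1 - l2.
  rewrite /jump (cvg_lim (@Rhausdorff R) (cvg_at_right_shift h1)).
  by rewrite (cvg_lim (@Rhausdorff R) (cvg_at_left_shift h2)).
have := tail_asymptotics (cvg_sine_tail_mean gper gV h1 h2)
  (fun n n0 => @cvg_iter_fourier_tail n r x n0).
rewrite /tail_jump_relation jumpE => h.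
have -> : (-1) ^+ r.+1 / (r.*2.+1%:R * pi) * (l1 - l2) =
    (-1) ^+ r * (- pi^-1 * (l1 - l2) / r.*2.+1%:R).
  by rewrite exprS mulN1r invfM; ring.
have h' : (-1) ^+ r * (n%:R ^+ r.*2.+1 * ((-1) ^+ r * iter_antiderivative r.*2.+1 (fourier_tail g n) x))
   @[n --> \oo] --> (-1) ^+ r * (- pi^-1 * (l1 - l2) / r.*2.+1%:R).
  by apply: cvgMr.
apply: cvg_trans h'; apply: near_eq_cvg; apply: nearW => n.
by rewrite mulrCA [X in _ * X]mulrA -expr2 sqrr_sign mul1r.
Qed.

End PartA.

(** * Comparison of Lambda with the harmonic weights *)

Section Rearrangement.
Variable R : realType.

Lemma wsum_insert (T : Type) (w : nat -> R) (d : T -> R) (x : T) s1 s2 :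
  (forall i, w i.+1 <= w i) -> all (fun y => d y <= d x) s1 ->
  wsum w d (s1 ++ x :: s2) <= wsum w d (x :: s1 ++ s2).
Proof.
elim: s1 w => [|y s1 IH] w wS //= /andP[yx s1x].
have /= h := IH (w \o succn) (fun i => wS i.+1) s1x.
apply: le_trans (lerD (lexx _) h) _.
have : 0 <= (d x - d y) * (w 0%N - w 1%N) by rewrite mulr_ge0 // subr_ge0.
by rewrite /=; lra.
Qed.

Lemma perm_mid (T : eqType) (x : T) s1 s2 : perm_eq (s1 ++ x :: s2) (x :: s1 ++ s2).
Proof. by apply/permP => a; rewrite /= !count_cat /=; lia. Qed.

(** The head of [t] is a largest entry of [s]; bringing it to the front puts it under the heaviest
    weight, and the induction goes on with the rest. *)
Lemma wsum_sort_ge (T : eqType) (w : nat -> R) (d : T -> R) (s t : seq T) :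
  (forall i, w i.+1 <= w i) -> perm_eq s t -> sorted (fun x y => d y <= d x) t ->
  wsum w d s <= wsum w d t.
Proof.
elim: t s w => [|x t IH] s w wS st tS.
  by move/perm_nilP: st => ->.
have xs : x \in s by rewrite (perm_mem st) mem_head.
have xmax y : y \in s -> d y <= d x.
  rewrite (perm_mem st) inE => /predU1P[->//|yt].
  have tr : transitive (fun x y => d y <= d x) by move=> a b c ab bc; exact: le_trans ab.
  by have /allP := order_path_min tr tS; apply.
move: st xmax; case/splitPr: xs => s1 s2 st xmax.
apply: le_trans (wsum_insert _ wS _) _.
  by apply/allP => y ys; apply: xmax; rewrite mem_cat ys.
rewrite /= lerD2l; apply: IH; [by move=> i; exact: wS| |exact: path_sorted tS].
by rewrite -(perm_cons x) -(permPl (perm_mid x s1 s2)).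
Qed.

(** By induction the sum up to [n] is at most [delta n] times the partial sum of [a]. As that
    partial sum is nonpositive, passing to a smaller [delta] only enlarges the bound. *)
Lemma abel_le0 (delta a : nat -> R) N : (forall i, 0 <= delta i) ->
  (forall i, (i.+1 < N)%N -> delta i.+1 <= delta i) ->
  (forall n, \sum_(i < n) a i <= 0) -> \sum_(i < N) delta i * a i <= 0.
Proof.
move=> d0 dS A0.
suff h n : (n < N)%N -> \sum_(i < n.+1) delta i * a i <= delta n * \sum_(i < n.+1) a i.
  case: N dS h => [|N] dS h; first by rewrite big_ord0.
  by apply: le_trans (h N (ltnSn N)) _; rewrite mulr_ge0_le0.
elim: n => [|n IH] nN; first by rewrite !big_ord_recr /= !big_ord0 !add0r.
rewrite [X in X <= _]big_ord_recr [in X in _ <= X]big_ord_recr /= mulrDr lerD2r.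
apply: le_trans (IH (ltnW nN)) _.
have := A0 n.+1; have := dS n nN.
by move: (\sum_(i < n.+1) a i) => z h1 h2; nra.
Qed.

(** Otherwise [hsum n] is at most [M] times the partial sum of the [1 / lam i] for every [n]. On a
    family sorted by decreasing increments, Abel summation turns this into a comparison of the two
    weighted sums, so [LambdaBV lam] would be contained in HBV. *)
Lemma hsum_ratio_unbounded (lam : nat -> R) : Lambda_sequence lam ->
  @HBV R `<` LambdaBV lam ->
  forall M, exists n, M * \sum_(i < n) (lam i)^-1 < hsum R n.
Proof.
move=> [lamS lam0 _ _] [_ nsub] M; apply: contrapT => hneg; apply: nsub.
have hM n : hsum R n <= M * \sum_(i < n) (lam i)^-1.
  by rewrite leNgt; apply/negP => h; apply: hneg; exists n.
have wS i : (lam i.+1)^-1 <= (lam i)^-1 by rewrite lef_pV2 ?posrE // lamS.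
have M0 : 0 <= M.
  have := hM 1%N; rewrite /hsum !big_ord1 /harm invr1 => h.
  have : 0 < M / lam 0%N by apply: lt_le_trans h.
  by rewrite pmulr_lgt0 ?invr_gt0 // => /ltW.
move=> f /(LambdaBVP f lam0 lamS) [V fV]; apply/HBVP; exists (M * V) => s fs.
pose d (I : R * R) := `|incr f I|.
pose leT (I J : R * R) := d J <= d I.
pose t := sort leT s.
have st : perm_eq s t by rewrite perm_sym perm_sort.
have tS : sorted leT t by apply: sort_sorted => I J; exact: le_total.
have ft : itvs 0 (pi *+ 2) t.
  have /andP[sa sp] := fs; apply/andP; split; first by rewrite (perm_all _ (permEl (perm_sort _ _))).
  have nosym : symmetric (@nonoverlapping R) by move=> I J; rewrite /nonoverlapping orbC.
  have pp (u v : seq (R * R)) : perm_eq u v -> pairwise (@nonoverlapping R) u ->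
      pairwise (@nonoverlapping R) v.
    elim: v u => [|x v IH] u uv //; have xu : x \in u by rewrite (perm_mem uv) mem_head.
    move: uv; case/splitPr: xu => u1 u2; rewrite (permPl (perm_mid x u1 u2)) perm_cons => uv.
    rewrite pairwise_cat /= allrel_consr => /and3P[/andP[h1 h2] h3 /andP[h4 h5]].
    apply/andP; split; last by apply: IH uv _; rewrite pairwise_cat h2 h3 h5.
    rewrite -(perm_all _ uv) all_cat h4 andbT; apply: sub_all h1 => I.
    by rewrite nosym.
  exact: pp st sp.
apply: le_trans (wsum_sort_ge (@harmS R) st tS) _.
apply: le_trans (ler_wpM2l M0 (fV t ft)).
rewrite -subr_le0 !(wsumE (0, 0)) mulr_sumr -sumrB.
under eq_bigr => i _ do rewrite mulrCA -mulrBr.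
apply: (@abel_le0 (fun i => d (nth (0, 0) t i)) (fun i => harm i - M * (lam i)^-1)).
- by move=> i; exact: normr_ge0.
- move=> i it.
  have tr : transitive leT by move=> a b c ab bc; exact: le_trans ab.
  by have := sorted_ltn_nth tr (0, 0) tS; apply; rewrite ?inE // ltnW.
- by move=> n; rewrite sumrB -mulr_sumr subr_le0; exact: hM.
Qed.

(** The list is in arbitrary order: its head separates the others into those on its left and those
    on its right, both shorter families. *)
Lemma sum_itvs_mono (h : R -> R) (a b : R) (s : seq (R * R)) :
  {homo h : x y / x <= y} -> a <= b -> itvs a b s ->
  \sum_(I <- s) (h I.2 - h I.1) <= h b - h a.
Proof.
move=> hm; have [n sn] := ubnP (size s); elim: n s a b sn => // n IH [|I s] a b sn ab fs.
  by rewrite big_nil subr_ge0 hm.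
have /andP[/= /andP[/and3P[aI II Ib] sa] /andP[Is sp]] := fs.
pose p (J : R * R) := J.2 <= I.1.
have sz q : (size [seq J <- s | q J] < n)%N by rewrite size_filter (leq_ltn_trans (count_size _ _)).
rewrite big_cons (bigID p) /= -[X in _ + (X + _)]big_filter -[X in _ + (_ + X)]big_filter.
have h1 : \sum_(J <- [seq J <- s | p J]) (h J.2 - h J.1) <= h I.1 - h a.
  apply: IH => //; apply/andP; split; last exact: pairwise_filter.
  rewrite all_filter; apply: sub_all sa => J /= /and3P[j1 j2 j3].
  by apply/implyP => pJ; rewrite j1 j2.
have h2 : \sum_(J <- [seq J <- s | ~~ p J]) (h J.2 - h J.1) <= h b - h I.2.
  apply: IH => //; apply/andP; split; last exact: pairwise_filter.
  rewrite all_filter; apply/allP => J Js /=; apply/implyP => pJ.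
  have /and3P[j1 j2 j3] := allP sa _ Js; rewrite j2 j3 !andbT.
  by have := allP Is _ Js; rewrite /nonoverlapping -/(p J) (negbTE pJ) orbF.
by lra.
Qed.

End Rearrangement.

(** * Truncated cosines *)

Section TruncatedCosine.
Variable R : realType.
Variables (n m : nat).
Hypotheses (n0 : (0 < n)%N) (nm : (n < m)%N).
Local Notation oint := (@oriented_integral R).

Let nu : R := m%:R - 2^-1.
Let al : R := pi / (2 * nu).
Let be : R := (n%:R + 2^-1) * pi / nu.

(* Clipping [nu y], [nu = m - 1/2], to [[pi/2, (n + 1/2) pi]], whose ends are
   zeros of the cosine, cuts the wave off after [n] half periods. *)
Definition tcos (y : R) : R := cos ((m%:R - 2^-1) *
  Num.max (pi / (2 * (m%:R - 2^-1))) (Num.min ((n%:R + 2^-1) * pi / (m%:R - 2^-1)) y)).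

Let clip (y : R) := Num.max al (Num.min be y).

Let tcosE y : tcos y = cos (nu * clip y). Proof. by []. Qed.

Let n1 : 1 <= n%:R :> R. Proof. by rewrite ler1n. Qed.
Let mn : n%:R + 1 <= m%:R :> R. Proof. by rewrite natr1 ler_nat. Qed.
Let pi0 := pi_gt0 R.

Let nu_gt1 : 1 < nu. Proof. by have := n1; have := mn; rewrite /nu; lra. Qed.
Let nu0 : 0 < nu. Proof. exact: lt_trans nu_gt1. Qed.
Let nu_m : nu <= m%:R. Proof. by rewrite /nu; lra. Qed.
Let m_nu : m%:R <= 2 * nu. Proof. by have := n1; have := mn; rewrite /nu; lra. Qed.

Let pi4 : pi < 4 :> R.
Proof. by have := pihalf_lt2 R; rewrite ltr_pdivrMr //; lra. Qed.

Let npi : (n%:R + 2^-1) * pi <= 8 * n%:R :> R.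
Proof.
have h : 0 <= n%:R + 2^-1 :> R by have := n1; lra.
by have := ler_wpM2l h (ltW pi4); have := n1; lra.
Qed.

Let al0 : 0 < al. Proof. by rewrite divr_gt0 // mulr_gt0. Qed.

Let al_be : al < be.
Proof.
rewrite /al /be ltr_pdivrMr ?mulr_gt0 //.
rewrite (_ : _ / nu * (2 * nu) = pi + 2 * (n%:R * pi)); last first.
  by move: (n%:R : R) (@pi R) => a p; field; rewrite gt_eqF.
by rewrite ltrDl !mulr_gt0 // ltr0n.
Qed.

(** This is exactly [n < m]: the truncated wave fits in [[0, pi]]. *)
Let be_pi : be <= pi.
Proof. by have := mn; rewrite /be ler_pdivrMr // mulrC ler_pM2l // /nu; lra. Qed.

Let nu_al : nu * al = pi / 2.
Proof. by rewrite /al; move: (@pi R) => p; field; rewrite gt_eqF. Qed.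

Let nu_be : nu * be = n%:R * pi + pi / 2.
Proof.
by rewrite /be; move: (@pi R) (n%:R : R) => p a; field; rewrite gt_eqF.
Qed.

Let cos_al : cos (nu * al) = 0. Proof. by rewrite nu_al cos_pihalf. Qed.

Let cos_be : cos (nu * be) = 0.
Proof. by rewrite nu_be cosD sin_natpi cos_pihalf mulr0 mul0r subrr. Qed.

Lemma tcos_le1 y : `|tcos y| <= 1. Proof. exact: cos_max. Qed.

Let clip_mono : {homo clip : x y / x <= y}.
Proof.
move=> x y xy; rewrite /clip ge_max le_max lexx /= le_max; apply/orP; right.
by rewrite le_min ge_min lexx /= ge_min xy orbT.
Qed.

Let clip_in y : al <= y <= be -> clip y = y.
Proof. by move=> /andP[h1 h2]; rewrite /clip min_r // max_r. Qed.

Lemma tcos_left y : y <= pi / (2 * (m%:R - 2^-1)) -> tcos y = 0.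
Proof.
move=> h; rewrite tcosE /clip min_r; last by rewrite (le_trans h) // ltW.
by rewrite max_l.
Qed.

Lemma tcos_right y : (n%:R + 2^-1) * pi / (m%:R - 2^-1) <= y -> tcos y = 0.
Proof.
by move=> h; rewrite tcosE /clip min_l // max_r // ltW.
Qed.

Lemma tcos_nonpos y : y <= 0 -> tcos y = 0.
Proof. by move=> h; apply: tcos_left; rewrite (le_trans h) // ltW. Qed.

Lemma tcos_support y : 16 * n%:R / m%:R <= y -> tcos y = 0.
Proof.
move=> h; apply: tcos_right; apply: le_trans h.
have m0 : 0 < m%:R :> R by apply: lt_le_trans nu_m.
rewrite -/nu ler_pdivlMr // mulrAC ler_pdivrMr //.
have h1 : 0 <= (n%:R + 2^-1) * pi :> R by apply: mulr_ge0; [have := n1; lra|exact: ltW].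
have := ler_wpM2l h1 m_nu; have := ler_wpM2r (ltW nu0) npi.
by lra.
Qed.

Lemma tcos_ge_pi y : pi <= y -> tcos y = 0.
Proof. by move=> h; apply: tcos_right; rewrite (le_trans be_pi). Qed.

Lemma continuous_tcos : continuous tcos.
Proof.
move=> y; rewrite /tcos.
apply: (@continuous_comp _ _ _ clip (fun t => cos (nu * t))); last exact: continuous_cosZ.
apply: (@continuous_comp _ _ _ (fun y => Num.min be y) (fun y => Num.max al y)).
  by apply: continuous_min => //; exact: cvg_cst.
by apply: continuous_max => //; exact: cvg_cst.
Qed.

Lemma cos_lipschitz (u v : R) : `|cos v - cos u| <= `|v - u|.
Proof.
wlog uv : u v / u <= v => [hw|].
  by case: (leP u v) => [/hw //|/ltW /hw]; rewrite distrC [`|u - v|]distrC.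
rewrite (ger0_norm (_ : 0 <= v - u)) ?subr_ge0 //.
apply: (@der_norm_le R cos id (fun x => - sin x) (fun=> 1)) => // x _.
by rewrite normrN sin_max.
Qed.

(** Each increment is at most 2 and the unweighted total is at most [n * pi <= 2 * (2 * n)], so the
    worst case is [2 * n] increments equal to 2; the second half of their weights is below the
    first. *)
Lemma tcos_variation (w : nat -> R) (b : R) : (forall i, 0 <= w i) ->
  (forall i, w i.+1 <= w i) -> 0 <= b ->
  wvariation_le w tcos 0 b (4 * \sum_(i < n) w i).
Proof.
move=> w0 wS b0 s fs.
have h1 : wsum w (fun I => `|incr tcos I|) s <= 2 * \sum_(i < n + n) w i.
  apply: wsum_le_cap => //.
    move=> I; rewrite normr_ge0 /= (le_trans (ler_normB _ _)) //.
    by have := tcos_le1 I.2; have := tcos_le1 I.1; lra.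
  apply: le_trans (_ : nu * (clip b - clip 0) <= _).
    apply: le_trans (ler_wpM2l (ltW nu0) (sum_itvs_mono clip_mono b0 fs)).
    rewrite mulr_sumr big_seq [X in _ <= X]big_seq; apply: ler_sum => I Is.
    have /andP[/allP sa _] := fs; have /and3P[_ II _] := sa _ Is.
    rewrite /incr !tcosE; apply: le_trans (cos_lipschitz _ _) _.
    by rewrite -mulrBr normrM (gtr0_norm nu0) (ger0_norm (_ : 0 <= clip _ - _)) ?subr_ge0 ?clip_mono.
  apply: le_trans (_ : nu * (be - al) <= _).
    rewrite ler_wpM2l ?(ltW nu0) //; apply: lerB.
      by rewrite /clip ge_max ltW //= ge_min lexx.
    by rewrite /clip le_max lexx.
  rewrite mulrBr nu_al nu_be natrD.
  have : n%:R * pi <= n%:R * 4 :> R by rewrite ler_wpM2l // ltW // pi4.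
  by lra.
have h2 : \sum_(i < n + n) w i <= 2 * \sum_(i < n) w i.
  rewrite big_split_ord /= mulr_natl mulr2n lerD2l; apply: ler_sum => i _.
  by apply: ((nonincreasing_seqP w).1 wS); exact: leq_addl.
by lra.
Qed.

Let oint_tcos (K : R -> R) : continuous K ->
  oint (fun t => tcos t * K t) 0 pi = oint (fun t => cos (nu * t) * K t) al be.
Proof.
move=> cK.
have tb : tame (fun t => tcos t * K t).
  by apply: tameM; apply: continuous_tame => //; exact: continuous_tcos.
have zero a b : a <= b -> (forall t, a < t < b -> tcos t = 0) ->
    oint (fun t => tcos t * K t) a b = 0.
  move=> ab h; apply/normr0_eq0/le_anti; rewrite normr_ge0 andbT.
  rewrite -(mul0r (b - a)); apply: norm_oint_le => // t /h ->.
  by rewrite mul0r normr0.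
rewrite (oint_add 0 al pi tb) (oint_add al be pi tb).
rewrite zero ?(ltW al0) //; last by move=> t /andP[_ t1]; rewrite tcos_left // ltW.
rewrite [X in _ + (_ + X)]zero //; last by move=> t /andP[t1 _]; rewrite tcos_right // ltW.
rewrite add0r addr0; apply: eq_oint_oo => // t.
rewrite (min_l (ltW al_be)) (max_r (ltW al_be)) => /andP[t1 t2].
by rewrite tcosE clip_in // !ltW.
Qed.

(** The wave is fast compared with [k], and its support lies in an interval of length [16 / k], on
    which the kernel is at most 8. *)
Lemma tcos_integral_high k : (0 < k)%N -> (k * n <= m)%N ->
  `|k%:R * oint (fun t => tcos t * sine_tail k t) 0 pi| <= 128.
Proof.
move=> k0 knm; rewrite oint_tcos; last exact: continuous_sine_tail.
rewrite normrM ger0_norm //.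
have h : `|oint (fun t => cos (nu * t) * sine_tail k t) al be| <= 8 * (be - al).
  apply: norm_oint_le; first exact: ltW.
    by apply: tameM; apply: continuous_tame; [exact: continuous_cosZ|exact: continuous_sine_tail].
  move=> t /andP[t1 t2]; rewrite normrM -[8]mul1r; apply: ler_pM => //; first exact: cos_max.
  by apply: sine_tail_bounded => //; rewrite (le_trans (ltW al0) (ltW t1)) (le_trans (ltW t2)).
apply: le_trans (ler_wpM2l (ler0n _ k) h) _.
have knR : k%:R * n%:R <= m%:R :> R by rewrite -natrM ler_nat.
have kn : k%:R * (be - al) <= 16; last by lra.
have kR : 0 <= k%:R :> R by [].
apply: le_trans (_ : k%:R * be <= _); first by rewrite ler_wpM2l // gerBl ltW.
rewrite /be mulrA ler_pdivrMr //.
have := ler_wpM2l kR npi; have := m_nu.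
by lra.
Qed.

(** The wave is slow compared with [k], so it is the kernel that gets integrated. The boundary terms
    vanish because the wave is cut at zeros of the cosine, and the gain [1 / k^2] of [sine_tail_int]
    beats the factor [nu] and the singularity at [al]. *)
Lemma tcos_integral_low k : (0 < k)%N -> (n * m <= k)%N ->
  `|k%:R * oint (fun t => tcos t * sine_tail k t) 0 pi| <= 128.
Proof.
move=> k0 nmk; rewrite oint_tcos; last exact: continuous_sine_tail.
have kR : 0 < k%:R :> R by rewrite ltr0n.
have cL := @continuous_sine_tail_int R k.
have dF (t : R) : is_derive t 1 (fun t => cos (nu * t) * - sine_tail_int k t)
   (cos (nu * t) * sine_tail k t + nu * (sin (nu * t) * sine_tail_int k t)).
  by apply: der_eq (derM (der_cosZ nu t) (derN (der_sine_tail_int k t))) _; ring.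
have cK : continuous (fun t => cos (nu * t) * sine_tail k t).
  by move=> t; apply: cvgM; [exact: continuous_cosZ|exact: continuous_sine_tail].
have cS : continuous (fun t => nu * (sin (nu * t) * sine_tail_int k t)).
  by move=> t; apply: cvgMr; apply: cvgM; [exact: continuous_sinZ|exact: cL].
have cc : continuous (fun t => cos (nu * t) * sine_tail k t + nu * (sin (nu * t) * sine_tail_int k t)).
  by move=> t; apply: cvgD; [exact: cK|exact: cS].
have E := oint_FTC_all al be cc dF.
rewrite cos_al cos_be !mul0r subrr ointD in E; [|exact: continuous_tame..].
move/eqP: E; rewrite addr_eq0 => /eqP ->; rewrite mulrN normrN ointZ; last first.
  by apply: continuous_tame => t; apply: cvgM; [exact: continuous_sinZ|exact: cL].
have h : `|oint (fun t => sin (nu * t) * sine_tail_int k t) al be| <= 32 / (k%:R ^+ 2 * al) * (be - al).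
  apply: norm_oint_le; first exact: ltW.
    by apply: continuous_tame => t; apply: cvgM; [exact: continuous_sinZ|exact: cL].
  move=> t /andP[t1 t2]; rewrite normrM -[X in _ <= X]mul1r; apply: ler_pM => //.
    exact: sin_max.
  have t0 : 0 < t by exact: lt_trans t1.
  apply: le_trans (sine_tail_int_bound k0 _) _; first by rewrite t0 (le_trans (ltW t2)).
  have k2 : 0 < k%:R ^+ 2 :> R by rewrite exprn_gt0.
  rewrite ler_wpM2l // lef_pV2 ?posrE; [|exact: mulr_gt0|exact: mulr_gt0].
  by rewrite ler_pM2l // ltW.
rewrite !normrM (gtr0_norm kR) (gtr0_norm nu0).
apply: le_trans (_ : k%:R * (nu * (32 / (k%:R ^+ 2 * al) * (be - al))) <= _).
  by rewrite !ler_wpM2l // ltW.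
have -> : k%:R * (nu * (32 / (k%:R ^+ 2 * al) * (be - al))) = 32 * (nu * (be - al)) / (k%:R * al).
  by move: (k%:R : R) kR be al al0 => z z0 b a a0; field; rewrite !gt_eqF.
rewrite mulrBr nu_al nu_be addrK ler_pdivrMr; last exact: mulr_gt0.
have nmR : n%:R * m%:R <= k%:R :> R by rewrite -natrM ler_nat.
have e1 : pi = 2 * nu * al by rewrite -mulrA nu_al; field.
rewrite {1}e1 -subr_ge0.
have -> : 128 * (k%:R * al) - 32 * (n%:R * (2 * nu * al)) = al * 64 * (2 * k%:R - n%:R * nu) by ring.
rewrite mulr_ge0 //; first by rewrite mulr_ge0 // ltW.
have : n%:R * nu <= n%:R * m%:R by rewrite ler_wpM2l.
by lra.
Qed.

Lemma oint_der (f : R -> R) (a x : R) : continuous f -> is_derive x 1 (oint f a) (f x).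
Proof.
move=> cf; have tf := continuous_tame cf.
pose a' := x - 1.
have a'x : a' < x by rewrite /a' gtrBl.
have [dF F'] := @continuous_FTC1_closed R f a' x (x + 1) (ltac:(by rewrite ltrDl))
  (tame_integrable _ _ tf) a'x (cf x).
have F : is_derive x 1 (fun y => \int[lebesgue_measure]_(t in `[a', y]) f t) (f x).
  by split; [exact: dF|rewrite -derive1E].
apply: (@near_eq_is_derive _ _ _ (fun y => oint f a a' + \int[lebesgue_measure]_(t in `[a', y]) f t)).
- near=> y; rewrite (oint_add a a' y tf) [X in _ = _ + X]oint_le_ab // ltW //.
  by near: y; exact: lt_nbhsr.
by apply: der_eq (derD (der_cst _ _) F) _; rewrite add0r.
Unshelve. all: by end_near. Qed.

Lemma hsum_le_ln (k : nat) : (0 < k)%N -> hsum R k <= 1 + ln k%:R.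
Proof.
elim: k => // -[|k] IH _; first by rewrite hsumS /hsum big_ord0 add0r /harm invr1 ln1 addr0.
rewrite hsumS; apply: le_trans (lerD (IH isT) (lexx _)) _; rewrite -addrA lerD2l /harm.
have k1 : 0 < k.+1%:R :> R by rewrite ltr0n.
have k2 : 0 < k.+2%:R :> R by rewrite ltr0n.
have h : ln (1 + - k.+2%:R^-1) <= - k.+2%:R^-1 :> R.
  by apply: le_ln1Dx; rewrite ltrN2 invf_lt1 // ltr1n.
have e : 1 + - k.+2%:R^-1 = k.+1%:R / k.+2%:R :> R.
  by rewrite -natr1; move: (k.+1%:R : R) k1 => z z0; field; rewrite gt_eqF // addr_gt0.
rewrite e ln_div ?posrE // in h.
have aux (a b c : R) : a - b <= - c -> a + c <= b by lra.
exact: aux h.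
Qed.

Lemma sin_le_id (x : R) : 0 <= x -> sin x <= x.
Proof.
move=> x0; have := @der_le_le R sin id cos (fun=> 1) 0 x x0.
rewrite sin0 !subr0; apply => // y _; exact: cos_le1.
Qed.

(* The derivative of [theta] in the proof is at most [nu cos (nu t) sine_tail m t]; its
   logarithmic term gives the harmonic sum. *)
Lemma tcos_integral_diag :
  hsum R n / 2 - 36 <= m%:R * oint (fun t => tcos t * sine_tail m t) 0 pi.
Proof.
have m0 : (0 < m)%N by apply: leq_ltn_trans nm.
pose K := @sine_tail R m.
(* Resonance: differentiating [sin (nu t) * K t] yields, besides the integrand, minus
   [sin (nu t)^2 / (2 sin (t/2))], and this square term is at least [(1 - cos (2 nu t)) / (2 t)].
   The logarithm integrates the first half of that bound and the last term the second; its [- 1]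
   gives the remainder of this last integration a sign. *)
pose theta (t : R) := sin (nu * t) * K t + 2^-1 * ln t - (sin ((2 * nu) * t) - 1) * (t^-1 / (4 * nu)).
have cK : continuous (fun t => nu * (cos (nu * t) * K t)).
  by move=> t; apply: cvgMr; apply: cvgM; [exact: continuous_cosZ|exact: continuous_sine_tail].
pose dtheta (t : R) := nu * (cos (nu * t) * K t) - sin (nu * t) * dirichlet m t
   + 2^-1 * t^-1 - cos (2 * nu * t) * t^-1 / 2 + (sin (2 * nu * t) - 1) * (t ^- 2 / (4 * nu)).
have dth (t : R) : 0 < t -> is_derive t 1 theta (dtheta t).
  move=> t0; have tn : t != 0 by rewrite gt_eqF.
  have h1 := derM (der_sinZ nu t) (der_sine_tail m t).
  have h2 := derZ 2^-1 (is_derive1_ln t0).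
  have h3 := derM (derB (der_sinZ (2 * nu) t) (der_cst 1 t))
    (derM (derV tn (der_id t)) (der_cst (4 * nu)^-1 t)).
  apply: der_eq (derB (derD h1 h2) h3) _.
  rewrite /dtheta /K; move: (cos _) (sin _) (sine_tail _ _) (dirichlet _ _) (cos _) (sin _) => c1 s1 k d c2 s2.
  by field; rewrite tn gt_eqF.
have := @der_le_le R theta (oint (fun t => nu * (cos (nu * t) * K t)) al) dtheta
  (fun t => nu * (cos (nu * t) * K t)) al be (ltW al_be).
rewrite oint_nn subr0 => h.
have {}h : theta be - theta al <= oint (fun t => nu * (cos (nu * t) * K t)) al be.
  apply: h => t /andP[t1 t2].
  - by apply: dth; exact: lt_le_trans t1.
  - exact: oint_der.
  have t0 : 0 < t by exact: lt_trans t1.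
  have tpi : 0 < t <= pi by rewrite t0 (le_trans (ltW t2)).
  rewrite /dtheta dirichletE // -/nu.
  have s0 := sin_half_pi_gt0 tpi.
  have c2 : cos (2 * nu * t) = 1 - 2 * sin (nu * t) ^+ 2.
    rewrite -mulrA mulr_natl cos_mulr2n cos2sin2 mulr_natl; ring.
  have sle : sin (2^-1 * t) <= 2^-1 * t by apply: sin_le_id; lra.
  have q : sin (nu * t) ^+ 2 * t^-1 <= sin (nu * t) ^+ 2 * (2 * sin (2^-1 * t))^-1.
    rewrite ler_wpM2l ?sqr_ge0 // lef_pV2 ?posrE ?mulr_gt0 //; lra.
  have s1 : (sin (2 * nu * t) - 1) * (t ^- 2 / (4 * nu)) <= 0.
    apply: mulr_le0_ge0; first by rewrite subr_le0 sin_le1.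
    apply: divr_ge0; first by rewrite invr_ge0 exprn_ge0 // ltW.
    by apply: mulr_ge0 => //; exact: ltW.
  rewrite c2; move: q s1; move: (nu * (cos (nu * t) * K t)) => z.
  move: (_ * (t ^- 2 / (4 * nu))) => y; rewrite mulrA -expr2.
  by move: (t^-1) (_^-1) => u v; lra.
have ln2n : ln be - ln al = ln (2 * n%:R + 1).
  rewrite -ln_div ?posrE //; last exact: lt_trans al_be.
  congr ln; rewrite /be /al; move: (n%:R : R) (@pi R) pi0 => a p p0.
  by field; rewrite !gt_eqF.
have lnn : ln n%:R <= ln (2 * n%:R + 1) :> R.
  by have nn := n1; rewrite ler_ln ?posrE; lra.
have hn := hsum_le_ln n0.
have tail_small t : 0 < t <= pi -> `|sin (nu * t) * K t| <= 8.
  move=> /andP[t0 tpi]; rewrite normrM -[8]mul1r; apply: ler_pM => //; first exact: sin_max.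
  by apply: sine_tail_bounded => //; rewrite ltW.
have last_small t : al <= t -> -1 <= (sin (2 * nu * t) - 1) * (t^-1 / (4 * nu)) <= 0.
  move=> at_; have t0 : 0 < t by exact: lt_le_trans at_.
  have i0 : 0 <= t^-1 / (4 * nu).
    by apply: divr_ge0; [rewrite invr_ge0 ltW|apply: mulr_ge0 => //; exact: ltW].
  have i1 : t^-1 / (4 * nu) <= 2^-1.
    rewrite -invfM lef_pV2 ?posrE ?mulr_gt0 //.
    have : nu * al <= nu * t by rewrite ler_wpM2l // ltW.
    rewrite nu_al; have := pi_ge2 R; lra.
  have := sin_le1 (2 * nu * t); have := sin_geN1 (2 * nu * t).
  by move=> ? ?; apply/andP; split; nra.
have be0 : 0 < be <= pi by rewrite be_pi andbT (lt_trans al0).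
have al0' : 0 < al <= pi by rewrite al0 (le_trans (ltW al_be)).
have := tail_small _ be0; have := tail_small _ al0'; rewrite !ler_norml.
have := last_small al (lexx _); have := last_small be (ltW al_be).
rewrite oint_tcos; last exact: continuous_sine_tail.
have tcK : tame (fun t => cos (nu * t) * K t).
  by apply: continuous_tame => t; apply: cvgM; [exact: continuous_cosZ|exact: continuous_sine_tail].
have small : `|oint (fun t => cos (nu * t) * K t) al be| <= 32.
  apply: le_trans (_ : 8 * (be - al) <= _).
    apply: norm_oint_le => //; first exact: ltW.
    move=> t /andP[t1 t2]; rewrite normrM -[8]mul1r; apply: ler_pM => //; first exact: cos_max.
    by apply: sine_tail_bounded => //; rewrite (le_trans (ltW al0) (ltW t1)) (le_trans (ltW t2)).
  by have := pi4; have := be_pi; have := al0; lra.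
(* The loss [36] covers the boundary values of [theta] (16 from the kernel, 1 from the last term),
   [1/2] from [hsum_le_ln] and 16 from the extra half in [m = nu + 1/2]. *)
move: h; rewrite ointZ // /theta; move: small; rewrite ler_norml.
rewrite (_ : m%:R = nu + 2^-1); last by rewrite /nu subrK.
rewrite mulrDl -/K.
move: (oint _ al be) (sin (nu * be) * K be) (sin (nu * al) * K al) => I a b.
move: ((sin (2 * nu * be) - 1) * _) ((sin (2 * nu * al) - 1) * _) => c d.
by move=> /andP[? ?] ? /andP[? ?] /andP[? ?] /andP[? ?] /andP[? ?]; lra.
Qed.

End TruncatedCosine.

(** * Fourier tails of uniform limits *)

Section DirichletMean.
Variable R : realType.
Variable g : R -> R.
Hypothesis gper : periodic g (pi *+ 2).
Hypothesis tg : tame g.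
Local Notation oint := (@oriented_integral R).

Lemma tame_dirichlet_mean n : (0 < n)%N -> tame (dirichlet_mean g n).
Proof.
move=> n0.
have -> : dirichlet_mean g n = fun x => fourier_cos g 0 / 2 +
    trig_poly (index_iota 1 n) (fourier_cos g) (fourier_sin g) x.
  apply/funext => x; rewrite /trig_poly (fourier_partial_sum tg gper) //.
  suff -> : dirichlet_mean g 1 x = fourier_cos g 0 / 2 by rewrite addrC subrK.
  have := fourier_term tg gper 0 x.
  rewrite !mul0r cos0 sin0 mulr1 mulr0 addr0 => ->.
  rewrite /dirichlet_mean -mulrA; congr (_ * _).
  rewrite mulrC -ointZ; last first.
    apply: tameM; first exact: tame_even_part.
    by apply: continuous_tame; exact: continuous_cosZ.
  by apply: eq_oint => t; rewrite mul0r cos0 /dirichlet big_geq //; ring.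
by apply: tameD; [exact: tame_cst|apply: continuous_tame; exact: continuous_trig_poly].
Qed.

End DirichletMean.

Lemma zero_mean0 (R : realType) (f : R -> R) :
  zero_mean_antiderivative f 0 =
  - (pi *+ 2)^-1 * oriented_integral (oriented_integral f 0) (- pi) pi.
Proof. by rewrite zeroE oint_nn sub0r mulNr. Qed.

(** At 0 only a double integral remains, and 0 is an endpoint of every inner one. A Fourier tail
    known off 0 in [(-pi, pi)] can therefore be replaced by its formula. *)
Lemma eq_zero_mean0 (R : realType) (f h : R -> R) : tame f ->
  (forall x, - pi < x < pi -> x != 0 -> f x = h x) ->
  zero_mean_antiderivative f 0 = zero_mean_antiderivative h 0.
Proof.
move=> tf fh; rewrite (zero_mean0 f) (zero_mean0 h).
suff -> : oriented_integral (oriented_integral f 0) (- pi) pi =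
  oriented_integral (oriented_integral h 0) (- pi) pi by [].
apply: eq_oint_oo; first exact: tame_oint.
have pp := pi_ge_Npi R; have pi0 := pi_gt0 R.
move=> x; rewrite min_l // max_r // => /andP[x1 x2].
apply: eq_oint_oo => // y; rewrite gt_min lt_max => /andP[y1 y2].
by apply: fh; case/orP: y1 => ?; case/orP: y2 => ?; lra.
Qed.

(** * Uniform limits that agree with their approximants away from 0 *)

Section UniformLimit.
Variable R : realType.
Variables (g : R -> R) (g_ : nat -> R -> R) (V e : nat -> R) (B : R).
Local Notation oint := (@oriented_integral R).
Local Notation Z := (@zero_mean_antiderivative R).
Hypothesis gper : periodic g (pi *+ 2).
Hypothesis g_per : forall M, periodic (g_ M) (pi *+ 2).
Hypothesis g_V : forall M, wvariation_le harm (g_ M) 0 (pi *+ 2) (V M).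
Hypothesis g_cont : forall M x, - pi < x < pi -> {for x, continuous (g_ M)}.
Hypothesis g_B : forall M x, `|g_ M x| <= B.
Hypothesis g_dist : forall M x, `|g x - g_ M x| <= e M.
Hypothesis cvg_e : e @ \oo --> 0.
Hypothesis g_loc : forall a, 0 < a -> \forall M \near \oo,
  forall y, a <= `|y| <= pi -> g_ M y = g y.

Let tg_ M : tame (g_ M). Proof. exact: (HBV_tame (g_per M) (g_V M)). Qed.

Let bcg : bounded_cvg g_ g.
Proof.
split=> //; first by move=> M; exists B => N x _.
move=> x; apply/cvgrPdist_le => d d0.
have /cvgr0Pnorm_le /(_ d d0) := cvg_e; apply: filterS => M /=.
by apply: le_trans; apply: le_trans (g_dist M x) (ler_norm _).
Qed.

Let tg : tame g. Proof. exact: bounded_cvg_tame bcg. Qed.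

Let oint_kernel_dist (u_ u w : R -> R) c C : tame u_ -> tame u -> tame w ->
  (forall t, 0 < t < pi -> `|u t - u_ t| * `|w t| <= c * C) ->
  `|pi^-1 * oint (fun t => u t * w t) 0 pi - pi^-1 * oint (fun t => u_ t * w t) 0 pi| <= c * C.
Proof.
move=> tu_ tu tw h; rewrite -mulrBr -ointB; try exact: tameM.
rewrite normrM gtr0_norm ?invr_gt0 ?pi_gt0 // ler_pdivrMl ?pi_gt0 // mulrC.
rewrite -{2}[pi]subr0; apply: norm_oint_le; first exact: pi_ge0.
  by apply: tameB; exact: tameM.
by move=> t t0; rewrite -mulrBl normrM; exact: h.
Qed.

Let g_lim M x : - pi < x < pi ->
  g_ M (x + t) @[t --> 0^'+] --> g_ M x /\ g_ M (x - t) @[t --> 0^'+] --> g_ M x.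
Proof.
move=> /(g_cont (M := M)) gc; split.
  have h : x + t @[t --> 0^'+] --> x.
    rewrite -[X in _ --> X]addr0; apply: cvgD; first exact: cvg_cst.
    exact: cvg_at_right_filter cvg_id.
  exact: (cvg_comp _ _ h gc).
have h : x - t @[t --> 0^'+] --> x.
  rewrite -[X in _ --> X]subr0; apply: cvgB; first exact: cvg_cst.
  exact: cvg_at_right_filter cvg_id.
exact: (cvg_comp _ _ h gc).
Qed.

(** Localization: for a fixed large [M], [g] and [g_ M] agree around [x], so their means differ only
    through [t > d], where the Dirichlet kernel is at most [2 / d] for all [N]. Then [N] goes to
    infinity for [g_ M], to which the convergence theorem applies. *)
Lemma cvg_dirichlet_mean_off0 x : - pi < x < pi -> x != 0 ->
  dirichlet_mean g N x @[N --> \oo] --> g x.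
Proof.
move=> xpi x0.
(* Keeps [x + t] and [x - t] in the region [|x| / 2 <= |y| <= pi] whenever [|t| <= d]. *)
pose d := Num.min (`|x| / 2) (pi - `|x|).
have xn : 0 < `|x| by rewrite normr_gt0.
have xp : `|x| < pi by rewrite ltr_norml.
have d0 : 0 < d by rewrite lt_min divr_gt0 //= subr_gt0.
have [d1 d2] : d <= `|x| / 2 /\ d <= pi - `|x| by rewrite /d; split; rewrite ge_min lexx ?orbT.
apply/cvgrPdist_le => eps eps0.
have [M] : exists M, [/\ e M <= eps * d / 8 & forall y, `|x| / 2 <= `|y| <= pi -> g_ M y = g y].
  have ed : 0 < eps * d / 8 by rewrite divr_gt0 // mulr_gt0.
  have /cvgr0Pnorm_le /(_ _ ed) [M1 _ h1] := cvg_e.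
  have [M2 _ h2] := g_loc (divr_gt0 xn (ltr0n R 2)).
  exists (M1 + M2)%N; split; last by apply: h2; rewrite /= leq_addl.
  by apply: le_trans (ler_norm _) _; apply: h1; rewrite /= leq_addr.
move=> [eM hM].
have [h1 h2] := g_lim M xpi.
have := cvg_dirichlet_mean (g_per M) (g_V M) h1 h2.
have -> : (g_ M x + g_ M x) / 2 = g x by rewrite hM; [lra|apply/andP; split; lra].
have e2 : 0 < eps / 2 by rewrite divr_gt0.
move=> /cvgrPdist_le /(_ _ e2) h; near=> N.
have N0 : (0 < N)%N by near: N; exists 1%N.
have hN : `|g x - dirichlet_mean (g_ M) N x| <= eps / 2 by near: N.
have hd : `|dirichlet_mean g N x - dirichlet_mean (g_ M) N x| <= (2 * e M) * (2 / d).
  apply: oint_kernel_dist; try exact: tame_even_part; first exact/continuous_tame/continuous_dirichlet.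
  move=> t /andP[t0 tpi].
  rewrite (_ : _ - _ = (g (x + t) - g_ M (x + t)) + (g (x - t) - g_ M (x - t))); last by ring.
  case: (leP t d) => td.
    have eq0 y : `|y - x| <= d -> g y - g_ M y = 0.
      move=> yx; rewrite hM ?subrr //.
      have := ler_distD 0 x y; have := lerB_normD x (y - x); have := ler_normD x (y - x).
      by rewrite addrC subrK; lra.
    rewrite !eq0 ?addr0 ?normr0 ?mul0r //.
    - have e0 : 0 <= e M by apply: le_trans (normr_ge0 _) (g_dist M 0).
      by rewrite !mulr_ge0 // invr_ge0 ltW.
    - by rewrite (_ : _ - _ = - t); [rewrite normrN gtr0_norm|ring].
    - by rewrite (_ : _ - _ = t); [rewrite gtr0_norm|ring].
  apply: ler_pM => //.
    by apply: le_trans (ler_normD _ _) _; have := g_dist M (x + t); have := g_dist M (x - t); lra.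
  apply: le_trans (dirichlet_bound N0 _) _; first by rewrite t0 ltW.
  by rewrite ler_pM2l // lef_pV2 ?posrE // ltW.
rewrite (_ : _ - _ = (g x - dirichlet_mean (g_ M) N x) - (dirichlet_mean g N x - dirichlet_mean (g_ M) N x)); last by ring.
apply: le_trans (ler_normB _ _) _.
have : 2 * e M * (2 / d) <= eps / 2.
  rewrite mulrA ler_pdivrMr //; move: eM; rewrite ler_pdivlMr //; lra.
by move: hN hd; lra.
Unshelve. all: by end_near.
Qed.

Lemma fourier_tail_off0 n x : (0 < n)%N -> - pi < x < pi -> x != 0 ->
  fourier_tail g n x = g x - dirichlet_mean g n x.
Proof.
move=> n0 xpi x0.
have h : dirichlet_mean g N x - dirichlet_mean g n x @[N --> \oo] --> g x - dirichlet_mean g n x.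
  by apply: cvgB; [exact: cvg_dirichlet_mean_off0|exact: cvg_cst].
apply: (cvg_lim (@Rhausdorff R)); apply: cvg_trans h.
apply: near_eq_cvg; exists n => // N /= nN.
by rewrite (fourier_partial_sum tg gper) // n0.
Qed.

(** For [r = 0] the integrated series telescopes, and [sine_tail_mean] tends to 0. *)
Lemma zero_mean_tail_HBV M n : (0 < n)%N ->
  Z (fourier_tail (g_ M) n) 0 = sine_tail_mean (g_ M) n 0.
Proof.
move=> n0; have [l1 [l2 [h1 h2]]] := HBV_limits (g_per M) (g_V M) 0.
have h := @cvg_iter_fourier_tail _ _ _ (g_per M) (g_V M) n 0 0 n0.
rewrite /= mul1r in h.
have st0 : sine_tail_mean (g_ M) N 0 @[N --> \oo] --> 0.
  have hN := cvg_sine_tail_mean (g_per M) (g_V M) h1 h2.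
  have h0 : N%:R^-1 * (N%:R * sine_tail_mean (g_ M) N 0) @[N --> \oo] -->
      (0 * (- pi^-1 * (l1 - l2)) : R) by apply: cvgM => //; exact: cvg_natV.
  rewrite mul0r in h0.
  apply: cvg_trans h0; apply: near_eq_cvg; exists 1%N => // N /= N0.
  by rewrite mulrA mulVf ?mul1r // pnatr_eq0 -lt0n.
have tel : sine_tail_mean (g_ M) n 0 - sine_tail_mean (g_ M) N 0 @[N --> \oo] -->
    sine_tail_mean (g_ M) n 0 - 0 by apply: cvgB => //; exact: cvg_cst.
rewrite subr0 in tel.
apply: (cvg_unique (@Rhausdorff R) h); apply: cvg_trans tel.
apply: near_eq_cvg; exists n => // N /= nN.
rewrite (eq_bigr (fun k => sine_tail_mean (g_ M) k 0 - sine_tail_mean (g_ M) k.+1 0)).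
  rewrite -opprB -(telescope_sumr (fun k => sine_tail_mean (g_ M) k 0)) // -sumrN.
  by apply: eq_bigr => k _; rewrite opprB.
by move=> k _; rewrite expr0 invr1 mulr1.
Qed.

Let cvg_of_dist (u : nat -> R) l C : (forall M, `|l - u M| <= e M * C) -> u @ \oo --> l.
Proof.
move=> h; have C0 : e M * C @[M --> \oo] --> 0 by rewrite -(mul0r C); apply: cvgMl.
apply/cvgrPdist_le => d d0.
have /cvgr0Pnorm_le /(_ d d0) := C0; apply: filterS => M /=.
by apply: le_trans; apply: le_trans (h M) (ler_norm _).
Qed.

Let cvg_sine_tail_mean_seq n x : (0 < n)%N ->
  sine_tail_mean (g_ M) n x @[M --> \oo] --> sine_tail_mean g n x.
Proof.
move=> n0; apply: (@cvg_of_dist _ _ (2 * 8)) => M.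
rewrite /sine_tail_mean !mulNr -opprD normrN mulrA (mulrC (e M)).
apply: oint_kernel_dist; try exact: tame_odd_part.
  exact/continuous_tame/continuous_sine_tail.
move=> t /andP[t0 tpi]; apply: ler_pM => //.
  rewrite (_ : _ - _ = (g (x + t) - g_ M (x + t)) - (g (x - t) - g_ M (x - t))); last by ring.
  by apply: le_trans (ler_normB _ _) _; have := g_dist M (x + t); have := g_dist M (x - t); lra.
by apply: sine_tail_bounded => //; rewrite !ltW.
Qed.

Let bounded_cvg_remainder n : (0 < n)%N ->
  bounded_cvg (fun M x => g_ M x - dirichlet_mean (g_ M) n x)
    (fun x => g x - dirichlet_mean g n x).
Proof.
move=> n0; have tD : tame (@dirichlet R n) by exact/continuous_tame/continuous_dirichlet.
split.
- by move=> M; apply: tameB => //; exact: tame_dirichlet_mean.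
- move=> K; exists (B + (B + B) * n%:R) => M x _.
  apply: le_trans (ler_normB _ _) _; apply: lerD => //.
  have := @oint_kernel_dist (fun=> 0) (fun t => g_ M (x + t) + g_ M (x - t)) (dirichlet n)
    (B + B) n%:R (@tame_cst R 0) (tame_even_part (tg_ M) x) tD.
  rewrite -/(dirichlet_mean (g_ M) n x).
  rewrite (eq_oint 0 pi (g := fun=> 0)) => [|t]; last by rewrite mul0r.
  rewrite oint_cst mul0r mulr0 subr0; apply => t _; rewrite subr0.
  apply: ler_pM => //; last exact: dirichlet_bound_n.
  by apply: le_trans (ler_normD _ _) _; exact: lerD.
- move=> x; apply: cvgB; first by have [_ _] := bcg; apply.
  apply: (@cvg_of_dist _ _ (2 * n%:R)) => M.
  rewrite mulrA (mulrC (e M)); apply: oint_kernel_dist => //; try exact: tame_even_part.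
  move=> t _; apply: ler_pM => //; last exact: dirichlet_bound_n.
  rewrite (_ : _ - _ = (g (x + t) - g_ M (x + t)) + (g (x - t) - g_ M (x - t))); last by ring.
  by apply: le_trans (ler_normD _ _) _; have := g_dist M (x + t); have := g_dist M (x - t); lra.
Qed.

(** Both sides are continuous under the uniform convergence of [g_ M], once the tail is replaced by
    [g - dirichlet_mean g n], which is well behaved without any convergence of the Fourier series at
    0. *)
Lemma zero_mean_tail0 n : (0 < n)%N ->
  Z (fourier_tail g n) 0 = sine_tail_mean g n 0.
Proof.
move=> n0; have bc := bounded_cvg_remainder n0.
have [tbc _ _] := bc.
have -> : Z (fourier_tail g n) 0 = Z (fun x => g x - dirichlet_mean g n x) 0.
  apply/esym/eq_zero_mean0; first exact: bounded_cvg_tame bc.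
  by move=> x xpi x0; rewrite fourier_tail_off0.
have [_ _ /(_ 0) hZ] := bounded_cvg_zero_mean bc.
apply: (cvg_unique (@Rhausdorff R) hZ).
have hT := @cvg_sine_tail_mean_seq n 0 n0.
move=> /=; apply: cvg_trans hT; apply: near_eq_cvg; apply: nearW => M.
rewrite -(zero_mean_tail_HBV M n0); apply/esym/eq_zero_mean0 => // x xpi _.
have [h1 h2] := g_lim M xpi.
by rewrite (fourier_tail_HBV (g_per M) (g_V M) n0 h1 h2); lra.
Qed.

End UniformLimit.

(** * A gliding hump outside HBV *)

Section Periodization.
Variable R : realType.
Implicit Types (G : R -> R) (x : R).

Definition periodize G x : R :=
  G (x - (Num.floor (x / (pi *+ 2)))%:~R * (pi *+ 2)).

Let twopi_gt0 : 0 < pi *+ 2 :> R.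
Proof. by rewrite pmulrn_lgt0 // pi_gt0. Qed.

Lemma periodize_periodic G : periodic (periodize G) (pi *+ 2).
Proof.
move=> x; rewrite /periodize; congr G.
have -> : (x + pi *+ 2) / (pi *+ 2) = x / (pi *+ 2) + 1%:~R.
  by rewrite mulrDl divff // gt_eqF.
by rewrite floorDrz ?intr_int // intrKfloor rmorphD /= mulrDl mul1r; ring.
Qed.

Lemma periodizeE G x : (forall y, y <= 0 -> G y = 0) -> (forall y, pi <= y -> G y = 0) ->
  - pi <= x <= pi *+ 2 -> periodize G x = G x.
Proof.
move=> Gneg Gpi /andP[x1 x2]; rewrite /periodize.
have pi0 := pi_gt0 R; have tp := twopi_gt0.
have twopiE : pi *+ 2 = pi + pi :> R by rewrite mulr2n.
case: (ltP x 0) => x0.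
  rewrite (@floor_def _ _ (-1)).
    by rewrite Gpi ?Gneg // ?(ltW x0) // mulrN1z mulN1r opprK; lra.
  rewrite mulrN1z addNr mulr0z ler_pdivlMr // ltr_pdivrMr // mul0r x0 andbT.
  by rewrite mulN1r; lra.
case: (ltP x (pi *+ 2)) => x3.
  rewrite (@floor_def _ _ 0) ?mul0r ?subr0 //.
  by rewrite add0r ler_pdivlMr // ltr_pdivrMr // mul0r mul1r x0.
have -> : x = pi *+ 2 by apply/le_anti; rewrite x2 x3.
rewrite divff ?gt_eqF // (@floor_def _ _ 1).
  by rewrite mul1r subrr Gneg // Gpi //; lra.
by rewrite intrD mulr1z lexx /=; lra.
Qed.

End Periodization.

Lemma eq_wvariation_le (R : realType) (w : nat -> R) (f h : R -> R) (a b V : R) :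
  (forall x, a <= x <= b -> f x = h x) ->
  wvariation_le w f a b V -> wvariation_le w h a b V.
Proof.
move=> fh fV s fs; apply: le_trans (fV s fs); rewrite le_eqVlt; apply/orP; left; apply/eqP.
case/andP: fs => sa _; elim: s w sa {fV} => //= I s IH w /andP[/and3P[I1 I12 I2] sa].
rewrite IH //; congr (_ * _ + _); rewrite /incr !fh // ?I1 ?I2 ?andbT.
  by rewrite (le_trans I12).
by rewrite (le_trans I1).
Qed.

(** * The superposition of truncated cosines and its integrated tail at 0 *)

Section Hump.
Variable R : realType.
Variables (lam : nat -> R) (n : nat -> nat).
Hypothesis lam_gt0 : forall i, 0 < lam i.
Hypothesis lam_homo : {homo lam : i j / (i <= j)%N >-> i <= j}.
Let Lam p : R := \sum_(i < p) (lam i)^-1.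
Hypothesis n_large : forall k, 4 ^+ k * Lam (n k) < hsum R (n k).
Local Notation oint := (@oriented_integral R).

Lemma n_gt0 k : (0 < n k)%N.
Proof.
case: (posnP (n k)) => // n0; have := n_large k.
by rewrite n0 /Lam /hsum !big_ord0 mulr0 ltxx.
Qed.

Let Lam_ge k : (lam 0%N)^-1 <= Lam (n k).
Proof.
rewrite /Lam -(prednK (n_gt0 k)) big_ord_recl lerDl sumr_ge0 // => i _.
by rewrite invr_ge0 ltW.
Qed.

Let Lam_gt0 k : 0 < Lam (n k).
Proof. by apply: lt_le_trans (Lam_ge k); rewrite invr_gt0. Qed.

Let c k : R := 2^-1 ^+ k / Lam (n k).

Let c_gt0 k : 0 < c k.
Proof. by rewrite divr_gt0 // exprn_gt0 // invr_gt0. Qed.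

Let c_le k : c k <= 2^-1 ^+ k * lam 0%N.
Proof.
rewrite /c ler_wpM2l ?exprn_ge0 ?invr_ge0 //.
by rewrite -[lam 0%N]invrK lef_pV2 ?posrE ?invr_gt0.
Qed.

(** The factor dominates both [n k'] and [n k'.+1], as the estimates for waves slower and faster
    than the kernel require; the [2] makes the sequence at least double and exceed [n]. *)
Fixpoint freq k := if k is k'.+1 then (freq k' * (n k' + n k'.+1 + 2))%N else (n 0%N).+1.

Lemma freq_exp k : (2 ^ k <= freq k)%N.
Proof.
elim: k => [|k IH] //=.
by rewrite expnSr leq_mul // leq_addl.
Qed.

Lemma freq_gt0 k : (0 < freq k)%N.
Proof. by apply: leq_trans (freq_exp k); rewrite expn_gt0. Qed.

Lemma freq_gt k : (n k < freq k)%N.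
Proof.
case: k => [|k] //=.
by apply: leq_trans (leq_pmull _ (freq_gt0 k)); lia.
Qed.

Lemma freqS_ge k : (freq k * n k <= freq k.+1)%N /\ (freq k * n k.+1 <= freq k.+1)%N.
Proof. by split=> /=; rewrite leq_mul2l; apply/orP; right; lia. Qed.

Lemma freq_homo : {homo freq : k l / (k <= l)%N}.
Proof.
apply: homo_leq => //; first exact: leq_trans.
by move=> k /=; rewrite leq_pmulr // addn2.
Qed.

Lemma freq_ge k l : (k < l)%N -> (n k * freq k <= freq l)%N /\ (freq k * n l <= freq l)%N.
Proof.
move=> kl; split.
  by rewrite mulnC; apply: leq_trans (freqS_ge k).1 _; exact: freq_homo.
case: l kl => // l kl; apply: leq_trans (freqS_ge l).2.
by rewrite leq_mul2r; apply/orP; right; exact: freq_homo.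
Qed.

Let b k : R -> R := tcos (n k) (freq k).

Definition hump_sum M (y : R) : R := \sum_(0 <= l < M) c l * b l y.
Definition hump (y : R) : R := limn (fun M => hump_sum M y).

(** The geometric bound for the sum of [c l] over [l >= M]; its successive differences bound the
    single terms, so errors telescope. *)
Let e M : R := 2 * lam 0%N * 2^-1 ^+ M.

Let e_ge0 M : 0 <= e M.
Proof. by rewrite /e mulr_ge0 ?exprn_ge0 ?invr_ge0 // mulr_ge0 // ltW. Qed.

Let cvg_e : e @ \oo --> 0.
Proof.
have h : 2 * lam 0%N * 2^-1 ^+ M @[M --> \oo] --> 2 * lam 0%N * 0.
  by apply: cvgMr; apply: cvg_expr; rewrite ger0_norm ?invr_ge0 // invf_lt1 // ltr1n.
by rewrite mulr0 in h.
Qed.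

Let hump_term l y : `|c l * b l y| <= e l - e l.+1.
Proof.
rewrite normrM (gtr0_norm (c_gt0 l)).
apply: le_trans (_ : c l * 1 <= _); first by apply: ler_wpM2l; [exact: ltW|exact: tcos_le1].
rewrite mulr1; apply: le_trans (c_le l) _; rewrite /e exprS.
by rewrite le_eqVlt; apply/orP; left; apply/eqP; field.
Qed.

Lemma hump_sum_dist M M' y : (M <= M')%N -> `|hump_sum M' y - hump_sum M y| <= e M - e M'.
Proof.
move=> /subnKC <-; elim: (M' - M)%N => [|j IH]; first by rewrite addn0 !subrr normr0.
have S : hump_sum (M + j).+1 y = hump_sum (M + j) y + c (M + j) * b (M + j) y.
  by rewrite /hump_sum big_nat_recr.
rewrite addnS S (_ : _ - _ = (hump_sum (M + j) y - hump_sum M y) + c (M + j) * b (M + j) y); last by ring.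
apply: le_trans (ler_normD _ _) _; have := hump_term (M + j) y.
by move: IH; lra.
Qed.

Lemma hump_sum_bound M y : `|hump_sum M y| <= e 0.
Proof.
have := @hump_sum_dist 0 M y (leq0n M); rewrite [hump_sum 0 y]/hump_sum big_geq // subr0.
by move/le_trans; apply; rewrite gerBl.
Qed.

Lemma cvg_hump y : hump_sum M y @[M --> \oo] --> hump y.
Proof.
apply: cauchy_cvg; apply/cauchy_ballP => r r0.
have /cvgr0Pnorm_lt /(_ (r / 2)) := cvg_e; rewrite divr_gt0 // => /(_ isT)[M _ hM].
have eM : e M < r / 2 by have := hM M (leqnn M); rewrite ger0_norm.
pose A := [set z : R | exists2 M', (M <= M')%N & z = hump_sum M' y].
exists (A, A); first by split=> /=; exists M => // M' MM'; exists M'.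
move=> -[_ _] [/= [M1 h1 ->] [M2 h2 ->]]; rewrite /ball /=.
have d1 := hump_sum_dist y h1; have d2 := hump_sum_dist y h2.
rewrite (_ : _ - _ = (hump_sum M1 y - hump_sum M y) - (hump_sum M2 y - hump_sum M y)); last by ring.
apply: le_lt_trans (ler_normB _ _) _.
by have := e_ge0 M1; have := e_ge0 M2; lra.
Qed.

Lemma hump_dist M y : `|hump y - hump_sum M y| <= e M.
Proof.
have h : hump_sum M' y - hump_sum M y @[M' --> \oo] --> hump y - hump_sum M y.
  by apply: cvgB; [exact: cvg_hump|exact: cvg_cst].
apply: (cvg_norm_le h); exists M => // M' /= MM'.
by apply: le_trans (hump_sum_dist y MM') _; rewrite gerBl.
Qed.

Lemma hump_sum_0 M y : y <= 0 -> hump_sum M y = 0.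
Proof.
move=> y0; rewrite /hump_sum big1 // => l _.
by rewrite /b tcos_nonpos ?mulr0 // ?n_gt0 ?freq_gt.
Qed.

Lemma hump_sum_pi M y : pi <= y -> hump_sum M y = 0.
Proof.
move=> y0; rewrite /hump_sum big1 // => l _.
by rewrite /b tcos_ge_pi ?mulr0 // ?n_gt0 ?freq_gt.
Qed.

Lemma hump_lim_eq y z : (\forall M \near \oo, hump_sum M y = z) -> hump y = z.
Proof.
move=> h; apply: (cvg_lim (@Rhausdorff R)).
have hz : (fun=> z) @ \oo --> z by exact: cvg_cst.
by apply: cvg_trans hz; apply: near_eq_cvg; apply: filterS h => M /= ->.
Qed.

Lemma hump_0 y : y <= 0 -> hump y = 0.
Proof. by move=> y0; apply: hump_lim_eq; apply: nearW => M; exact: hump_sum_0. Qed.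

Lemma hump_pi y : pi <= y -> hump y = 0.
Proof. by move=> y0; apply: hump_lim_eq; apply: nearW => M; exact: hump_sum_pi. Qed.

(** The [l]-th wave vanishes beyond [16 * n l / freq l], which tends to 0 geometrically since
    [freq l.+1 >= 2^l * n l.+1]: away from 0 the series is finite. *)
Lemma hump_far a : 0 < a -> \forall M \near \oo,
  forall y, a <= `|y| -> hump_sum M y = hump y.
Proof.
move=> a0.
have h : 16 * 2^-1 ^+ M @[M --> \oo] --> (16 * 0 : R).
  by apply: cvgMr; apply: cvg_expr; rewrite ger0_norm ?invr_ge0 // invf_lt1 // ltr1n.
rewrite mulr0 in h; have /cvgr0Pnorm_le /(_ a a0) [M0 _ hM] := h.
have far y l : a <= y -> (M0 < l)%N -> b l y = 0.
  move=> ay; case: l => // l Ml; rewrite /b tcos_support ?n_gt0 ?freq_gt //.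
  apply: le_trans ay; have := hM l Ml; rewrite ger0_norm ?mulr_ge0 ?exprn_ge0 ?invr_ge0 //.
  apply: le_trans; rewrite -mulrA ler_wpM2l // ler_pdivrMr ?ltr0n ?freq_gt0 //.
  rewrite exprVn mulrC ler_pdivlMr ?exprn_gt0 // -natrX -natrM ler_nat mulnC.
  by apply: leq_trans (freqS_ge l).2; rewrite leq_mul2r freq_exp orbT.
have stable y M : a <= y -> (M0 < M)%N -> hump_sum M y = hump_sum M0.+1 y.
  move=> ay MM; rewrite /hump_sum (big_cat_nat _ (n := M0.+1)) //=.
  rewrite [X in _ + X](_ : _ = 0) ?addr0 //.
  by rewrite big_nat_cond big1 // => l /andP[/andP[Ml _] _]; rewrite far ?mulr0.
exists M0.+1 => // M /= MM y ay.
case: (lerP y 0) => y0; first by rewrite hump_sum_0 // hump_0.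
rewrite (gtr0_norm y0) in ay.
rewrite stable //; apply/esym/hump_lim_eq; exists M0.+1 => // M' /= MM'.
exact: stable.
Qed.

Lemma continuous_hump_sum M : continuous (hump_sum M).
Proof.
elim: M => [|M IH] y.
  have -> : hump_sum 0 = fun=> 0 by apply/funext => z; rewrite /hump_sum big_geq.
  exact: cvg_cst.
have -> : hump_sum M.+1 = fun y => hump_sum M y + c M * b M y.
  by apply/funext => z; rewrite /hump_sum big_nat_recr.
by apply: cvgD; [exact: IH|apply: cvgMr; exact: continuous_tcos].
Qed.

Lemma hump_sum_variation (w : nat -> R) M d : (forall i, 0 <= w i) ->
  (forall i, w i.+1 <= w i) -> 0 <= d ->
  wvariation_le w (hump_sum M) 0 d (\sum_(0 <= l < M) c l * (4 * \sum_(i < n l) w i)).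
Proof.
move=> w0 wS d0; elim: M => [|M IH].
  have -> : hump_sum 0 = fun=> 0 by apply/funext => y; rewrite /hump_sum big_geq.
  by rewrite big_geq //; exact: wvariation_le_cst.
have -> : hump_sum M.+1 = fun y => hump_sum M y + c M * b M y.
  by apply/funext => z; rewrite /hump_sum big_nat_recr.
rewrite big_nat_recr //=; apply: wvariation_leD => //.
have := tcos_variation (n_gt0 M) (freq_gt M) w0 wS d0.
by move=> /(wvariation_leZ (c M)); rewrite gtr0_norm.
Qed.

Let geom M : \sum_(0 <= l < M) 2^-1 ^+ l <= (2 : R).
Proof.
suff -> : \sum_(0 <= l < M) 2^-1 ^+ l = 2 - 2 * 2^-1 ^+ M :> R.
  by rewrite gerBl mulr_ge0 // exprn_ge0 // invr_ge0.
elim: M => [|M IH]; first by rewrite big_geq // expr0; ring.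
by rewrite big_nat_recr //= IH exprS; field.
Qed.

(** The factor [c l] cancels [Lam (n l)], leaving [4 * 2^-l] for each wave and [8] in all, uniformly
    in [M]. *)
Lemma hump_sum_Lambda_variation M :
  wvariation_le (fun i => (lam i)^-1) (hump_sum M) 0 (pi *+ 2) 8.
Proof.
have tp : 0 <= pi *+ 2 :> R by rewrite mulrn_wge0 // pi_ge0.
move=> s fs; apply: le_trans (@hump_sum_variation (fun i => (lam i)^-1) M _ _ _ tp s fs) _.
- by move=> i; rewrite invr_ge0 ltW.
- by move=> i; rewrite lef_pV2 ?posrE // lam_homo.
rewrite (eq_bigr (fun l => 4 * 2^-1 ^+ l)) => [|l _].
  by rewrite -mulr_sumr; have := geom M; lra.
by rewrite -/(Lam (n l)) /c mulrCA mulfVK // gt_eqF.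
Qed.

Let sum_c M : \sum_(0 <= l < M) c l <= 2 * lam 0%N.
Proof.
apply: le_trans (_ : \sum_(0 <= l < M) 2^-1 ^+ l * lam 0%N <= _).
  by apply: ler_sum => l _; exact: c_le.
by rewrite -mulr_suml ler_pM2r //; exact: geom.
Qed.

Lemma hump_sum_integral M k : (k < M)%N ->
  2 ^+ k / 2 - 256 * lam 0%N <=
  (freq k)%:R * oint (fun t => hump_sum M t * sine_tail (freq k) t) 0 pi.
Proof.
move=> kM; set K := sine_tail (freq k).
have tK l : tame (fun t => b l t * K t).
  by apply: tameM; apply: continuous_tame; [exact: continuous_tcos|exact: continuous_sine_tail].
have -> : (freq k)%:R * oint (fun t => hump_sum M t * K t) 0 pi =
    \sum_(0 <= l < M) c l * ((freq k)%:R * oint (fun t => b l t * K t) 0 pi).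
  rewrite (eq_oint 0 pi (g := fun t => \sum_(0 <= l < M) c l * (b l t * K t))) => [|t].
    rewrite oint_sum => [|l]; last exact: tameZ.
    by rewrite mulr_sumr; apply: eq_bigr => l _; rewrite ointZ // mulrCA.
  by rewrite /hump_sum mulr_suml; apply: eq_bigr => l _; rewrite mulrA.
(* Off the diagonal each wave loses at most [128 * c l], and this also absorbs the loss [36 * c k]
   of the resonant one. The coefficients sum to at most [2 * lam 0], whence [256]. *)
have term l : (if l == k then 2 ^+ k / 2 else 0) - 128 * c l <=
    c l * ((freq k)%:R * oint (fun t => b l t * K t) 0 pi).
  have cl := c_gt0 l.
  have lower I : `|I| <= 128 -> 0 - 128 * c l <= c l * I.
    by rewrite sub0r ler_norml => /andP[h _]; rewrite -mulNr mulrC ler_pM2l.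
  case: eqP => [->|/eqP].
    apply: le_trans (_ : c k * (hsum R (n k) / 2 - 36) <= _); last first.
      by rewrite ler_pM2l //; exact: tcos_integral_diag (n_gt0 k) (freq_gt k).
    have h : 2 ^+ k <= c k * hsum R (n k).
      rewrite /c mulrAC ler_pdivlMr // exprVn [leRHS]mulrC ler_pdivlMr ?exprn_gt0 //.
      rewrite mulrAC -expr2 exprAC -[2 ^+ 2]natrX; exact: ltW.
    by have := c_gt0 k; lra.
  rewrite neq_ltn => /orP[lk|kl]; apply: lower.
    by apply: tcos_integral_low (n_gt0 l) (freq_gt l) _ (freq_gt0 k) _; exact: (freq_ge lk).1.
  by apply: tcos_integral_high (n_gt0 l) (freq_gt l) _ (freq_gt0 k) _; exact: (freq_ge kl).2.
apply: le_trans (ler_sum _ (fun l _ => term l)).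
rewrite big_split /= sumrN -mulr_sumr -big_mkcond big_nat1_eq /= kM.
by have := sum_c M; lra.
Qed.

Let bounded_cvg_hump_sine_tail m : (0 < m)%N ->
  bounded_cvg (fun M t => hump_sum M t * sine_tail m t) (fun t => hump t * sine_tail m t).
Proof.
move=> m0; split.
- move=> M; apply: tameM; apply: continuous_tame; first exact: continuous_hump_sum.
  exact: continuous_sine_tail.
- move=> K; have [_ /(_ K) [C hC]] := continuous_tame (@continuous_sine_tail R m).
  exists (e 0 * C) => M t tK; rewrite normrM; apply: ler_pM => //; last exact: hC.
  exact: hump_sum_bound.
- by move=> t; apply: cvgMl; exact: cvg_hump.
Qed.

Lemma hump_integral k :
  2 ^+ k / 2 - 256 * lam 0%N <=
  (freq k)%:R * oint (fun t => hump t * sine_tail (freq k) t) 0 pi.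
Proof.
have h : (freq k)%:R * oint (fun t => hump_sum M t * sine_tail (freq k) t) 0 pi @[M --> \oo]
   --> (freq k)%:R * oint (fun t => hump t * sine_tail (freq k) t) 0 pi.
  apply: cvgMr; exact: (@bounded_cvg_oint _ _ _ 0 pi (bounded_cvg_hump_sine_tail (freq_gt0 k))).
rewrite -(cvg_lim (@Rhausdorff R) h); apply: limr_ge; first by apply/cvg_ex; eexists; exact: h.
by exists k.+1 => // M /= kM; exact: hump_sum_integral.
Qed.

Let g := periodize hump.
Let g_ M := periodize (hump_sum M).

Let gE x : - pi <= x <= pi *+ 2 -> g x = hump x.
Proof. exact: periodizeE hump_0 hump_pi. Qed.

Let g_E M x : - pi <= x <= pi *+ 2 -> g_ M x = hump_sum M x.
Proof. by apply: periodizeE => y; [exact: hump_sum_0|exact: hump_sum_pi]. Qed.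

Let pi2 : 0 < (pi : R) /\ (pi : R) < pi *+ 2.
Proof. by have := pi_gt0 R; rewrite mulr2n; split; lra. Qed.

Let g_V M : wvariation_le harm (g_ M) 0 (pi *+ 2)
  (\sum_(0 <= l < M) c l * (4 * \sum_(i < n l) @harm R i)).
Proof.
have [p0 p2] := pi2.
apply: (eq_wvariation_le (f := hump_sum M)) => [x /andP[x0 x1]|].
  by rewrite g_E // x1 andbT; lra.
by apply: hump_sum_variation; [exact: harm_ge0|exact: harmS|lra].
Qed.

Let g_cont M x : - pi < x < pi -> {for x, continuous (g_ M)}.
Proof.
have [p0 p2] := pi2; move=> /andP[x1 x2].
have h : hump_sum M y @[y --> x] --> g_ M x.
  by rewrite g_E; [exact: continuous_hump_sum|apply/andP; split; lra].
apply: cvg_trans h; apply: near_eq_cvg.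
have : \forall y \near x, y \in `]- pi, pi[.
  by apply: near_in_itvoo; rewrite in_itv /= x1.
apply: filterS => y; rewrite in_itv /= => /andP[y1 y2].
by apply/esym/g_E/andP; split; lra.
Qed.

Let g_loc a : 0 < a -> \forall M \near \oo, forall y, a <= `|y| <= pi -> g_ M y = g y.
Proof.
have [p0 p2] := pi2; move=> /hump_far; apply: filterS => M hM y /andP[ay].
rewrite ler_norml => /andP[y1 y2]; rewrite g_E ?gE ?hM //; apply/andP; split; lra.
Qed.

Lemma periodize_hump_LambdaBV : LambdaBV lam g.
Proof.
have [p0 p2] := pi2.
apply/(LambdaBVP _ lam_gt0 lam_homo); exists 8.
apply: (eq_wvariation_le (f := hump)) => [x /andP[x0 x1]|s fs].
  by rewrite gE // x1 andbT; lra.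
(* On a fixed family, replacing [hump] by [hump_sum M] costs at most [e M * S], which is as small as
   wanted. *)
pose S := wsum (fun i => (lam i)^-1) (fun=> 2) s.
have S0 : 0 <= S by apply: wsum_ge0 => // i; rewrite invr_ge0 ltW.
apply/ler_addgt0Pr => eps eps0.
have d0 : 0 < eps / (S + 1) by rewrite divr_gt0 //; lra.
have /cvgr0Pnorm_le /(_ _ d0) [M _ /(_ M (leqnn M))] := cvg_e.
rewrite /= ger0_norm // ler_pdivlMr; last lra.
move=> eM; apply: le_trans (_ : 8 + e M * S <= _); last first.
  by have := e_ge0 M; lra.
apply: le_trans (lerD (hump_sum_Lambda_variation M fs) (lexx _)).
rewrite -wsumZ -wsumD; apply: wsum_le => [i|I]; first by rewrite invr_ge0 ltW.
rewrite /incr (_ : hump I.2 - hump I.1 = (hump_sum M I.2 - hump_sum M I.1) +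
  ((hump I.2 - hump_sum M I.2) - (hump I.1 - hump_sum M I.1))); last by ring.
apply: le_trans (ler_normD _ _) _; rewrite lerD2l.
apply: le_trans (ler_normB _ _) _.
by have := hump_dist M I.2; have := hump_dist M I.1; lra.
Qed.

Lemma periodize_hump_tail m : (0 < m)%N ->
  iter_antiderivative 1 (fourier_tail g m) 0 =
  - pi^-1 * oint (fun t => hump t * sine_tail m t) 0 pi.
Proof.
move=> m0; have [p0 p2] := pi2.
apply: etrans (_ : zero_mean_antiderivative (fourier_tail g m) 0 = _); first by [].
have -> := @zero_mean_tail0 R g g_ _ e (e 0) (@periodize_periodic R hump)
  (fun M => @periodize_periodic R (hump_sum M)) g_V g_cont
  (fun M x => hump_sum_bound M _) (fun M x => hump_dist M _) cvg_e g_loc m m0.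
rewrite /sine_tail_mean; congr (_ * _); apply/esym/eq_oint_oo.
  exact: bounded_cvg_tame (bounded_cvg_hump_sine_tail m0).
move=> t; rewrite min_l ?max_r ?(ltW p0) // => /andP[t0 t1].
(* The hump vanishes on the negative side, so on [(0, pi)] the odd difference is [hump] itself. *)
rewrite add0r sub0r !gE; try by apply/andP; split; lra.
by rewrite (@hump_0 (- t)) ?subr0 //; lra.
Qed.

Lemma periodize_hump_not_tail_jump : ~ tail_jump_relation g 0 0.
Proof.
(* The candidate limit [L] is kept arbitrary: along [freq k] the sequence is unbounded, so it has no
   limit at all. *)
rewrite /tail_jump_relation; move: (_ * jump g 0) => L h.
have [p0 p2] := pi2.
have /cvgrPdist_le /(_ 1 ltr01) [N _ hN] := h.
pose X := 2 * (256 * lam 0%N + pi * (`|L| + 2)).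
pose k := (N + (Num.truncn X).+1)%N.
have Xk : X < 2 ^+ k.
  apply: lt_le_trans (truncnS_gt X) _; rewrite -natrX ler_nat.
  by apply: leq_trans (ltnW (ltn_expl k (ltnSn 1))); rewrite /k leq_addl.
have Nk : (N <= freq k)%N.
  apply: leq_trans (freq_exp k); apply: leq_trans (ltnW (ltn_expl k (ltnSn 1))).
  by rewrite /k leq_addr.
have : `|L - (freq k)%:R * iter_antiderivative 1 (fourier_tail g (freq k)) 0| <= 1 := hN _ Nk.
rewrite (periodize_hump_tail (freq_gt0 k)) mulrCA mulNr opprK; have := hump_integral k.
move: (_ * oint _ _ _) => J kJ hJ.
have J1 : pi * (`|L| + 2) <= J.
  apply: le_trans kJ; rewrite lerBrDr ler_pdivlMr // mulrC addrC; exact: ltW.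
have J2 : `|L| + 2 <= pi^-1 * J by rewrite ler_pdivlMl.
have := ler_norm (L + pi^-1 * J); have := ler_norm (- L); rewrite normrN.
by move: hJ; lra.
Qed.

Lemma periodize_hump_not_HBV : ~ @HBV R g.
Proof.
move=> /HBVP[V gV]; apply: periodize_hump_not_tail_jump.
exact: (HBV_tail_jump (@periodize_periodic R hump) gV).
Qed.

End Hump.

Theorem theorem2p1 (R : realType) :
  (forall (g : R -> R) (r : nat),
      periodic g (pi *+ 2) -> @HBV R g ->
      forall x0 : R, tail_jump_relation g r x0)
  /\
  (forall lam : nat -> R,
      Lambda_sequence lam ->
      @HBV R `<` LambdaBV lam ->
      exists (g : R -> R) (r : nat) (x0 : R),
        [/\ periodic g (pi *+ 2),
            LambdaBV lam g,
            ~ @HBV R g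
          & ~ tail_jump_relation g r x0]).
Proof.
split=> [g r gper /HBVP[V gV] x0|lam Llam HL].
  exact: (HBV_tail_jump gper gV).
have [lam_homo lam_gt0 _ _] := Llam.
have /choice [n n_large] : forall k : nat, exists m,
    4 ^+ k * \sum_(i < m) (lam i)^-1 < hsum R m.
  by move=> k; exact: hsum_ratio_unbounded.
exists (periodize (hump lam n)), 0%N, 0; split.
- exact: periodize_periodic.
- exact: periodize_hump_LambdaBV.
- exact: periodize_hump_not_HBV.
- exact: periodize_hump_not_tail_jump.
Qed.
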